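(* Consider the bipedal robot with inertial disc described in the context (a hybrid model with $N$ rigid links satisfying the listed robot hypotheses), and suppose that there exist functions $\mathbf{h}_r^{ref}(q_N)$, $V(q_N)>0$ and $S(q_N)$ with $\frac{\partial S}{\partial q_N}(q_N)\,V(q_N)=k_2(\mathbf{0},q_N)$ such that the manifolds $\mathcal{W}$ and $\mathcal{Z}$ are hybrid invariant. Let $\mathcal{P}$ be the Poincaré return map, on the impact surface $\mathcal{S}$, of the hybrid system in the coordinates $\mathbf{y}=(\mathbf{h}_r,\dot{\mathbf{h}}_r,b,c)$, with feedback parameters $K_P,K_V$ (positive definite) and $\beta_0,\gamma>0$. Then: (1) The Poincaré return map $\mathcal{P}$ is regular in some neighborhood $\mathcal{S}_{\mathcal{P}}\subset\mathcal{S}$ of $\mathbf{y}=\mathbf{0}$; that is, $\mathcal{P}:\mathcal{S}_{\mathcal{P}}\to\mathcal{S}$ is well defined there (every impact in $\mathcal{S}_{\mathcal{P}}$ is followed by at least one further impact). (2) The parameters $K_P$, $K_V$, $\beta_0$ and $\gamma$ can be chosen so that $\mathcal{P}$ is locally exponentially contracting in some neighborhood $\mathcal{S}_C\subset\mathcal{S}_{\mathcal{P}}$ of $\mathbf{y}=\mathbf{0}$; that is, there are constants $M\ge 1$ and $\lambda\in(0,1)$ such that for every $\mathbf{y}\in\mathcal{S}_C$ all iterates $\mathcal{P}^k(\mathbf{y})$, $k\ge 0$, are defined and $\|\mathcal{P}^k(\mathbf{y})\|\le M\lambda^k\|\mathbf{y}\|$.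
   Context: **Robot and hypotheses.** The robot is a planar chain of $N$ rigid links (known masses, centers of mass, inertias), one of them an inertial disc, connected by $N-1$ frictionless, independently actuated joints. There are at least one and at most two contact points with the ground (feet), which are punctual and unactuated. Walking takes place on a surface, in the sagittal plane, as alternating phases of single support (the stance foot is an ideal pivot) and instantaneous double support (impact). At impact the swing leg touches the ground with neither slip nor rebound, and the former stance leg releases without interaction. The coordinates are $\mathbf{q}=(q_d,\mathbf{q}_r,q_N)^T$, with $q_d\in\mathbb{R}$ the relative disc angle (a cyclic coordinate), $\mathbf{q}_r\in\mathbb{R}^{N-2}$ the relative angles of the rest of the body, and $q_N\in\mathbb{R}$ the only absolute angle. **Continuous phase.** $\mathbf{D}(\mathbf{q}_r)\ddot{\mathbf{q}}+\mathbf{C}(\mathbf{q}_r,\dot{\mathbf{q}}_r,\dot q_N)\dot{\mathbf{q}}+\mathbf{G}(\mathbf{q}_r,q_N)=\mathbf{B}(\mathbf{q}_r)\mathbf{u}$, with $\mathbf{u}\in\mathbb{R}^{N-1}$ the actuator torques ($\mathbf{D}$ inertia matrix, $\mathbf{C}$ Coriolis matrix, $\mathbf{G}$ gravity vector). The angular momentum is $\sigma_N=\mathbf{D}_N(\mathbf{q}_r)\dot{\mathbf{q}}$, with $\mathbf{D}_N$ the last row of $\mathbf{D}$; it satisfies $\dot\sigma_N=-\mathbf{G}_N(\mathbf{q}_r,q_N)$, with $\mathbf{G}_N$ the last entry of $\mathbf{G}$. Put $\omega=(\sigma_N,\dot{\mathbf{q}}_r,\dot q_N)^T$, which is related to $\dot{\mathbf{q}}$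 by a diffeomorphism. The state is $\mathbf{x}=(\mathbf{q},\omega)^T$, in the set $\mathcal{X}\subset\mathbb{R}^{2N}$ of valid states, and the continuous phase is written $\dot{\mathbf{x}}=\mathbf{f}(\mathbf{x})+\mathbf{g}(\mathbf{x})\mathbf{u}$. All data are smooth. **Impact.** $\mathcal{S}=\{\mathbf{x}\in\mathcal{X}: p_2(\mathbf{q})=0,\ \dot p_2(\mathbf{x})<0\}$, where $p_2(\mathbf{q})\ge 0$ is e.g. the height of the swing foot (a function of $\mathbf{q}_r,q_N$), with $\dot p_2(\mathbf{x}^+)>0$ and $\dot p_2(\mathbf{x}^-)<0$. The walking gait is assumed transversal to the impact surface. At impact $\mathbf{x}^+=\Delta(\mathbf{x}^-)=(\Delta_{\mathbf{q}}\mathbf{q}^-,\ \Delta_\omega(\mathbf{q}_r^-,q_N^-)\omega^-)$, where $\Delta_{\mathbf{q}}$ is a constant involutive matrix and $\Delta_\omega$ is a matrix function whose first column is $(1,0,\dots,0)^T$. Superscripts $-$ and $+$ denote values just before and just after impact. The hybrid model is $\dot{\mathbf{x}}=\mathbf{f}(\mathbf{x})+\mathbf{g}(\mathbf{x})\mathbf{u}$ for $\mathbf{x}\notin\mathcal{S}$, and $\mathbf{x}^+=\Delta(\mathbf{x}^-)$ for $\mathbf{x}^-\in\mathcal{S}$. **Reference functions and manifolds.** $\mathbf{h}_r^{ref}(q_N)\in\mathbb{R}^{N-2}$ is the desired value of $\mathbf{q}_r$; $\mathbf{h}_r=\mathbf{q}_r-\mathbf{h}_r^{ref}(q_N)$;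 $k_2(\mathbf{h}_r,q_N)=-\mathbf{G}_N(\mathbf{h}_r+\mathbf{h}_r^{ref}(q_N),q_N)$, so $\dot\sigma_N=k_2(\mathbf{h}_r,q_N)$. $V(q_N)>0$ and $S(q_N)$ are the references for $\dot q_N$ and $\sigma_N$, related by $\frac{\partial S}{\partial q_N}V=k_2(\mathbf{0},q_N)$. There is a bounded function $\mathbf{f}_2$ with $k_2(\mathbf{h}_r,q_N)-\frac{\partial S}{\partial q_N}V=\langle\mathbf{h}_r,\mathbf{f}_2(\mathbf{h}_r,q_N)\rangle$. With positive constants $\gamma,\beta_0$, define $$b=\sigma_N-S(q_N),\qquad c=\dot q_N-V(q_N)-\frac{\gamma}{\beta_0}\frac{\partial S}{\partial q_N}b,$$ $$\mathcal{W}=\{\mathbf{x}\in\mathcal{X}:\mathbf{h}_r=0,\ \dot{\mathbf{h}}_r=0\},\qquad \mathcal{Z}=\{\mathbf{x}\in\mathcal{W}: b=0,\ c=0\}.$$ A manifold $\mathcal{M}$ is forward invariant if solutions (of the continuous closed-loop dynamics) starting in $\mathcal{M}$ remain in $\mathcal{M}$; impact invariant if $\mathcal{M}\cap\mathcal{S}\ne\emptyset$ and $\Delta(\mathcal{M}\cap\mathcal{S})\subset\mathcal{M}$; hybrid invariant if both. On the nominal step, $q_N$ goes monotonically from $\bar q_N^+$ to $\bar q_N^->\bar q_N^+$. **Closed loop.** Use a linearizing input giving $\ddot{\mathbf{h}}_r=\mathbf{v}_r$, $\ddot q_N=v_N$, with $$\mathbf{v}_r=-K_P\mathbf{h}_r-K_V\dot{\mathbf{h}}_r,\qquad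 v_N=\frac{\partial V}{\partial q_N}\dot q_N+\gamma\frac{\partial S}{\partial q_N}b-\beta_0(\dot q_N-V)+\frac{d}{dt}\Big(\frac{\gamma}{\beta_0}\frac{\partial S}{\partial q_N}b\Big),$$ where $K_P,K_V$ are positive definite. In the coordinates $\mathbf{y}=(\mathbf{h}_r,\dot{\mathbf{h}}_r,b,c)^T\in\mathbb{R}^{2N-2}$, with $q_N$ (monotonic in the continuous phase) as independent variable, the continuous phase is $$\frac{d\mathbf{y}}{dq_N}=\xi\begin{pmatrix}\dot{\mathbf{h}}_r\\ -K_P\mathbf{h}_r-K_V\dot{\mathbf{h}}_r\\ \langle\mathbf{h}_r,\mathbf{f}_2\rangle-\frac{\partial S}{\partial q_N}c-\frac{\gamma}{\beta_0}\big(\frac{\partial S}{\partial q_N}\big)^2 b\\ -\beta_0 c\end{pmatrix},\qquad \xi=\Big(c+V+\frac{\gamma}{\beta_0}\frac{\partial S}{\partial q_N}b\Big)^{-1}.$$ The impact map $\mathbf{y}^+=\Delta_{\mathbf{y}}(\mathbf{y}^-)$ is $\Delta$ expressed in the coordinates $\mathbf{y}$ (the disc angle $q_d$ being discarded); the pre- and post-impact values $q_N^-$ and $q_N^+$ ($q_N^+<q_N^-$) are determined by the impact condition $p_2=0$ and by $\mathbf{q}^+=\Delta_{\mathbf{q}}\mathbf{q}^-$. Points of $\mathcal{S}$ near $\mathcal{Z}\cap\mathcal{S}$ are described by $\mathbf{y}$, and $\mathcal{Z}\cap\mathcal{S}$ corresponds to $\mathbf{y}=\mathbf{0}$. **Poincaré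 map.** $\mathcal{P}(\mathbf{y})=\varphi_{\mathbf{y}}(q_N^+,q_N^-,\Delta_{\mathbf{y}}(\mathbf{y}))$, where $\varphi_{\mathbf{y}}(q_N^+,q_N^-,\mathbf{y}_0)$ is the value at $q_N=q_N^-$ (the next impact) of the solution of the continuous phase starting at $\mathbf{y}_0$ at $q_N=q_N^+$. It satisfies $\mathcal{P}(\mathbf{0})=\mathbf{0}$.
   Formalization: Part (2) additionally assumes that k_2(0,q_N) is not identically zero on the nominal step [q_N^+, q_N^-]; otherwise S is constant there and every small y=(0,0,b,0) is a fixed point of P for all parameters, so P is never contracting. *)

(* Defs.v *)
From HB Require Import structures.
From mathcomp Require Import all_boot all_order all_algebra.
From mathcomp Require Import all_classical all_reals all_analysis.
Set Implicit Arguments.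
Unset Strict Implicit.
Unset Printing Implicit Defensive.
Import Order.TTheory GRing.Theory Num.Theory.
Import numFieldNormedType.Exports.
Local Open Scope classical_set_scope.
Local Open Scope ring_scope.

(* In finite dimension, having continuous iterated directional derivatives of
   all orders is the same as being C^infinity. *)
Fixpoint Ck (R : realType) (U W : normedModType R) (k : nat) (f : U -> W) :
    Prop :=
  continuous f /\
  if k is k'.+1 then
    (forall x v, derivable f x v) /\ (forall v, Ck k' (fun x => 'D_v f x))
  else True.

Definition smooth (R : realType) (U W : normedModType R) (f : U -> W) : Prop :=
  forall k, Ck k f.

Definition posdef (R : realType) (m : nat) (K : 'M[R]_m) : Prop :=
  K^T = K /\ forall v : 'cV[R]_m, v != 0 -> 0 < (v^T *m K *m v) 0 0.

(* The number of links is N = n + 2.  Vectors of R^N are split as 1 + n + 1: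
   q = (q_d, q_r, q_N) and omega = (sigma_N, qdot_r, qdot_N). *)
Section Blocks.
Context (R : realType) (n : nat).

Definition ifst : 'I_(1 + n + 1) := lshift 1 (lshift n ord0).
Definition ilst : 'I_(1 + n + 1) := rshift (1 + n) ord0.

Definition stack (a : R) (v : 'cV[R]_n) (b : R) : 'cV[R]_(1 + n + 1) :=
  col_mx (col_mx a%:M v) b%:M.
Definition bfst (w : 'cV[R]_(1 + n + 1)) : R := w ifst 0.
Definition bmid (w : 'cV[R]_(1 + n + 1)) : 'cV[R]_n := dsubmx (usubmx w).
Definition blst (w : 'cV[R]_(1 + n + 1)) : R := w ilst 0.

Definition inner (u v : 'cV[R]_n) : R := (u^T *m v) 0 0.

(* x = (q, omega) in R^(2N) *)
Definition state : Type := ('cV[R]_(1 + n + 1) * 'cV[R]_(1 + n + 1))%type.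
Definition qr (x : state) := bmid x.1.
Definition qN (x : state) := blst x.1.
Definition sigma (x : state) := bfst x.2.
Definition qr' (x : state) := bmid x.2.
Definition qN' (x : state) := blst x.2.

(* y = (h_r, hdot_r, b, c) in R^(2N-2) *)
Definition ycoord : Type := ('cV[R]_n * 'cV[R]_n * R * R)%type.

End Blocks.
Arguments ifst {n}.
Arguments ilst {n}.

(* That q_d is a cyclic coordinate, and that it can be discarded, is built into
   the types: no function below takes q_d as an argument. *)
Record robot (R : realType) (n : nat) := Robot {
  inertia  : 'cV[R]_n -> 'M[R]_(1 + n + 1) ;
  coriolis : 'cV[R]_n * 'cV[R]_n * R -> 'M[R]_(1 + n + 1) ;
  gravity  : 'cV[R]_n * R -> 'cV[R]_(1 + n + 1) ;
  actuation : 'cV[R]_n -> 'M[R]_(1 + n + 1, 1 + n) ;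
  p2       : 'cV[R]_n * R -> R ;
  impact_q : 'M[R]_(1 + n + 1) ;
  impact_w : 'cV[R]_n * R -> 'M[R]_(1 + n + 1) ;
  (* constraints on (q_r, q_N, omega), other than p_2 >= 0, that define the
     valid states *)
  dom      : set ('cV[R]_n * R * 'cV[R]_(1 + n + 1)) }.

Record references (R : realType) (n : nat) := References {
  href : R -> 'cV[R]_n ;
  Vref : R -> R ;
  Sref : R -> R ;
  f2   : 'cV[R]_n -> R -> 'cV[R]_n }.

Record gains (R : realType) (n : nat) := Gains {
  KP : 'M[R]_n ;
  KV : 'M[R]_n ;
  beta0 : R ;
  gamma : R }.

Definition admissible (R : realType) (n : nat) (g : gains R n) : Prop :=
  [/\ posdef (KP g), posdef (KV g), 0 < beta0 g & 0 < gamma g].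

Section Robot.
Context (R : realType) (n : nat) (rb : robot R n).
Local Notation state := (state R n).

Definition valid : set state :=
  [set x | dom rb (qr x, qN x, x.2) /\ 0 <= p2 rb (qr x, qN x)].

Definition p2dot (x : state) : R :=
  'D_(qr' x, qN' x) (p2 rb) (qr x, qN x).

Definition surface : set state :=
  [set x | [/\ valid x, p2 rb (qr x, qN x) = 0 & p2dot x < 0]].

Definition impact (x : state) : state :=
  (impact_q rb *m x.1, impact_w rb (qr x, qN x) *m x.2).

(* omega = (D_N(q_r) qdot, qdot_r, qdot_N) along a motion t |-> q(t) *)
Definition state_at (q : R -> 'cV[R]_(1 + n + 1)) (t : R) : state :=
  let dq := derive1 q t in
  (q t, stack ((inertia rb (bmid (q t)) *m dq) ilst 0) (bmid dq) (blst dq)).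

Definition continuous_phase (a b : R) (q : R -> 'cV[R]_(1 + n + 1))
    (u : R -> 'cV[R]_(1 + n)) : Prop :=
  forall t, a < t < b ->
  [/\ derivable q t 1, derivable (derive1 q) t 1 &
      inertia rb (bmid (q t)) *m (derive1 (derive1 q) t)
      + coriolis rb (bmid (q t), bmid (derive1 q t), blst (derive1 q t))
        *m (derive1 q t)
      + gravity rb (bmid (q t), blst (q t))
      = actuation rb (bmid (q t)) *m u t].

Record robot_hyp : Prop := RobotHyp {
  inertia_smooth : smooth (inertia rb) ;
  coriolis_smooth : smooth (coriolis rb) ;
  gravity_smooth : smooth (gravity rb) ;
  actuation_smooth : smooth (actuation rb) ;
  p2_smooth : smooth (p2 rb) ;
  impact_w_smooth : smooth (impact_w rb) ;
  dom_open : open (dom rb) ;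
  inertia_posdef : forall v, posdef (inertia rb v) ;
  (* q' |-> omega is invertible *)
  inertia_disc : forall v, inertia rb v ilst ifst != 0 ;
  (* all N - 1 joints are independently actuated *)
  actuation_rank : forall v, \rank (actuation rb v) = (1 + n)%N ;
  momentum_balance : forall a b q u, continuous_phase a b q u ->
    forall t, a < t < b ->
    is_derive t 1 (fun s => sigma (state_at q s))
      (- blst (gravity rb (bmid (q t), blst (q t)))) ;
  impact_q_involutive : impact_q rb *m impact_q rb = 1%:M ;
  (* (q_r, q_N) after impact does not depend on q_d *)
  impact_q_disc : forall i, i != ifst -> impact_q rb i ifst = 0 ;
  impact_w_col : forall z i, impact_w rb z i ifst = (i == ifst)%:R ;
  (* both feet are on the ground at impact, then the former stance leg is
     released *)
  impact_release : forall x, surface x ->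
    p2 rb (qr (impact x), qN (impact x)) = 0 /\ 0 < p2dot (impact x) }.

Context (rf : references R n).

Definition k2 (h : 'cV[R]_n) (s : R) : R :=
  - blst (gravity rb (h + href rf s, s)).

Record references_hyp : Prop := ReferencesHyp {
  href_smooth : smooth (href rf) ;
  Vref_smooth : smooth (Vref rf) ;
  Sref_smooth : smooth (Sref rf) ;
  Vref_gt0 : forall s, 0 < Vref rf s ;
  Sref_eq : forall s, derive1 (Sref rf) s * Vref rf s = k2 0 s ;
  f2_bounded : exists M : R, forall h s, `|f2 rf h s| <= M ;
  f2_eq : forall h s,
    k2 h s - derive1 (Sref rf) s * Vref rf s = inner h (f2 rf h s) }.

Definition hr (x : state) : 'cV[R]_n := qr x - href rf (qN x).
Definition hr' (x : state) : 'cV[R]_n :=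
  qr' x - qN' x *: derive1 (href rf) (qN x).
Definition bvar (x : state) : R := sigma x - Sref rf (qN x).

Context (g : gains R n).

Definition cvar (x : state) : R :=
  qN' x - Vref rf (qN x)
  - gamma g / beta0 g * derive1 (Sref rf) (qN x) * bvar x.

Definition Wman : set state := [set x | [/\ valid x, hr x = 0 & hr' x = 0]].

Definition Zman : set state :=
  [set x | [/\ Wman x, bvar x = 0 & cvar x = 0]].

Definition vr (x : state) : 'cV[R]_n := - (KP g *m hr x) - KV g *m hr' x.

Definition closed_loop (a b : R) (q : R -> 'cV[R]_(1 + n + 1)) : Prop :=
  (exists u, continuous_phase a b q u) /\
  forall t, a < t < b ->
  let x := state_at q in
  derive1 (derive1 (fun s => hr (x s))) t = vr (x t) /\
  derive1 (derive1 (fun s => qN (x s))) t =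
    derive1 (Vref rf) (qN (x t)) * qN' (x t)
    + gamma g * derive1 (Sref rf) (qN (x t)) * bvar (x t)
    - beta0 g * (qN' (x t) - Vref rf (qN (x t)))
    + derive1 (fun s => gamma g / beta0 g * derive1 (Sref rf) (qN (x s))
                        * bvar (x s)) t.

(* The continuous phase lasts only as long as the state is valid. *)
Definition forward_invariant (M : set state) : Prop :=
  forall a b q, closed_loop a b q ->
  forall t0 t1, a < t0 -> t0 <= t1 -> t1 < b ->
  (forall t, t0 <= t <= t1 -> valid (state_at q t)) ->
  M (state_at q t0) -> M (state_at q t1).

Definition impact_invariant (M : set state) : Prop :=
  M `&` surface !=set0 /\ impact @` (M `&` surface) `<=` M.

Definition hybrid_invariant (M : set state) : Prop :=
  forward_invariant M /\ impact_invariant M.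

(* The point of the orbit h_r = hdot_r = 0, b = c = 0 (with q_d = 0) *)
Definition nominal (s : R) : state :=
  (stack 0 (href rf s) s,
   stack (Sref rf s) (Vref rf s *: derive1 (href rf) s) (Vref rf s)).

(* The swing foot is off the ground strictly between the two impacts. *)
Definition nominal_step (qp qm : R) : Prop :=
  [/\ surface (nominal qm),
      qN (impact (nominal qm)) = qp,
      qp < qm,
      forall s, qp <= s <= qm -> valid (nominal s) &
      forall s, qp < s < qm -> 0 < p2 rb (href rf s, s)].

(* The value of qdot_N at q_N = s, in terms of b and c *)
Definition rate (s b c : R) : R :=
  c + Vref rf s + gamma g / beta0 g * derive1 (Sref rf) s * b.

Definition y_of_state (x : state) : ycoord R n :=
  (hr x, hr' x, bvar x, cvar x).

(* Inverse of x |-> (q_N, y), with the irrelevant q_d set to 0 *)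
Definition state_of_y (s : R) (y : ycoord R n) : state :=
  let: (h, h', b, c) := y in
  (stack 0 (h + href rf s) s,
   stack (b + Sref rf s) (h' + rate s b c *: derive1 (href rf) s)
         (rate s b c)).

Definition y_field (s : R) (y : ycoord R n) : ycoord R n :=
  let: (h, h', b, c) := y in
  let dS := derive1 (Sref rf) s in
  let xi := (rate s b c)^-1 in
  (xi *: h',
   xi *: (- (KP g *m h) - KV g *m h'),
   xi * (inner h (f2 rf h s) - dS * c - gamma g / beta0 g * dS ^+ 2 * b),
   xi * (- (beta0 g) * c)).

(* dy/dq_N = y_field on [s0, s1], q_N being increasing in time *)
Definition y_solution (s0 s1 : R) (Y : R -> ycoord R n) : Prop :=
  [/\ {within `[s0, s1], continuous Y},
      forall s, s0 < s < s1 -> is_derive s 1 Y (y_field s (Y s)) &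
      forall s, s0 <= s <= s1 -> 0 < rate s (Y s).1.2 (Y s).2].

(* The impact surface modulo q_d.  Near the nominal impact its points (q_N, y)
   are determined by y, since q_N solves p_2(h_r + h_ref(q_N), q_N) = 0. *)
Definition y_surface : set (R * ycoord R n) :=
  [set z | surface (state_of_y z.1 z.2)].

(* z = (q_N^-, y^-) is mapped by the impact to (q_N^+, y^+), and from there the
   continuous phase first reaches the impact surface at z'. *)
Definition poincare (z z' : R * ycoord R n) : Prop :=
  let xp := impact (state_of_y z.1 z.2) in
  [/\ y_surface z, y_surface z', qN xp < z'.1 &
      exists Y : R -> ycoord R n,
      [/\ y_solution (qN xp) z'.1 Y,
          Y (qN xp) = y_of_state xp,
          Y z'.1 = z'.2,
          forall s, qN xp <= s <= z'.1 -> valid (state_of_y s (Y s)) &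
          forall s, qN xp <= s < z'.1 -> ~ surface (state_of_y s (Y s))]].

(* Neighborhoods of y = 0 in the impact surface *)
Definition surface_nbhd (qm : R) (A : set (R * ycoord R n)) : Prop :=
  A `<=` y_surface /\ within y_surface (nbhs (qm, 0 : ycoord R n)) A.

Definition regular_on (qm : R) (SP : set (R * ycoord R n)) : Prop :=
  surface_nbhd qm SP /\ forall z, SP z -> exists! z', poincare z z'.

Definition contracting_on (qm : R) (SP SC : set (R * ycoord R n)) : Prop :=
  [/\ surface_nbhd qm SC, SC `<=` SP &
      exists M lambda : R, [/\ 1 <= M, 0 < lambda < 1 &
        forall z, SC z -> exists zs : nat -> R * ycoord R n,
          [/\ zs 0%N = z,
              forall k, SP (zs k) /\ poincare (zs k) (zs k.+1) &
              forall k, `|(zs k).2| <= M * lambda ^+ k * `|z.2|]]].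

End Robot.

(* Main.v *)
(* Near the nominal orbit y = 0 the field dy/dq_N is locally Lipschitz, so
   solutions exist and stay small over the whole step. The height p_2 of the
   swing foot vanishes at the start with positive derivative, is bounded below
   in the middle of the step and crosses 0 transversally near q_N^-, hence each
   impact near y = 0 is followed by exactly one first next impact.

   For the contraction put eps = gamma / beta0. By impact invariance of W and Z
   the impact maps (h, h') = 0 to itself and there
   b^+ = b + A (c + eps S'(q_N^-) b) with a constant A, so that b is amplified
   by a factor at most linear in eps, whereas the continuous phase multiplies b
   by exp(- eps int S'^2 / V), up to terms in c and h. As S' is not identically
   0, some large eps makes the product small. Then beta0 is taken large, which
   damps c and its influence on b, and finally K_P = 2 k^2, K_V = 3 k with k
   large, which damps (h, h'). Since the bound on the next (h, h') involves
   (h, h') only, the return map contracts max(|b|, |c|, L |(h, h')|) for L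
   large. *)
Require Import Defs.
From mathcomp Require Import all_boot all_order all_algebra.
From mathcomp Require Import all_classical all_reals all_analysis.
From mathcomp Require Import ring lra.
Set Implicit Arguments.
Unset Strict Implicit.
Unset Printing Implicit Defensive.
Import Order.TTheory GRing.Theory Num.Theory.
Import numFieldNormedType.Exports.
Local Open Scope classical_set_scope.
Local Open Scope ring_scope.

(** * Calculus of curves *)

(** The return map is never differentiated. Return points come from Lipschitz bounds and from signs
    of the height, and the contraction comes from scalar differential inequalities along the actual
    solutions.

    Invariance of W and Z constrains the impact only where [h = h' = 0]. Elsewhere an impact point
    is compared with its projection [(qm, (0, 0, b, c))]: since [p_2] depends on [q_N] and [h] only,
    transversality bounds [|q_N - qm|] by a multiple of [|h|], and the projection costs a multiple
    of [|(h, h')|].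

    The gains can be fixed one after the other because the impact in the coordinates [y] depends on
    them only through [eps]; enlarging [beta0] and [k] afterwards acts on the flow alone. Invariance
    of Z for one choice of gains serves for all of them, since at [b = 0] the variable [c] is just
    [qN' - V].

    If [S'] vanished on the whole step, points with only [b] nonzero and small would be fixed by the
    return map for all gains. This is why contraction is claimed under the premise that [k2 rb rf 0]
    is not identically 0 there. *)

Section Clamp.
Context (R : realType).
Implicit Types a b t : R.

(** Extends a curve given on a segment by constants, so that continuity can be required on the whole
    line. *)
Definition clamp a b t := Num.max a (Num.min t b).

Lemma clampK a b t : a <= t <= b -> clamp a b t = t.
Proof. by move=> /andP[? ?]; rewrite /clamp min_l// max_r. Qed.

Lemma clamp_itv a b t : a <= b -> a <= clamp a b t <= b.
Proof. by move=> ab; rewrite /clamp le_max lexx/= ge_max ab ge_min lexx orbT. Qed.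

Lemma continuous_clamp a b : continuous (clamp a b).
Proof.
move=> t; rewrite /clamp.
apply: (@continuous_max _ _ (fun=> a) (fun s => Num.min s b) t).
  exact: cvg_cst.
by apply: (@continuous_min _ _ id (fun=> b) t); [exact: cvg_id|exact: cvg_cst].
Qed.

Lemma within_clamp (T : topologicalType) a b (f : R -> T) : a <= b ->
  {within `[a, b], continuous f} -> continuous (f \o clamp a b).
Proof.
move=> ab /subspace_continuousP fc t U /=.
have ct : `[a, b]%classic (clamp a b t) by rewrite /= in_itv/= clamp_itv.
move=> /(fc _ ct) fU; have := @continuous_clamp a b t _ fU.
move=> H; apply: (@filterS _ (nbhs t) _ _ _ _ H) => s /=.
by apply; rewrite in_itv/= clamp_itv.
Qed.

End Clamp.

Lemma continuous_pair (T U V : topologicalType) (f : T -> U) (g : T -> V) t :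
  {for t, continuous f} -> {for t, continuous g} ->
  {for t, continuous (fun s => (f s, g s))}.
Proof. by move=> fc gc; exact: cvg_pair. Qed.

Lemma continuous_comp_at (T U V : topologicalType) (f : T -> U) (g : U -> V) t :
  {for t, continuous f} -> {for (f t), continuous g} ->
  {for t, continuous (fun s => g (f s))}.
Proof. exact: continuous_comp. Qed.

Section Derivatives.
Context (R : realType).

Lemma is_deriveP (U W : normedModType R) (f : U -> W) x v d :
  is_derive x v f d <->
  h^-1 *: (f (h *: v + x) - f x) @[h --> 0^'] --> d.
Proof.
split=> [[df <-]|fd]; first exact: df.
by split; [apply/cvg_ex; exists d|exact/cvg_lim].
Qed.

Lemma is_derive_pair (U V W : normedModType R) (f : U -> V) (g : U -> W)
    (x v : U) df dg : is_derive x v f df -> is_derive x v g dg ->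
  is_derive x v (fun y => (f y, g y)) (df, dg).
Proof.
move=> /is_deriveP fd /is_deriveP gd; apply/is_deriveP.
exact: (cvg_pair fd gd).
Qed.

Lemma is_derive_fst (U V W : normedModType R) (f : U -> V * W)
    (x v : U) d : is_derive x v f d -> is_derive x v (fun y => (f y).1) d.1.
Proof.
move=> /is_deriveP fd; apply/is_deriveP.
exact: (cvg_comp _ fst fd cvg_fst).
Qed.

Lemma is_derive_snd (U V W : normedModType R) (f : U -> V * W)
    (x v : U) d : is_derive x v f d -> is_derive x v (fun y => (f y).2) d.2.
Proof.
move=> /is_deriveP fd; apply/is_deriveP.
exact: (cvg_comp _ snd fd cvg_snd).
Qed.

Lemma is_derive_mx (U : normedModType R) m n (f : U -> 'M[R]_(m, n))
    (x v : U) d : is_derive x v f d <->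
  forall i j, is_derive x v (fun y => f y i j) (d i j).
Proof.
split=> [[fv <-] i j|fd].
  by split; [exact: ((derivable_mxP f x v).1 fv)|rewrite derive_mx// mxE].
have fv : derivable f x v by apply/derivable_mxP => i j; have [] := fd i j.
split=> //; rewrite derive_mx//; apply/matrixP => i j; rewrite mxE.
exact: derive_val.
Qed.

Lemma is_derive_clamp (W : normedModType R) (f : R -> W) (a b t : R) d :
  a < t < b -> is_derive t 1 f d -> is_derive t 1 (f \o clamp a b) d.
Proof.
move=> tab; apply: near_eq_is_derive.
have : t \in `]a, b[ by rewrite in_itv.
move=> /near_in_itvoo; apply: filterS => s; rewrite in_itv/= => /andP[sa sb].
by rewrite /= clampK// !ltW.
Qed.

Lemma prod_norm_leP (V W : normedModType R) (x : V * W) (M : R) :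
  `|x| <= M <-> `|x.1| <= M /\ `|x.2| <= M.
Proof. by rewrite prod_normE ge_max; split=> [/andP|] // [-> ->]. Qed.

Lemma mx_norm_leP m n (x : 'M[R]_(m, n)) (M : R) : 0 <= M ->
  `|x| <= M <-> forall i j, `|x i j| <= M.
Proof.
move=> M0; rewrite [leLHS]/Num.Def.normr/= mx_normrE; split=> [xM i j|xM].
  by apply: le_trans xM; exact: (le_bigmax _ (fun i => `|x i.1 i.2|) (i, j)).
by apply: bigmax_le => // -[i j] _; exact: xM.
Qed.

Lemma cvg_mx (T : Type) (F : set_system T) {FF : Filter F} m n (f : T -> 'M[R]_(m, n))
    (l : 'M[R]_(m, n)) :
  (forall i j, f x i j @[x --> F] --> l i j) -> f @ F --> l.
Proof.
move=> fl; apply/cvgrPdist_le => e e0.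
have : \forall x \near F, forall ij : 'I_m * 'I_n, `|l ij.1 ij.2 - f x ij.1 ij.2| <= e.
  by apply: filter_forall => -[i j]; exact: ((cvgrPdist_le _ _).1 (fl i j)).
apply: filterS => x H; apply/mx_norm_leP; first exact: ltW.
by move=> i j; rewrite !mxE; exact: (H (i, j)).
Qed.

End Derivatives.

Section Nice.
Context (R : realType).

(* These three properties pass to products and to matrices because the norms
   there are maxima of the norms of the components. *)
Record nice (V : normedModType R) : Prop := Nice {
  nice_limit : forall (u : nat -> V) (C : R),
    (forall k, `|u k.+1 - u k| <= C * 2^-1 ^+ k) ->
    exists l, forall k, `|l - u k| <= 2 * C * 2^-1 ^+ k ;
  nice_mean_value : forall (a b : R) (f df : R -> V) (p dp : R -> R), a <= b ->
    continuous f -> continuous p ->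
    (forall t, a < t < b -> is_derive t 1 f (df t)) ->
    (forall t, a < t < b -> is_derive t 1 p (dp t)) ->
    (forall t, a < t < b -> `|df t| <= dp t) -> `|f b - f a| <= p b - p a ;
  nice_primitive : forall (a b : R) (f : R -> V), a < b -> continuous f ->
    exists F, [/\ continuous F, F a = 0,
      forall t, a < t < b -> is_derive t 1 F (f t) &
      forall t, F (clamp a b t) = F t] }.

(** The intervals with center [u k] and radius [2 C 2^-k], the sum of the remaining steps, are
    nested; the supremum of their left ends lies in each of them. *)
Lemma geometric_limit (u : nat -> R) (C : R) :
  (forall k, `|u k.+1 - u k| <= C * 2^-1 ^+ k) ->
  exists l, forall k, `|l - u k| <= 2 * C * 2^-1 ^+ k.
Proof.
move=> uC.
have dist k j : `|u (k + j)%N - u k| <= 2 * C * 2^-1 ^+ k * (1 - 2^-1 ^+ j).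
  elim: j => [|j IH]; first by rewrite addn0 subrr normr0 expr0 subrr mulr0.
  have := uC (k + j)%N; rewrite addnS exprD exprS => H.
  rewrite (le_trans (ler_distD (u (k + j)%N) _ _))// .
  rewrite (le_trans (lerD H IH))//.
  set x := 2^-1 ^+ k; set y := 2^-1 ^+ j.
  by lra.
have C0 : 0 <= C by have := le_trans (normr_ge0 _) (uC 0%N); rewrite mulr1.
have h0 k : 0 <= 2 * C * 2^-1 ^+ k by rewrite !mulr_ge0// exprn_ge0// invr_ge0.
pose a k := u k - 2 * C * 2^-1 ^+ k; pose b k := u k + 2 * C * 2^-1 ^+ k.
have mono k j : a k <= a (k + j)%N /\ b (k + j)%N <= b k.
  rewrite /a /b exprD; have := dist k j.
  rewrite ler_distl => /andP[]; split; lra.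
have ab k j : a k <= b j.
  have [kj _] := mono k j; have [_ jk] := mono j k.
  apply: (le_trans kj); apply: le_trans jk; rewrite addnC /a /b.
  by rewrite lerD2l ge0_cp.
have sup_a : has_sup (range a).
  by split; [exists (a 0%N), 0%N|exists (b 0%N) => _ [k _ <-]].
exists (sup (range a)) => k; rewrite ler_distl; apply/andP; split.
  by apply: (sup_upper_bound sup_a); exists k.
by apply: ge_sup; [exists (a 0%N), 0%N|move=> _ [j _ <-]; exact: ab].
Qed.

(** The mean value theorem for [p - f] and for [p + f], whose derivatives are nonnegative. *)
Lemma mean_value_scalar (a b : R) (f df p dp : R -> R) : a <= b ->
  continuous f -> continuous p ->
  (forall t, a < t < b -> is_derive t 1 f (df t)) ->
  (forall t, a < t < b -> is_derive t 1 p (dp t)) ->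
  (forall t, a < t < b -> `|df t| <= dp t) -> `|f b - f a| <= p b - p a.
Proof.
rewrite le_eqVlt => /predU1P[->|ab] fc pc fd pd H.
  by rewrite !subrr normr0.
have [t tab] : exists2 t, t \in `]a, b[%R &
    (p - f) b - (p - f) a = (dp t - df t) * (b - a).
  apply: MVT => // [t|]; last first.
    by apply: continuous_subspaceT => t; apply: continuousB; [exact: pc|exact: fc].
  by rewrite in_itv/= => tab; apply: is_deriveB; [exact: pd|exact: fd].
have [s sab] : exists2 t, t \in `]a, b[%R &
    (p + f) b - (p + f) a = (dp t + df t) * (b - a).
  apply: MVT => // [t'|]; last first.
    by apply: continuous_subspaceT => t'; apply: continuousD; [exact: pc|exact: fc].
  by rewrite in_itv/= => ?; apply: is_deriveD; [exact: pd|exact: fd].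
rewrite -![(_ + _) _]/(_ + _) -![(- _) _]/(- _) => E2 E1.
move: tab sab; rewrite !in_itv/= => /H + /H.
rewrite !ler_norml => /andP[_ Ht] /andP[Hs _].
have t0 : 0 <= (dp t - df t) * (b - a) by rewrite mulr_ge0// subr_ge0// ltW.
have s0 : 0 <= (dp s + df s) * (b - a).
  by apply: mulr_ge0; [rewrite -lerBlDr sub0r lerNl|rewrite subr_ge0 ltW].
by apply/andP; split; lra.
Qed.

Lemma primitive_scalar (a b : R) (f : R -> R) : a < b -> continuous f ->
  exists F, [/\ continuous F, F a = 0,
    forall t, a < t < b -> is_derive t 1 F (f t) &
    forall t, F (clamp a b t) = F t].
Proof.
move=> ab fc.
(* The integral starts at [a - 1] so that [G] is differentiable, hence continuous, at [a] as
   well. *)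
pose G := fun t : R => (\int[lebesgue_measure]_(s in `[a - 1, t]) f s)%R.
have dG t : a - 1 < t < b + 1 -> is_derive t 1 G (f t).
  move=> /andP[at1 tb1].
  have /= [dG dGE] : derivable G t 1 /\ G^`()%classic t = f t.
    apply: (continuous_FTC1_closed (u := b + 1)) => //; last exact: fc.
    apply: continuous_compact_integrable; first exact: segment_compact.
    exact: continuous_subspaceT.
  by split; [exact: dG|rewrite -derive1E; exact: dGE].
have cG : {within `[a, b], continuous G}.
  apply: derivable_within_continuous => t; rewrite in_itv/= => /andP[ta tb].
  by have [] := dG t; first by apply/andP; split; lra.
have ab' := ltW ab.
exists (fun t => G (clamp a b t) - G a); split.
- by move=> t; apply: cvgB; [exact: (within_clamp ab' cG)|exact: cvg_cst].
- by rewrite clampK ?subrr// lexx.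
- move=> t tab; rewrite -[f t]subr0.
  apply: is_deriveB; apply: (is_derive_clamp tab); apply: dG.
  by move/andP: tab => [ta tb]; apply/andP; split; lra.
- by move=> t; rewrite [clamp a b (clamp a b t)]clampK// clamp_itv.
Qed.

Lemma nice_scalar : nice R.
Proof.
by split; [exact: geometric_limit|exact: mean_value_scalar|exact: primitive_scalar].
Qed.

Lemma nice_prod (V W : normedModType R) : nice V -> nice W -> nice (V * W)%type.
Proof.
move=> [lV mV pV] [lW mW pW]; split.
- move=> u C uC.
  have [l1 H1] := lV (fun k => (u k).1) C (fun k => ((prod_norm_leP _ _).1 (uC k)).1).
  have [l2 H2] := lW (fun k => (u k).2) C (fun k => ((prod_norm_leP _ _).1 (uC k)).2).
  by exists (l1, l2) => k; apply/prod_norm_leP; split; [exact: H1|exact: H2].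
- move=> a b f df p dp ab fc pc fd pd H; apply/prod_norm_leP; split => /=.
  + apply: (mV a b (fun t => (f t).1) (fun t => (df t).1) p dp) => //.
    * by move=> t; apply: (cvg_comp _ fst (fc t) cvg_fst).
    * by move=> t /fd; exact: is_derive_fst.
    * by move=> t /H/prod_norm_leP[].
  + apply: (mW a b (fun t => (f t).2) (fun t => (df t).2) p dp) => //.
    * by move=> t; apply: (cvg_comp _ snd (fc t) cvg_snd).
    * by move=> t /fd; exact: is_derive_snd.
    * by move=> t /H/prod_norm_leP[].
- move=> a b f ab fc.
  have [F [Fc Fa Fd FK]] := pV a b (fun t => (f t).1) ab
    (fun t => cvg_comp _ fst (fc t) cvg_fst).
  have [G [Gc Ga Gd GK]] := pW a b (fun t => (f t).2) ab
    (fun t => cvg_comp _ snd (fc t) cvg_snd).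
  exists (fun t => (F t, G t)); split.
  + by move=> t; apply: cvg_pair; [exact: Fc|exact: Gc].
  + by rewrite Fa Ga.
  + move=> t tab; have := is_derive_pair (Fd t tab) (Gd t tab).
    by case: (f t).
  + by move=> t; rewrite FK GK.
Qed.

Lemma nice_mx m n : nice 'M[R]_(m, n).
Proof.
have pos (u : R) (v : 'M[R]_(m, n)) : `|v| <= u -> forall i j, `|v i j| <= u.
  by move=> H; apply/mx_norm_leP => //; exact: le_trans H.
split.
- move=> u C uC.
  have /choice[l lP] : forall ij : 'I_m * 'I_n, exists l, forall k,
      `|l - u k ij.1 ij.2| <= 2 * C * 2^-1 ^+ k.
    move=> [i j]; apply: geometric_limit => k /=.
    by have := pos _ _ (uC k) i j; rewrite !mxE.
  have C0 : 0 <= C by have := le_trans (normr_ge0 _) (uC 0%N); rewrite mulr1.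
  exists (\matrix_(i, j) l (i, j)) => k; apply/mx_norm_leP.
    by rewrite !mulr_ge0// exprn_ge0// invr_ge0.
  by move=> i j; rewrite !mxE; exact: (lP (i, j)).
- move=> a b f df p dp ab fc pc fd pd H; apply/mx_norm_leP => [|i j].
    (* An empty matrix has norm 0, so [0 <= p b - p a] needs its own proof: it is the mean value
       inequality for [p] against itself. *)
    apply: le_trans (normr_ge0 _) (@mean_value_scalar a b p dp p dp ab pc pc pd pd _).
    by move=> t tab; rewrite ger0_norm//; apply: le_trans (H t tab).
  rewrite !mxE; apply: (@mean_value_scalar a b (fun t => f t i j) (fun t => df t i j) p dp) => //.
  + by move=> t; apply: (cvg_comp _ _ (fc t) (@coord_continuous _ _ _ i j _)).
  + by move=> t /fd/is_derive_mx.
  + by move=> t /H/pos.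
- move=> a b f ab fc.
  have /choice[F FP] : forall ij : 'I_m * 'I_n, exists F, [/\ continuous F, F a = 0,
      forall t, a < t < b -> is_derive t 1 F (f t ij.1 ij.2) &
      forall t, F (clamp a b t) = F t].
    move=> [i j]; apply: primitive_scalar => // t.
    exact: (cvg_comp _ _ (fc t) (@coord_continuous _ _ _ i j _)).
  exists (fun t => \matrix_(i, j) F (i, j) t); split.
  + move=> t; apply: cvg_mx => i j; rewrite mxE; under eq_fun do rewrite mxE.
    by have [Fc _ _ _] := FP (i, j); exact: Fc.
  + by apply/matrixP => i j; rewrite !mxE; have [] := FP (i, j).
  + move=> t tab; apply/is_derive_mx => i j; under eq_fun do rewrite mxE.
    by have [_ _ + _] := FP (i, j); exact.
  + by move=> t; apply/matrixP => i j; rewrite !mxE; have [_ _ _] := FP (i, j).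
Qed.

End Nice.

(** * Ordinary differential equations *)

Section ODE.
Context (R : realType).

(** [s] is the minimum of the compact set of points of [[a, b]] where [g] is nonnegative. *)
Lemma first_hit (g : R -> R) (a b : R) : a <= b -> continuous g -> g a < 0 ->
  0 <= g b ->
  exists2 s, a < s <= b & 0 <= g s /\ forall u, a <= u < s -> g u < 0.
Proof.
move=> ab gc ga gb.
pose S := `[a, b]%classic `&` g @^-1` [set x | 0 <= x].
have cS : compact S.
  apply: (@subclosed_compact _ _ `[a, b]%classic); [|exact: segment_compact|by move=> ? []].
  apply: closedI; first by apply: compact_closed; [exact: norm_hausdorff|exact: segment_compact].
  by apply: closed_comp => [x _|]; [exact: gc|exact: closed_ge].
have [s] : exists2 c, c \in S & forall t, t \in S -> c <= t.
  apply: compact_EVT_min => //; first by exists b; split => //=; rewrite in_itv/= ab lexx.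
  by apply: continuous_subspaceT => x; exact: cvg_id.
rewrite inE => -[/=]; rewrite in_itv/= => /andP[sa sb] gs smin; exists s.
  rewrite sb andbT lt_neqAle sa andbT; apply/eqP => as_.
  by move: ga; rewrite as_ ltNge gs.
split=> // u /andP[au us]; rewrite ltNge; apply/negP => gu.
suff : s <= u by rewrite leNgt us.
by apply: smin; rewrite inE; split => //=; rewrite in_itv/= au/= (le_trans (ltW us)).
Qed.

Lemma is_derive_expR_affine (c k a t : R) :
  is_derive t 1 (fun u : R => c * expR (k * (u - a))) (c * (k * expR (k * (t - a)))).
Proof.
pose h := fun u : R => k * (u - a).
have hd : is_derive t 1 h k.
  have := is_deriveZ k (is_deriveB (is_derive_id t (1:R)) (is_derive_cst a t (1:R))).
  by rewrite subr0 /GRing.scale/= mulr1.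
have := is_derive1_comp (is_derive_expR (h t)) hd.
move=> /(is_deriveZ c) H; rewrite [k * _]mulrC; exact: H.
Qed.

Lemma continuous_expR_affine (c k a : R) :
  continuous (fun u : R => c * expR (k * (u - a))).
Proof.
move=> t; have [] := is_derive_expR_affine c k a t.
by move=> /derivable1_diffP/differentiable_continuous.
Qed.

Lemma le_geometric (x y D : R) :
  (forall k, x <= y + D * 2^-1 ^+ k) -> x <= y.
Proof.
move=> H.
have D1 : 0 < `|D| + 1 by rewrite ltr_pwDr.
apply/ler_addgt0Pr => e e0.
have /cvgrPdist_lt/(_ (e / (`|D| + 1)) (divr_gt0 e0 D1)) [N _ /(_ _ (leqnn N))] :
    (2^-1 : R) ^+ k @[k --> \oo] --> (0 : R).
  by apply: cvg_expr; rewrite ger0_norm ?invr_ge0// invf_lt1 ?ltr1n.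
rewrite /= sub0r normrN ger0_norm ?exprn_ge0 ?invr_ge0// ltr_pdivlMr// => HN.
apply: (le_trans (H N)); rewrite lerD2l; apply: le_trans (ltW HN).
rewrite mulrC ler_wpM2l ?exprn_ge0 ?invr_ge0//.
by rewrite (le_trans (ler_norm D))// lerDl.
Qed.

Context (V : normedModType R) (niceV : nice V).

(* The factor 2 in the exponent leaves room for a first-exit argument: up to
   the first exit the mean value inequality gives half the increase. *)
Lemma gronwall (a b L rho : R) (f df : R -> V) : a <= b -> 0 <= L ->
  continuous f -> (forall t, a < t < b -> is_derive t 1 f (df t)) ->
  (forall t, a < t < b -> `|f t| < rho -> `|df t| <= L * `|f t|) ->
  `|f a| * expR (2 * L * (b - a)) < rho ->
  forall t, a <= t <= b -> `|f t| <= `|f a| * expR (2 * L * (t - a)).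
Proof.
move=> ab L0 fc fd H fa t /andP[at_ tb].
pose e u := expR (2 * L * (u - a)).
have e0 u : 0 < e u by exact: expR_gt0.
have emono u v : u <= v -> e u <= e v.
  by move=> uv; rewrite ler_expR ler_wpM2l ?mulr_ge0// lerB.
have ea : e a = 1 by rewrite /e subrr mulr0 expR0.
(* With [r] slightly above [|f a|] the bound is strict at [a], so the first exit comes after [a]. A
   violation of the bound for [|f a|] itself would already violate it for some such [r]. *)
suff key r : `|f a| < r -> r * e b < rho -> `|f t| <= r * e t.
  rewrite leNgt; apply/negP => ft.
  have : `|f a| < Num.min (`|f t| / e t) (rho / e b).
    by rewrite lt_min !ltr_pdivlMr// ft.
  move=> ar; have [r1 r2] := midf_lt ar; set r := _ / 2 in r1 r2.
  move: r2; rewrite lt_min !ltr_pdivlMr// => /andP[r2 r3].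
  by have := key r r1 r3; rewrite leNgt r2.
move=> far rrho; rewrite leNgt; apply/negP => ft.
have r0 : 0 < r by exact: le_lt_trans far.
pose g u := `|f u| - r * e u.
have gc : continuous g.
  move=> u; apply: cvgB; first exact: (cvg_norm (fc u)).
  exact: continuous_expR_affine.
have [||s /andP[as_ st] [gs gu]] := first_hit at_ gc.
- by rewrite /g ea mulr1 subr_lt0.
- by rewrite /g subr_ge0 ltW.
have sb := le_trans st tb.
have mv : `|f s - f a| <= r / 2 * e s - r / 2 * e a.
  apply: (nice_mean_value niceV (df := df) (p := fun u => r / 2 * e u)
    (dp := fun u => r / 2 * (2 * L * e u)) (ltW as_) fc).
  - exact: continuous_expR_affine.
  - by move=> u /andP[au us]; apply: fd; rewrite au (lt_le_trans us).
  - by move=> u _; exact: is_derive_expR_affine.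
  - move=> u /andP[au us].
    have fu : `|f u| < r * e u by rewrite -subr_lt0 gu// ltW.
    have -> : r / 2 * (2 * L * e u) = L * (r * e u) by field.
    apply: le_trans (_ : L * `|f u| <= _); last by rewrite ler_wpM2l// ltW.
    apply: H; first by rewrite au (lt_le_trans us).
    apply: (lt_trans fu); apply: le_lt_trans rrho; rewrite ler_wpM2l//; first exact: ltW.
    by apply: emono; rewrite ltW// (lt_le_trans us).
have fs : `|f s| <= `|f a| + `|f s - f a|.
  by rewrite -[X in `|X| <= _](subrK (f a)) addrC ler_normD.
have es : 1 <= e s by rewrite -ea emono// ltW.
move: gs; rewrite /g subr_ge0 ea in mv * => gs.
have : r * 1 <= r * e s by rewrite ler_wpM2l// ltW.
lra.
Qed.

Section Picard.
Variables (a b L rho : R) (F : R -> V -> V).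
Hypotheses (ab : a < b) (L0 : 0 <= L)
  (Fc : forall t y, a <= t <= b -> `|y| < rho ->
    {for (t, y), continuous (fun z : R * V => F z.1 z.2)})
  (FL : forall t x y, a <= t <= b -> `|x| < rho -> `|y| < rho ->
    `|F t x - F t y| <= L * `|x - y|)
  (F0 : forall t, F t 0 = 0).

Let e u := expR (2 * L * (u - a)).

(** As [F t 0 = 0], the Lipschitz bound becomes a linear bound on [F]. Hence a solution with small
    initial value never leaves the ball of radius [rho], outside which nothing is known about
    [F]. *)
Lemma ode_bound (Y : R -> V) (c : R) : c <= b -> continuous Y ->
  (forall t, a < t < c -> is_derive t 1 Y (F t (Y t))) ->
  `|Y a| * e b < rho -> forall t, a <= t <= c -> `|Y t| <= `|Y a| * e t.
Proof.
move=> cb Yc Yd Ya t atc; have ac : a <= c.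
  by case/andP: atc; exact: le_trans.
have Ya' : `|Y a| * e c < rho.
  apply: le_lt_trans Ya; rewrite ler_wpM2l// ler_expR ler_wpM2l ?mulr_ge0//.
  by rewrite lerB.
apply: (gronwall ac L0 Yc Yd _ Ya' atc) => {atc}t /andP[at_ tc] Yt.
rewrite -[F t _]subr0 -(F0 t) -[X in L * `|X|]subr0.
apply: FL => //; first by rewrite (ltW at_) (le_trans (ltW tc)).
by rewrite normr0; exact: le_lt_trans Yt.
Qed.

Lemma ode_unique (Y Z : R -> V) (c : R) : c <= b ->
  continuous Y -> continuous Z ->
  (forall t, a < t < c -> is_derive t 1 Y (F t (Y t))) ->
  (forall t, a < t < c -> is_derive t 1 Z (F t (Z t))) ->
  Y a = Z a -> `|Y a| * e b < rho -> forall t, a <= t <= c -> Y t = Z t.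
Proof.
move=> cb Yc Zc Yd Zd YZ Ya t atc; have ac : a <= c.
  by case/andP: atc; exact: le_trans.
have in_ball X : continuous X ->
    (forall t, a < t < c -> is_derive t 1 X (F t (X t))) -> X a = Y a ->
    forall t, a <= t <= c -> `|X t| < rho.
  move=> Xc Xd Xa u auc; apply: (le_lt_trans _ Ya); rewrite -Xa.
  have /andP[au uc] := auc.
  apply: (le_trans (ode_bound cb Xc Xd _ auc)).
    by rewrite Xa.
  by rewrite ler_wpM2l// ler_expR ler_wpM2l ?mulr_ge0// lerB// (le_trans uc).
have Dc : continuous (fun t => Y t - Z t).
  by move=> u; apply: cvgB; [exact: Yc|exact: Zc].
have Dd u : a < u < c -> is_derive u 1 (fun t => Y t - Z t) (F u (Y u) - F u (Z u)).
  by move=> auc; apply: is_deriveB; [exact: Yd|exact: Zd].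
have Da : `|Y a - Z a| * expR (2 * L * (c - a)) < 1.
  by rewrite YZ subrr normr0 mul0r.
have DL u : a < u < c -> `|Y u - Z u| < 1 ->
    `|F u (Y u) - F u (Z u)| <= L * `|Y u - Z u|.
  move=> /andP[/ltW au /ltW uc] _.
  by apply: FL; [rewrite au (le_trans uc)|apply: (in_ball Y)|apply: (in_ball Z)];
    rewrite ?au ?uc ?YZ.
have := gronwall ac L0 Dc Dd DL Da atc.
by rewrite YZ subrr normr0 mul0r normr_le0 subr_eq0 => /eqP.
Qed.

Lemma picard (y0 : V) : `|y0| * e b < rho ->
  exists Y, [/\ continuous Y, Y a = y0,
    forall t, a < t < b -> is_derive t 1 Y (F t (Y t)) &
    forall t, a <= t <= b -> `|Y t| <= `|y0| * e t].
Proof.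
move=> y0rho; have ab' := ltW ab.
have emono u v : u <= v -> e u <= e v.
  by move=> uv; rewrite ler_expR ler_wpM2l ?mulr_ge0// lerB.
have ea : e a = 1 by rewrite /e subrr mulr0 expR0.
have e1 t : a <= t -> 1 <= e t by rewrite -ea => /emono.
pose good (Y : R -> V) := [/\ continuous Y, Y a = y0,
  forall t, a <= t <= b -> `|Y t| <= `|y0| * e t &
  forall t, Y (clamp a b t) = Y t].
have good_lt Y t : good Y -> a <= t <= b -> `|Y t| < rho.
  move=> [_ _ Yb _] atb; apply: (le_lt_trans (Yb t atb)).
  by apply: le_lt_trans y0rho; rewrite ler_wpM2l// emono//; case/andP: atb.
(* [phi Y] is [y0] plus the integral of [F s (Y s)]. Outside [good], where the integrand may fail to
   be continuous, it takes a dummy value. *)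
have /choice[phi phiP] Y : exists Z, good Y ->
    good Z /\ forall t, a < t < b -> is_derive t 1 Z (F t (Y t)).
  have [gY|] := pselect (good Y); last by exists 0.
  have [Yc Ya Yb YK] := gY.
  have fc : continuous (fun t => F (clamp a b t) (Y t)).
    move=> t; have ct := clamp_itv t ab'.
    have Yt : `|Y t| < rho by rewrite -YK; exact: good_lt.
    apply: (@continuous_comp_at _ _ _ (fun s => (clamp a b s, Y s))
      (fun z : R * V => F z.1 z.2)); last exact: Fc.
    by apply: continuous_pair; [exact: continuous_clamp|exact: Yc].
  have [G [Gc Ga Gd GK]] := nice_primitive niceV ab fc.
  have Gd' t : a < t < b -> is_derive t 1 (fun t => y0 + G t) (F t (Y t)).
    move=> atb; have := is_deriveD (is_derive_cst y0 t (1:R)) (Gd t atb).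
    by rewrite add0r clampK//; case/andP: atb => ? ?; rewrite !ltW.
  have Zc : continuous (fun t => y0 + G t).
    by move=> t; apply: cvgD; [exact: cvg_cst|exact: Gc].
  exists (fun t => y0 + G t) => _; split=> //; split => //.
  - by rewrite Ga addr0.
  - move=> t /andP[at_ tb].
    have : `|(y0 + G t) - (y0 + G a)| <= `|y0| / 2 * e t - `|y0| / 2 * e a.
      apply: (nice_mean_value niceV (df := fun u => F u (Y u))
        (p := fun u => `|y0| / 2 * e u)
        (dp := fun u => `|y0| / 2 * (2 * L * e u)) at_ Zc).
      + exact: continuous_expR_affine.
      + by move=> u /andP[au ut]; apply: Gd'; rewrite au (lt_le_trans ut).
      + by move=> u _; exact: is_derive_expR_affine.
      + move=> u /andP[/ltW au ut]; have ub : u <= b by rewrite ltW// (lt_le_trans ut).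
        have -> : `|y0| / 2 * (2 * L * e u) = L * (`|y0| * e u) by field.
        apply: le_trans (_ : L * `|Y u| <= _); last first.
          by rewrite ler_wpM2l// Yb// au.
        rewrite -[F u _]subr0 -(F0 u) -[X in L * `|X|]subr0; apply: FL => //.
        * by rewrite au.
        * by apply: good_lt => //; rewrite au.
        * by rewrite normr0; apply: le_lt_trans y0rho; rewrite mulr_ge0 ?expR_ge0.
    rewrite Ga addr0 ea => H.
    have : `|y0 + G t| <= `|y0| + `|y0 + G t - y0|.
      by rewrite -[X in `|X| <= _](subrK y0) addrC ler_normD.
    have : `|y0| * 1 <= `|y0| * e t by rewrite ler_wpM2l// e1.
    lra.
  - by move=> t; rewrite GK.
pose u k := iter k phi (cst y0).
have gu k : good (u k).
  elim: k => [|k IH]; last by have [] := phiP _ IH.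
  split=> //; first by move=> t; exact: cvg_cst.
  by move=> t /andP[at_ _]; rewrite ler_peMr// e1.
have ud k t : a < t < b -> is_derive t 1 (u k.+1) (F t (u k t)).
  by have [_] := phiP _ (gu k); exact.
have h0 k : 0 <= (2^-1 : R) ^+ k by rewrite exprn_ge0 ?invr_ge0.
have dist k t : a <= t <= b -> `|u k.+1 t - u k t| <= 2 * `|y0| * 2^-1 ^+ k * e t.
  elim: k t => [|k IH] t atb; have /andP[at_ tb] := atb.
    have [_ _ /(_ _ atb) u1 _] := gu 1%N; have [_ _ /(_ _ atb) u0 _] := gu 0%N.
    rewrite expr0 mulr1 -mulrA mulr_natl mulr2n; apply: le_trans (lerD u1 u0).
    exact: ler_normB.
  have [u2c u2a _ _] := gu k.+2; have [u1c u1a _ _] := gu k.+1.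
  have Dc : continuous (fun t => u k.+2 t - u k.+1 t).
    by move=> s; apply: cvgB; [exact: u2c|exact: u1c].
  have : `|(u k.+2 t - u k.+1 t) - (u k.+2 a - u k.+1 a)| <=
      `|y0| * 2^-1 ^+ k * e t - `|y0| * 2^-1 ^+ k * e a.
    apply: (nice_mean_value niceV (df := fun s => F s (u k.+1 s) - F s (u k s))
      (p := fun s => `|y0| * 2^-1 ^+ k * e s)
      (dp := fun s => `|y0| * 2^-1 ^+ k * (2 * L * e s)) at_ Dc).
    + exact: continuous_expR_affine.
    + move=> s /andP[as_ st]; have sab : a < s < b by rewrite as_ (lt_le_trans st).
      by apply: is_deriveB; exact: ud.
    + by move=> s _; exact: is_derive_expR_affine.
    + move=> s /andP[/ltW as_ st].
      have sab : a <= s <= b by rewrite as_ ltW// (lt_le_trans st).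
      apply: (le_trans (FL sab (good_lt _ _ (gu _) sab) (good_lt _ _ (gu _) sab))).
      have -> : `|y0| * 2^-1 ^+ k * (2 * L * e s) = L * (2 * `|y0| * 2^-1 ^+ k * e s).
        by ring.
      by rewrite ler_wpM2l// IH.
  rewrite u2a u1a subrr subr0 ea => /le_trans; apply.
  rewrite exprS; have : 0 <= `|y0| * 2^-1 ^+ k by rewrite mulr_ge0.
  by set q := _ ^+ k; lra.
pose C := 2 * `|y0| * e b.
have uC k t : `|u k.+1 t - u k t| <= C * 2^-1 ^+ k.
  have [_ _ _ <-] := gu k.+1; have [_ _ _ <-] := gu k.
  have tab := clamp_itv t ab'; apply: (le_trans (dist k _ tab)).
  rewrite /C -!mulrA !ler_wpM2l// mulrC ler_wpM2r// emono//.
  by case/andP: tab.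
have /choice[l lP] t : exists l, forall k, `|l - u k t| <= 2 * C * 2^-1 ^+ k.
  exact: (nice_limit niceV (uC^~ t)).
pose Y t := l (clamp a b t).
have YP k t : `|Y t - u k t| <= 2 * C * 2^-1 ^+ k.
  by have [_ _ _ <-] := gu k; exact: lP.
have gY : good Y; first split.
- move=> t; apply/cvgrPdist_le => /= eps eps0.
  have C1 : 0 < 4 * C + 1.
    by rewrite ltr_wpDl// !mulr_ge0 ?expR_ge0.
  have /cvgrPdist_lt/(_ (eps / 2 / (4 * C + 1)) (divr_gt0 (divr_gt0 eps0 (ltr0n _ 2)) C1))
      [N _ /(_ _ (leqnn N))] : (2^-1 : R) ^+ k @[k --> \oo] --> (0 : R).
    by apply: cvg_expr; rewrite ger0_norm ?invr_ge0// invf_lt1 ?ltr1n.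
  rewrite /= sub0r normrN ger0_norm// ltr_pdivlMr// => HN.
  have [/(_ t)/cvgrPdist_le/(_ (eps / 2) (divr_gt0 eps0 (ltr0n _ 2))) uc _ _ _] := gu N.
  near=> s; have us : `|u N t - u N s| <= eps / 2 by near: s.
  have := YP N t; have := YP N s; rewrite [`|Y s - _|]distrC => Y1 Y2.
  have := ler_distD (u N t) (Y t) (Y s).
  have := ler_distD (u N s) (u N t) (Y s).
  have := h0 N; move: HN Y1 Y2; set q := _ ^+ N; lra.
- apply/eqP; rewrite -subr_eq0 -normr_le0.
  apply: (@le_geometric _ _ (2 * C)) => k; rewrite add0r.
  by have [_ <- _ _] := gu k.
- move=> t tab; apply: (@le_geometric _ _ (2 * C)) => k.
  have [_ _ /(_ _ tab) ukt _] := gu k.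
  rewrite -[Y t](subrK (u k t)) addrC; apply: (le_trans (ler_normD _ _)).
  by rewrite lerD.
- by move=> t; rewrite /Y [clamp a b (clamp a b t)]clampK// clamp_itv.
(* The limit [Y] is only known to be continuous, while [phi Y] is differentiable. Both are limits of
   the iterates on [[a, b]], so they agree there and [phi Y] is the solution. *)
have [[Zc Za Zb ZK] Zd] := phiP _ gY; have [Yc Ya Yb YK] := gY.
have ZY t : a <= t <= b -> phi Y t = Y t.
  move=> /andP[at_ tb]; apply/eqP; rewrite -subr_eq0 -normr_le0.
  apply: (@le_geometric _ _ (L * (2 * C) * (t - a) + 2 * C)) => k; rewrite add0r.
  have [uc ua _ _] := gu k.+1.
  have Dc : continuous (fun t => phi Y t - u k.+1 t).
    by move=> s; apply: cvgB; [exact: Zc|exact: uc].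
  have : `|(phi Y t - u k.+1 t) - (phi Y a - u k.+1 a)| <=
      L * (2 * C * 2^-1 ^+ k) * t - L * (2 * C * 2^-1 ^+ k) * a.
    apply: (nice_mean_value niceV (df := fun s => F s (Y s) - F s (u k s))
      (p := fun s => L * (2 * C * 2^-1 ^+ k) * s)
      (dp := fun s => L * (2 * C * 2^-1 ^+ k)) at_ Dc).
    + by move=> s; apply: cvgMr; exact: cvg_id.
    + move=> s /andP[as_ st]; have sab : a < s < b by rewrite as_ (lt_le_trans st).
      by apply: is_deriveB; [exact: Zd|exact: ud].
    + move=> s _; have := is_deriveZ (L * (2 * C * 2^-1 ^+ k)) (is_derive_id s (1:R)).
      by rewrite /GRing.scale/= mulr1.
    + move=> s /andP[/ltW as_ st].
      have sab : a <= s <= b by rewrite as_ ltW// (lt_le_trans st).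
      apply: (le_trans (FL sab (good_lt _ _ gY sab) (good_lt _ _ (gu _) sab))).
      by rewrite ler_wpM2l.
  rewrite Za ua subrr subr0 => H.
  have YPk := YP k.+1 t; rewrite distrC exprS in YPk.
  have := ler_distD (u k.+1 t) (phi Y t) (Y t).
  have : 0 <= C * 2^-1 ^+ k by rewrite !mulr_ge0 ?expR_ge0.
  by move: H YPk; set q := _ ^+ k; lra.
exists (phi Y); split => // t tab.
have tab' : a <= t <= b by case/andP: tab => *; rewrite !ltW.
by rewrite ZY//; exact: Zd.
Unshelve. all: end_near. Qed.

End Picard.
End ODE.

(** * Scalar differential inequalities *)

Section Comparison.
Context (R : realType).

(** If [v b < 0], let [c] be the last point with [0 <= v c], found as a first hit in reversed time.
    Between [c] and [b] the derivative is nonnegative, so [v b] is at least [v c]. *)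
Lemma ge0_of_derive_ge0_where_lt0 (v dv : R -> R) (a b : R) : a <= b ->
  continuous v -> (forall t, a < t < b -> is_derive t 1 v (dv t)) ->
  (forall t, a < t < b -> v t < 0 -> 0 <= dv t) -> 0 <= v a -> 0 <= v b.
Proof.
move=> ab vc vd H va; rewrite leNgt; apply/negP => vb.
have gc : continuous (fun x => v (a + b - x)).
  move=> x; apply: (@continuous_comp_at _ _ _ (fun x => a + b - x) v); last exact: vc.
  by apply: cvgB; [exact: cvg_cst|exact: cvg_id].
have [||s /andP[as_ sb] [gs gu]] := first_hit ab gc.
- by rewrite addrAC subrr add0r.
- by rewrite addrK.
pose c := a + b - s.
have ac : a <= c by rewrite /c; lra.
have cb : c < b by rewrite /c; lra.
have [t] : exists2 t, t \in `]c, b[%R & v b - v c = dv t * (b - c).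
  apply: MVT => // [t|]; last exact: continuous_subspaceT.
  by rewrite in_itv/= => /andP[ct tb]; apply: vd; rewrite tb (le_lt_trans ac).
rewrite in_itv/= => /andP[ct tb] E.
have dt : 0 <= dv t.
  apply: H; first by rewrite tb (le_lt_trans ac).
  have := gu (a + b - t); rewrite opprB addrCA subrr addr0; apply.
  by move: ct tb; rewrite /c => *; apply/andP; split; lra.
have : 0 <= dv t * (b - c) by rewrite mulr_ge0// subr_ge0 ltW.
by move: gs vb; rewrite -/c -E; lra.
Qed.

(** [p] is a supersolution for the slowest rate [al]. For a sign [s] the derivative of [p - s * u]
    is at least [(c - al) * (s * u) + al * (s * u - p)], which is nonnegative wherever
    [p < s * u]. *)
Lemma comparison (u p dp c r : R -> R) (a b al : R) : a <= b -> 0 <= al ->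
  continuous u -> continuous p ->
  (forall t, a < t < b -> is_derive t 1 u (- (c t * u t) + r t)) ->
  (forall t, a < t < b -> is_derive t 1 p (dp t)) ->
  (forall t, a < t < b -> al <= c t) ->
  (forall t, a < t < b -> 0 <= p t) ->
  (forall t, a < t < b -> - (al * p t) + `|r t| <= dp t) ->
  `|u a| <= p a -> `|u b| <= p b.
Proof.
move=> ab al0 uc pc ud pd ac p0 H ua.
have key s : `|s| = 1 -> 0 <= p b - s * u b.
  move=> s1.
  have vc : continuous (fun t => p t - s * u t).
    move=> t; apply: cvgB; first exact: pc.
    by apply: cvgMr; exact: uc.
  have vd t : a < t < b -> is_derive t 1 (fun t => p t - s * u t)
      (dp t - s * (- (c t * u t) + r t)).
    by move=> tab; apply: is_deriveB; [exact: pd|apply: is_deriveZ; exact: ud].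
  apply: (ge0_of_derive_ge0_where_lt0 ab vc vd) => [t tab|]; last first.
    rewrite subr_ge0; apply: le_trans ua; apply: le_trans (ler_norm _) _.
    by rewrite normrM s1 mul1r.
  rewrite subr_lt0 => pu.
  have := H t tab; have := ac t tab; have := p0 t tab => p0t ct Ht.
  have sr : s * r t <= `|r t|.
    by apply: le_trans (ler_norm _) _; rewrite normrM s1 mul1r.
  have : 0 <= (c t - al) * (s * u t).
    by rewrite mulr_ge0// ?subr_ge0// (le_trans p0t)// ltW.
  have : 0 <= al * (s * u t - p t) by rewrite mulr_ge0// subr_ge0 ltW.
  lra.
have := key 1 (normr1 _); have := key (-1); rewrite normrN1 => /(_ erefl) h1 h2.
by rewrite ler_norml; apply/andP; split; lra.
Qed.

(** Thanks to the factor [k], the exponential part of the forcing has integral [K] over a half-line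
    whatever [k > 0] is. The supersolution adds the undamped integrals of both parts of the forcing
    to the damped initial value. *)
Lemma decay_bound (u c r : R -> R) (a b al H K k : R) : a <= b -> 0 <= al ->
  0 <= H -> 0 <= K -> 0 <= k -> continuous u ->
  (forall t, a < t < b -> is_derive t 1 u (- (c t * u t) + r t)) ->
  (forall t, a < t < b -> al <= c t) ->
  (forall t, a < t < b -> `|r t| <= H + K * (k * expR (- k * (t - a)))) ->
  `|u b| <= `|u a| * expR (- al * (b - a)) + H * (b - a) + K.
Proof.
move=> ab al0 H0 K0 k0 uc ud ac rH.
pose p t := `|u a| * expR (- al * (t - a)) + H * (t - a)
  + (K + (- K) * expR (- k * (t - a))).
pose dp t := `|u a| * (- al * expR (- al * (t - a))) + H
  + (0 + (- K) * (- k * expR (- k * (t - a)))).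
have pc : continuous p.
  move=> t; apply: cvgD; first apply: cvgD.
  - exact: continuous_expR_affine.
  - by apply: cvgMr; apply: cvgB; [exact: cvg_id|exact: cvg_cst].
  - by apply: cvgD; [exact: cvg_cst|exact: continuous_expR_affine].
have pd t : a < t < b -> is_derive t 1 p (dp t).
  move=> _; apply: is_deriveD; first apply: is_deriveD.
  - exact: is_derive_expR_affine.
  - have := is_deriveZ H (is_deriveB (is_derive_id t (1:R)) (is_derive_cst a t (1:R))).
    by rewrite subr0 /GRing.scale/= mulr1.
  - by apply: is_deriveD; exact: is_derive_expR_affine.
have e1 t : a <= t -> expR (- k * (t - a)) <= 1.
  by move=> at_; rewrite -expR0 ler_expR mulNr oppr_le0 mulr_ge0// subr_ge0.
have K1 t : a <= t -> 0 <= K * (1 - expR (- k * (t - a))).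
  by move=> /e1 ?; rewrite mulr_ge0// subr_ge0.
have H1 t : a <= t -> 0 <= H * (t - a) by move=> ?; rewrite mulr_ge0// subr_ge0.
have U1 t : 0 <= `|u a| * expR (- al * (t - a)) by rewrite mulr_ge0 ?expR_ge0.
apply: le_trans (_ : p b <= _); last first.
  by rewrite /p lerD2l mulNr gerBl mulr_ge0// expR_ge0.
apply: (comparison ab al0 uc pc ud pd ac) => [t /andP[/ltW at_ _]|t tab|].
- by have := K1 t at_; have := H1 t at_; have := U1 t; rewrite /p; lra.
- have /andP[/ltW at_ _] := tab.
  have k1 : 0 <= al * (K * (1 - expR (- k * (t - a)))) by rewrite mulr_ge0// K1.
  have h1 : 0 <= al * (H * (t - a)) by rewrite mulr_ge0// H1.
  have := rH t tab; move: k1 h1; rewrite /p /dp.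
  set E := expR (- k * _); set E' := expR _; lra.
- by rewrite /p subrr !mulr0 expR0; lra.
Qed.

End Comparison.

(** * Local Lipschitz continuity and C^1 functions *)

Section LocallyLipschitz.
Context (R : realType).
Implicit Types U V W T : normedModType R.

(** Strong enough for uniqueness of solutions and for a chain rule along curves, and closed under
    composition without any differentiability. *)
Definition loclip U W (f : U -> W) (x : U) := exists C e : R,
  [/\ 0 <= C, 0 < e & forall y z, `|y - x| < e -> `|z - x| < e ->
    `|f y - f z| <= C * `|y - z|].

Lemma loclip_continuous U W (f : U -> W) x : loclip f x ->
  {for x, continuous f}.
Proof.
move=> [C [e [C0 e0 H]]]; apply/cvgrPdist_le => /= eps eps0.
have C1 : 0 < C + 1 by rewrite ltr_wpDl.
have /cvgrPdist_lt xx : y @[y --> x] --> x by [].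
near=> y.
have ye : `|y - x| < e by rewrite distrC; near: y; exact: xx.
apply: le_trans (H x y _ ye) _; first by rewrite subrr normr0.
have : `|x - y| < eps / (C + 1) by near: y; apply: xx; rewrite divr_gt0.
rewrite ltr_pdivlMr// mulrDr mulr1 mulrC => /ltW; apply: le_trans.
by rewrite lerDl.
Unshelve. all: end_near. Qed.

Lemma nbhs_pair0P U W (x0 : U) (A : set (U * W)) : nbhs (x0, 0) A <->
  exists2 d, 0 < d & forall z, `|z.1 - x0| < d -> `|z.2| < d -> A z.
Proof.
split=> [/nbhs_normP[d /= d0 dA]|[d d0 dA]].
  exists d => // z z1 z2; apply: dA.
  by rewrite /= prod_normE/= gt_max distrC z1 sub0r normrN.
apply: (nbhs_normP (x0, 0 : W) _).2; exists d => // z /=.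
by rewrite prod_normE/= gt_max distrC sub0r normrN => /andP[]; exact: dA.
Qed.

Lemma loclip_near U V W T (f : U * V -> W * T) x0 e :
  loclip f (x0, 0) -> 0 < e -> exists2 d, 0 < d &
  forall z, `|z.1 - x0| < d -> `|z.2| < d ->
    `|(f z).1 - (f (x0, 0)).1| < e /\ `|(f z).2 - (f (x0, 0)).2| < e.
Proof.
move=> fx e0; have /cvgrPdist_lt/(_ e e0)/nbhs_pair0P[d d0 dP] := loclip_continuous fx.
exists d => // z z1 z2; have := dP z z1 z2.
by rewrite distrC prod_normE gt_max => /andP[].
Qed.

Lemma loclip_comp U V W (f : U -> V) (g : V -> W) x :
  loclip f x -> loclip g (f x) -> loclip (fun y => g (f y)) x.
Proof.
move=> fx; have := loclip_continuous fx; move: fx.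
move=> [C [e [C0 e0 H]]] fc [C' [e' [C'0 e'0 H']]].
have /cvgrPdist_lt/(_ e' e'0)/nbhs_normP[d /= d0 dP] := fc.
exists (C' * C), (Num.min e d); split; [exact: mulr_ge0|by rewrite lt_min e0|].
move=> y z; rewrite !lt_min => /andP[ye yd] /andP[ze zd].
apply: (le_trans (H' _ _ _ _)).
- by rewrite distrC; apply: dP; rewrite /= distrC.
- by rewrite distrC; apply: dP; rewrite /= distrC.
- by rewrite -mulrA ler_wpM2l// H.
Qed.

Lemma loclip_pair U V W (f : U -> V) (g : U -> W) x :
  loclip f x -> loclip g x -> loclip (fun y => (f y, g y)) x.
Proof.
move=> [C [e [C0 e0 H]]] [C' [e' [C'0 e'0 H']]].
exists (C + C'), (Num.min e e'); split; [exact: addr_ge0|by rewrite lt_min e0|].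
move=> y z; rewrite !lt_min => /andP[ye yd] /andP[ze zd].
apply/prod_norm_leP; split=> /=.
- by apply: (le_trans (H _ _ ye ze)); rewrite ler_wpM2r// lerDl.
- by apply: (le_trans (H' _ _ yd zd)); rewrite ler_wpM2r// lerDr.
Qed.

Lemma loclip_lipschitz U W (f : U -> W) C x : 0 <= C ->
  (forall y z, `|f y - f z| <= C * `|y - z|) -> loclip f x.
Proof. by move=> C0 H; exists C, 1; split. Qed.

Lemma loclip_cst U W (c : W) (x : U) : loclip (fun=> c) x.
Proof. by apply: (@loclip_lipschitz _ _ _ 0) => // y z; rewrite subrr normr0 mul0r. Qed.

Lemma loclip_id U (x : U) : loclip id x.
Proof. by apply: (@loclip_lipschitz _ _ _ 1) => // y z; rewrite mul1r. Qed.

Lemma loclip_fst U V W (f : U -> V * W) x : loclip f x ->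
  loclip (fun y => (f y).1) x.
Proof.
move=> fx; apply: (loclip_comp fx); apply: (@loclip_lipschitz _ _ _ 1) => // y z.
by rewrite mul1r; have [] := (prod_norm_leP (y - z) _).1 (lexx _).
Qed.

Lemma loclip_snd U V W (f : U -> V * W) x : loclip f x ->
  loclip (fun y => (f y).2) x.
Proof.
move=> fx; apply: (loclip_comp fx); apply: (@loclip_lipschitz _ _ _ 1) => // y z.
by rewrite mul1r; have [] := (prod_norm_leP (y - z) _).1 (lexx _).
Qed.

Lemma loclipD U W (f g : U -> W) x : loclip f x -> loclip g x ->
  loclip (fun y => f y + g y) x.
Proof.
move=> fx gx; apply: (loclip_comp (loclip_pair fx gx) (g := fun p => p.1 + p.2)).
apply: (@loclip_lipschitz _ _ _ 2) => // y z.
rewrite opprD addrACA; apply: (le_trans (ler_normD _ _)).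
have [y1 y2] := (prod_norm_leP (y - z) _).1 (lexx _).
by rewrite mulr_natl mulr2n lerD.
Qed.

Lemma loclipN U W (f : U -> W) x : loclip f x -> loclip (fun y => - f y) x.
Proof.
move=> fx; apply: (loclip_comp fx (g := -%R)).
by apply: (@loclip_lipschitz _ _ _ 1) => // y z; rewrite -opprD normrN mul1r.
Qed.

Lemma loclipB U W (f g : U -> W) x : loclip f x -> loclip g x ->
  loclip (fun y => f y - g y) x.
Proof. by move=> fx gx; apply: loclipD => //; exact: loclipN. Qed.

Lemma loclipZ U W (k : U -> R) (f : U -> W) x : loclip k x -> loclip f x ->
  loclip (fun y => k y *: f y) x.
Proof.
move=> kx fx; apply: (loclip_comp (loclip_pair kx fx) (g := fun p : R * W => p.1 *: p.2)).
set p := (k x, f x); exists (`|p| + 1 + (`|p| + 1)), 1; split=> //.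
move=> y z yp zp.
have bd (w : R * W) : `|w - p| < 1 -> `|w| <= `|p| + 1.
  move=> wp; rewrite -[w in `|w|](subrK p) addrC (le_trans (ler_normD _ _))//.
  by rewrite lerD2l ltW.
have [y1 _] := (prod_norm_leP y _).1 (bd _ yp).
have [_ z2] := (prod_norm_leP z _).1 (bd _ zp).
have [d1 d2] := (prod_norm_leP (y - z) _).1 (lexx _).
have -> : y.1 *: y.2 - z.1 *: z.2 = y.1 *: (y.2 - z.2) + (y.1 - z.1) *: z.2.
  by rewrite scalerBr scalerBl addrA subrK.
rewrite (le_trans (ler_normD _ _))// !normrZ mulrDl lerD//.
  by apply: ler_pM.
by rewrite mulrC; apply: ler_pM.
Qed.

Lemma loclipM U (f g : U -> R) x : loclip f x -> loclip g x ->
  loclip (fun y => f y * g y) x.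
Proof. exact: loclipZ. Qed.

Lemma loclipV U (f : U -> R) x : loclip f x -> f x != 0 ->
  loclip (fun y => (f y)^-1) x.
Proof.
move=> fx fx0; apply: (loclip_comp fx (g := fun r : R => r^-1)).
set p := f x; have p0 : 0 < `|p| / 2 by rewrite divr_gt0 ?normr_gt0.
exists ((`|p| / 2)^-1 ^+ 2), (`|p| / 2); split=> //.
have bd (w : R) : `|w - p| < `|p| / 2 -> `|p| / 2 <= `|w|.
  by move=> wp; have := ler_distD w p 0; rewrite !subr0 distrC => ?; lra.
move=> y z /bd yp /bd zp.
have y0 : 0 < `|y| by exact: lt_le_trans yp.
have z0 : 0 < `|z| by exact: lt_le_trans zp.
have -> : y^-1 - z^-1 = y^-1 * z^-1 * (z - y).
  by rewrite mulrBr mulfVK -?normr_gt0// mulrAC mulVf -?normr_gt0// mul1r.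
rewrite !normrM !normfV [`|z - y|]distrC expr2 ler_wpM2r//.
by apply: ler_pM; rewrite ?invr_ge0// lef_pV2.
Qed.

Lemma loclip_mxP U m n (f : U -> 'M[R]_(m, n)) x :
  (forall i j, loclip (fun y => f y i j) x) <-> loclip f x.
Proof.
split=> [H|fx i j]; last first.
  apply: (loclip_comp fx (g := fun M : 'M[R]_(m, n) => M i j)).
  apply: (@loclip_lipschitz _ _ _ 1) => // y z; rewrite mul1r.
  have -> : y i j - z i j = (y - z) i j by rewrite !mxE.
  exact: (mx_norm_leP _ (normr_ge0 _)).1.
have /choice[C /choice[e ePC]] : forall ij : 'I_m * 'I_n,
    exists C, exists e, [/\ 0 <= C, 0 < e &
    forall y z, `|y - x| < e -> `|z - x| < e ->
    `|f y ij.1 ij.2 - f z ij.1 ij.2| <= C * `|y - z|].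
  by move=> ij; exact: (H ij.1 ij.2).
have C0 ij : 0 <= C ij by have [] := ePC ij.
(* The default 1 keeps the radius positive for an empty matrix. *)
exists (\sum_ij C ij), (\big[Num.min/1]_ij e ij); split.
- by rewrite sumr_ge0.
- by apply: lt_bigmin => // ij _; have [] := ePC ij.
- move=> y z yx zx; have S0 : 0 <= \sum_ij C ij by rewrite sumr_ge0.
  apply/mx_norm_leP; first by rewrite mulr_ge0.
  move=> i j; rewrite !mxE; have [_ _ /(_ y z)] := ePC (i, j).
  move=> /(_ (lt_le_trans yx (bigmin_le_cond _ _ _)))/= D.
  apply: (le_trans (D _ _)) => //.
  + exact: (lt_le_trans zx (bigmin_le_cond _ _ _)).
  + by rewrite ler_wpM2r// (bigD1 (i, j))//= lerDl sumr_ge0.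
Qed.

Lemma loclip_sum U W I (r : seq I) (f : I -> U -> W) x :
  (forall i, loclip (f i) x) -> loclip (fun y => \sum_(i <- r) f i y) x.
Proof.
move=> H; elim: r => [|i r IH].
  by under eq_fun do rewrite big_nil; exact: loclip_cst.
by under eq_fun do rewrite big_cons; exact: loclipD.
Qed.

Lemma loclip_mulmx U m n p (f : U -> 'M[R]_(m, n)) (g : U -> 'M[R]_(n, p)) x :
  loclip f x -> loclip g x -> loclip (fun y => f y *m g y) x.
Proof.
move=> /loclip_mxP fx /loclip_mxP gx; apply/loclip_mxP => i j.
under eq_fun do rewrite mxE; apply: loclip_sum => k; exact: loclipM.
Qed.

(** A derivative of [f] in the single direction [c'] is enough: [c (t + h)] and [c t + h c'] differ
    by [o(h)], and the Lipschitz bound passes this error on to [f]. *)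
Lemma is_derive_comp_loclip U W (f : U -> W) (c : R -> U) t c' d :
  loclip f (c t) -> is_derive (c t) c' f d -> is_derive t 1 c c' ->
  is_derive t 1 (fun s => f (c s)) d.
Proof.
move=> [C [e [C0 e0 H]]] /is_deriveP fd /is_deriveP cd; apply/is_deriveP.
have c1 : c @ t --> c t.
  have : is_derive t 1 c c' by apply/is_deriveP.
  by move=> [/derivable1_diffP/differentiable_continuous].
have C1 : 0 < C + 1 by rewrite ltr_wpDl.
apply/cvgrPdist_le => /= eps eps0.
have eps2 : 0 < eps / 2 by rewrite divr_gt0.
have epsC : 0 < eps / 2 / (C + 1) by rewrite divr_gt0.
have sh0 : h *: (1 : R) + t @[h --> 0^'] --> t.
  rewrite -[X in _ --> X]add0r; apply: cvgD; last exact: cvg_cst.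
  rewrite -[X in _ --> X](scale0r (1:R)); apply: cvgZr_tmp.
  exact: cvg_within.
have line0 : h *: c' + c t @[h --> 0^'] --> c t.
  rewrite -[X in _ --> X]add0r; apply: cvgD; last exact: cvg_cst.
  rewrite -[X in _ --> X](scale0r c'); apply: cvgZr_tmp.
  exact: cvg_within.
near=> h.
have h0 : h != 0 by near: h; exact: nbhs_dnbhs_neq.
have A1 : `|d - h^-1 *: (f (h *: c' + c t) - f (c t))| <= eps / 2.
  by near: h; exact: (cvgrPdist_le _ _).1 fd _ eps2.
have A2 : `|c' - h^-1 *: (c (h *: (1 : R) + t) - c t)| <= eps / 2 / (C + 1).
  by near: h; exact: (cvgrPdist_le _ _).1 cd _ epsC.
have A3 : `|c (h *: (1 : R) + t) - c t| < e.
  rewrite distrC; near: h; apply: (cvgrPdist_lt _ _).1 _ _ e0.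
  exact: cvg_comp sh0 c1.
have A4 : `|h *: c' + c t - c t| < e.
  by rewrite distrC; near: h; exact: (cvgrPdist_lt _ _).1 line0 _ e0.
have A5 := H _ _ A4 A3.
apply: (le_trans (ler_distD (h^-1 *: (f (h *: c' + c t) - f (c t))) _ _)).
rewrite [leRHS]splitr lerD// -scalerBr opprB addrA subrK normrZ.
apply: (@le_trans _ _ (`|h^-1| * (C * `|h *: c' + c t - c (h *: (1 : R) + t)|))).
  by rewrite ler_wpM2l.
have -> : h *: c' + c t - c (h *: (1 : R) + t)
    = h *: (c' - h^-1 *: (c (h *: (1 : R) + t) - c t)).
  by rewrite scalerBr scalerA mulfV// scale1r opprB addrA.
rewrite normrZ normfV mulrCA mulKf ?normr_eq0//.
move: A2; rewrite ler_pdivlMr// mulrDr mulr1 mulrC; apply: le_trans.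
by rewrite lerDl.
Unshelve. all: end_near. Qed.

End LocallyLipschitz.

(** * Directional derivatives and finite spanning families *)

Section ContinuouslyDifferentiable.
Context (R : realType).

Definition C1 (U W : normedModType R) (f : U -> W) :=
  (forall x v, derivable f x v) /\ forall v, continuous (fun x => 'D_v f x).

Lemma is_derive_line (U W : normedModType R) (f : U -> W) x v (t : R) :
  derivable f (t *: v + x) v ->
  is_derive t 1 (fun s => f (s *: v + x)) ('D_v f (t *: v + x)).
Proof.
move=> /derivableP/is_deriveP fd; apply/is_deriveP; move: fd.
under eq_fun do rewrite addrA -scalerDl -[X in (X + t) *: v]mulr1.
exact.
Qed.

Lemma line_increment (U : normedModType R) (f : U -> R) x v (a d eps : R) :
  (forall z, derivable f z v) ->
  (forall t, `|t| <= `|a| -> `|'D_v f (t *: v + x) - d| <= eps) ->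
  `|f (a *: v + x) - f x - a * d| <= eps * `|a|.
Proof.
move=> fv.
have pos y b : 0 <= b -> (forall t, 0 <= t <= b -> `|'D_v f (t *: v + y) - d| <= eps) ->
    `|f (b *: v + y) - f y - b * d| <= eps * b.
  move=> b0 H.
  have pd (t : R) : is_derive t 1 (fun s => f (s *: v + y) - s * d) ('D_v f (t *: v + y) - d).
    apply: is_deriveB; first exact: is_derive_line.
    have -> : (fun s : R => s * d) = d \*: @id R.
      by apply/funext => s; rewrite mulrC.
    by have := is_deriveZ d (is_derive_id t (1:R)); rewrite /GRing.scale/= mulr1.
  have pc : continuous (fun s : R => f (s *: v + y) - s * d).
    by move=> t; have [/derivable1_diffP/differentiable_continuous] := pd t.
  have qc : continuous (fun s : R => eps * s).
    by move=> t; apply: cvgMr; exact: cvg_id.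
  have qd (t : R) : is_derive t 1 (fun s : R => eps * s) eps.
    have := is_deriveZ eps (is_derive_id t (1:R)).
    by rewrite /GRing.scale/= mulr1.
  have H' t : 0 < t < b -> `|'D_v f (t *: v + y) - d| <= eps.
    by move=> /andP[/ltW t0 /ltW tb]; apply: H; rewrite t0.
  have := mean_value_scalar b0 pc qc (fun t _ => pd t) (fun t _ => qd t) H'.
  by rewrite scale0r add0r mul0r mulr0 !subr0 [f _ - _ - f y]addrAC.
move=> H; have [a0|a0] := leP 0 a.
  rewrite [`|a|]ger0_norm//; apply: pos => // t /andP[t0 ta]; apply: H.
  by rewrite !ger0_norm.
rewrite [`|a|]ltr0_norm//.
(* For negative [a] the segment is traversed from its other end. *)
have := pos (a *: v + x) (- a); rewrite addrA -scalerDl addNr scale0r add0r.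
rewrite mulNr opprK -normrN opprD opprB => K.
apply: K; first by rewrite oppr_ge0 ltW.
move=> t /andP[t0 ta]; rewrite addrA -scalerDl; apply: H.
by rewrite [`|a|]ltr0_norm// ler_norml; apply/andP; split; lra.
Qed.

Section Frame.
Context (U : normedModType R) (I : Type).

(** One direction is added at a time, and each increment is compared with the derivative at [x0].
    Letting the base point [x] vary near [x0] is what later yields Lipschitz continuity. *)
Lemma strict_derivative (f : U -> R) (v : I -> U) (r : seq I) x0 (eps : R) :
  C1 f -> 0 < eps -> exists2 dl, 0 < dl & forall x (a : I -> R),
    `|x - x0| < dl -> (forall i, `|a i| < dl) ->
    `|f (\sum_(i <- r) a i *: v i + x) - f x - \sum_(i <- r) a i * 'D_(v i) f x0|
      <= eps * \sum_(i <- r) `|a i|.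
Proof.
move=> [fd fc] eps0; elim: r => [|i r [dl dl0 IH]].
  exists 1 => // x a _ _; rewrite !big_nil add0r subrr mulr0.
  by rewrite subr0 normr0.
have /cvgrPdist_le/(_ eps eps0)/nbhs_normP[d /= d0 dP] := fc (v i) x0.
pose S := \sum_(j <- i :: r) `|v j|.
have S0 : 0 <= S by rewrite sumr_ge0.
have S1 : 0 < S + 1 by rewrite ltr_wpDl.
(* A base point within [d / (S + 1)] of [x0] and a displacement of at most [d / (S + 1) * S] keep
   all intermediate points within [d] of [x0]. *)
exists (Num.min dl (d / (S + 1))); first by rewrite lt_min dl0 divr_gt0.
move=> x a; rewrite lt_min => /andP[x1 x2] adl.
have a1 j : `|a j| < dl by have := adl j; rewrite lt_min => /andP[].
have a2 j : `|a j| < d / (S + 1) by have := adl j; rewrite lt_min => /andP[].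
rewrite !big_cons -[_ *: _ + _ + x]addrA; set y := \sum_(j <- r) _ + x.
have Hy := IH x a x1 a1; rewrite -/y in Hy.
have Hi : `|f (a i *: v i + y) - f y - a i * 'D_(v i) f x0| <= eps * `|a i|.
  apply: line_increment => // t ta; rewrite distrC; apply: dP => /=.
  rewrite distrC /y; have -> : t *: v i + (\sum_(j <- r) a j *: v j + x) - x0 =
    (t *: v i + \sum_(j <- r) a j *: v j) + (x - x0) by rewrite !addrA.
  apply: (le_lt_trans (ler_normD _ _)).
  have : `|t *: v i + \sum_(j <- r) a j *: v j| <= d / (S + 1) * S.
    apply: (le_trans (ler_normD _ _)); rewrite [X in _ <= _ * X]big_cons mulrDr.
    apply: lerD.
      by rewrite normrZ; apply: ler_wpM2r => //; exact: (le_trans ta (ltW (a2 i))).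
    apply: (le_trans (ler_norm_sum _ _ _)); rewrite mulr_sumr; apply: ler_sum => j _.
    by rewrite normrZ; apply: ler_wpM2r => //; exact: ltW (a2 j).
  have : d = d / (S + 1) * S + d / (S + 1) by field; rewrite gt_eqF.
  by move: x2; set q := d / (S + 1); lra.
have -> : f (a i *: v i + y) - f x - (a i * 'D_(v i) f x0 + \sum_(j <- r) a j * 'D_(v j) f x0)
   = (f (a i *: v i + y) - f y - a i * 'D_(v i) f x0)
    + (f y - f x - \sum_(j <- r) a j * 'D_(v j) f x0) by ring.
by rewrite mulrDr (le_trans (ler_normD _ _))// lerD.
Qed.

(** One [h] must make all increments [h * a i] small. As the index type [I] may be infinite, this
    takes the uniform bound [B]. *)
Lemma derive_frame (f : U -> R) (v : I -> U) (r : seq I) x w (a : I -> R) B :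
  C1 f -> (forall i, `|a i| <= B) -> w = \sum_(i <- r) a i *: v i ->
  'D_w f x = \sum_(i <- r) a i * 'D_(v i) f x.
Proof.
move=> fC aB wE; have [fd _] := fC.
suff : is_derive x w f (\sum_(i <- r) a i * 'D_(v i) f x) by case.
apply/is_deriveP/cvgrPdist_le => /= e e0.
set D := \sum_(i <- r) _; pose A := \sum_(i <- r) `|a i|.
have A0 : 0 <= A by rewrite sumr_ge0.
have A1 : 0 < A + 1 by rewrite ltr_wpDl.
have [dl dl0 H] := strict_derivative v r x fC (divr_gt0 e0 A1).
have B1 : 0 < `|B| + 1 by rewrite ltr_wpDl.
have dlB : 0 < dl / (`|B| + 1) by rewrite divr_gt0.
near=> h.
have h0 : h != 0 by near: h; exact: nbhs_dnbhs_neq.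
have hB : `|h| < dl / (`|B| + 1) by near: h; exact: dnbhs0_lt.
have ha i : `|h * a i| < dl.
  rewrite normrM; move: hB; rewrite ltr_pdivlMr//; apply: le_lt_trans.
  rewrite ler_wpM2l// (le_trans (aB i))// (le_trans (ler_norm B))//.
  by rewrite lerDl.
have := H x (fun i => h * a i); rewrite subrr normr0 => /(_ dl0 ha).
have -> : \sum_(i <- r) (h * a i) *: v i = h *: w.
  by rewrite wE scaler_sumr; apply: eq_bigr => i _; rewrite scalerA.
have -> : \sum_(i <- r) h * a i * 'D_(v i) f x = h * D.
  by rewrite mulr_sumr; apply: eq_bigr => i _; rewrite mulrA.
have -> : \sum_(i <- r) `|h * a i| = `|h| * A.
  by rewrite mulr_sumr; apply: eq_bigr => i _; rewrite normrM.
move=> K; have -> : D - h^-1 *: (f (h *: w + x) - f x)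
    = - (h^-1 * (f (h *: w + x) - f x - h * D)).
  by rewrite [_ *: _]/(_ * _) [in RHS]mulrBr mulKf// opprB.
rewrite normrN normrM normfV ler_pdivrMl ?normr_gt0//; apply: (le_trans K).
rewrite mulrCA ler_wpM2l// mulrAC ler_pdivrMr// ler_wpM2l//; first exact: ltW.
by rewrite lerDl.
Unshelve. all: end_near. Qed.

Variables (v : I -> U) (r : seq I) (co : U -> I -> R).
Hypothesis frame : forall u, u = \sum_(i <- r) co u i *: v i.
Hypothesis frame_le : forall u i, `|co u i| <= `|u|.

Lemma C1_loclip (f : U -> R) x : C1 f -> loclip f x.
Proof.
move=> fC; have [dl dl0 H] := strict_derivative v r x fC ltr01.
exists (\sum_(i <- r) (`|'D_(v i) f x| + 1)), (dl / 2); split.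
- by rewrite sumr_ge0.
- by rewrite divr_gt0.
- move=> y z yx zx.
  have yz : `|y - z| < dl.
    by have := ler_distD x y z; rewrite [`|x - z|]distrC; lra.
  have zdl : `|z - x| < dl by lra.
  have := H z (co (y - z)) zdl (fun i => le_lt_trans (frame_le _ _) yz).
  rewrite -frame subrK mul1r => K.
  have -> : f y - f z = (f y - f z - \sum_(i <- r) co (y - z) i * 'D_(v i) f x) +
    \sum_(i <- r) co (y - z) i * 'D_(v i) f x by rewrite subrK.
  apply: (le_trans (ler_normD _ _)); apply: (le_trans (lerD K (ler_norm_sum _ _ _))).
  rewrite -big_split/= mulr_suml; apply: ler_sum => i _.
  rewrite normrM mulrDl mul1r addrC lerD// mulrC ler_wpM2l//.
Qed.

End Frame.

End ContinuouslyDifferentiable.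

(** * Transversal crossing *)

Section Crossing.
Context (R : realType).

Lemma increasing_of_derive_gt0 (f df : R -> R) (a b : R) : a < b -> continuous f ->
  (forall t, a < t < b -> is_derive t 1 f (df t)) ->
  (forall t, a < t < b -> 0 < df t) -> f a < f b.
Proof.
move=> ab fc fd df0; rewrite -subr_gt0.
have [t] : exists2 t, t \in `]a, b[%R & f b - f a = df t * (b - a).
  by apply: MVT => //; exact: continuous_subspaceT.
by rewrite in_itv/= => tab ->; rewrite mulr_gt0 ?subr_gt0 ?df0.
Qed.

(** Near each [s0] the property holds for all large [L], the radius [e] of the neighborhood also
    giving the threshold [e^-1]; compactness of the segment makes the threshold uniform. *)
Lemma compact_uniform (Q : R -> R -> Prop) (a b : R) :
  (forall s0, a <= s0 <= b -> exists2 e, 0 < e & forall s L,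
    `|s - s0| < e -> e^-1 < L -> Q L s) ->
  exists2 L, 0 < L & forall s, a <= s <= b -> Q L s.
Proof.
move=> H; have [M [_ MP]] : \forall L \near +oo, `[a, b]%classic `<=` Q L.
  apply: ((@compact_near_coveringP _ `[a, b]%classic).1 _ R) => //.
    exact: segment_compact.
  move=> s0 /=; rewrite in_itv/= => /H[e e0 eP].
  exists ([set s | `|s0 - s| < e], [set L | e^-1 < L]) => /=.
    by split; [apply/nbhs_normP; exists e|exact: nbhs_pinfty_gt (num_real _)].
  by move=> [s L] /= [se Le]; apply: eP; rewrite // distrC.
exists (`|M| + 1) => [|s sab]; first by rewrite ltr_wpDl.
by apply: MP; rewrite /= ?in_itv// (le_lt_trans (ler_norm M))// ltrDl.
Qed.

Lemma near0_of_continuous (V : normedModType R) (f : R * V -> R) s : continuous f -> 0 < f (s, 0) ->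
  exists2 e, 0 < e & forall t y, `|t - s| < e -> `|y| < e -> 0 < f (t, y).
Proof.
move=> fc f0; have /cvgrPdist_lt/(_ _ f0)/nbhs_normP[e /= e0 eP] := fc (s, 0).
exists e => // t y ts ye; have := eP (t, y); rewrite /= ltr_distl => H.
have /H : `|(s, 0) - (t, y) : R * V| < e.
  by rewrite prod_normE/= gt_max sub0r normrN distrC ts.
by move=> /andP[_]; rewrite -ltrBlDr subrr.
Qed.

(** One number [L] serves both as Lipschitz constant and as inverse radius of a neighborhood of the
    segment at [y = 0]. Points slightly outside the segment are attached to its nearest end by
    [clamp]. *)
Lemma tube (V : normedModType R) (F : R -> V -> V) (rt : R * V -> R) (D : set (R * V))
    (qp qm : R) : qp < qm ->
  (forall s, qp <= s <= qm -> loclip (fun z : R * V => F z.1 z.2) (s, 0)) ->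
  continuous rt -> open D ->
  (forall s, qp <= s <= qm -> 0 < rt (s, 0)) -> (forall s, qp <= s <= qm -> D (s, 0)) ->
  exists2 L, 0 < L & forall s x y, qp - L^-1 < s < qm + L^-1 ->
  `|x| < L^-1 -> `|y| < L^-1 ->
  [/\ `|F s x - F s y| <= L * `|x - y|,
      {for (s, x), continuous (fun z : R * V => F z.1 z.2)},
      0 < rt (s, x) & D (s, x)].
Proof.
move=> qpm FL rtc Do rt0 D0.
pose Q L s0 := forall s x y, `|s - s0| < L^-1 -> `|x| < L^-1 -> `|y| < L^-1 ->
  [/\ `|F s x - F s y| <= L * `|x - y|,
      {for (s, x), continuous (fun z : R * V => F z.1 z.2)},
      0 < rt (s, x) & D (s, x)].
have [|L L0 LP] := @compact_uniform Q qp qm; last first.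
  exists L => // s x y /andP[s1 s2]; apply: (LP (clamp qp qm s)).
    exact/clamp_itv/ltW.
  have L1 : 0 < L^-1 by rewrite invr_gt0.
  have [sp|sp] := leP s qp.
    have -> : clamp qp qm s = qp.
      by rewrite /clamp min_l ?max_l// (le_trans sp)// ltW.
    by rewrite ltr_norml; apply/andP; split; lra.
  have [sm|sm] := leP s qm; first by rewrite clampK ?subrr ?normr0// sm ltW.
  have -> : clamp qp qm s = qm by rewrite /clamp min_r ?max_r ?ltW.
  by rewrite ltr_norml; apply/andP; split; lra.
move=> s0 s0pm; have [C [e1 [C0 e10 e1P]]] := FL s0 s0pm.
have [e2 e20 e2P] := near0_of_continuous rtc (rt0 s0 s0pm).
have /nbhs_normP[e3 /= e30 e3P] : nbhs (s0, 0) D.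
  by apply: open_nbhs_nbhs; split; [exact: Do|exact: D0].
pose m := Num.min (Num.min e1 e2) (Num.min e3 (C + 1)^-1).
have m0 : 0 < m by rewrite !lt_min e10 e20 e30 invr_gt0 ltr_wpDl.
have [m1 m2 m3 m4] : [/\ m <= e1, m <= e2, m <= e3 & m <= (C + 1)^-1].
  by split; rewrite !ge_min lexx ?orbT.
exists (m / 2); first by rewrite divr_gt0.
move=> s' L s's mL s x y ss' xL yL.
have mi : 0 < (m / 2)^-1 by rewrite invr_gt0 divr_gt0.
have L0 : 0 < L by exact: lt_trans mL.
have Lm : L^-1 < m / 2 by rewrite -[ltRHS]invrK ltf_pV2 ?posrE.
have CL : C <= L.
  have : (C + 1)^-1^-1 <= m^-1 by rewrite lef_pV2 ?posrE// invr_gt0 ltr_wpDl.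
  rewrite invrK => C1; have : m^-1 <= (m / 2)^-1.
    by rewrite lef_pV2 ?posrE ?divr_gt0//; lra.
  lra.
have ss0 : `|s - s0| < m by have := ler_distD s' s s0; lra.
have xm : `|x| < m by lra.
have ym : `|y| < m by lra.
have inb t z : `|t - s0| < m -> `|z| < m -> `|(t, z) - (s0, 0) : R * V| < m.
  by move=> tm zm; rewrite prod_normE/= gt_max subr0 tm.
split.
- have := e1P (s, x) (s, y) (lt_le_trans (inb _ _ ss0 xm) m1) (lt_le_trans (inb _ _ ss0 ym) m1).
  move=> /= /le_trans; apply; apply: ler_pM => //.
  by rewrite prod_normE/= subrr normr0 max_r.
- apply: loclip_continuous; exists C, (m - `|(s, x) - (s0, 0) : R * V|); split => //.
    by rewrite subr_gt0 inb.
  move=> u v us vs; apply: e1P.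
    by have := ler_distD (s, x) u (s0, 0); lra.
  by have := ler_distD (s, x) v (s0, 0); lra.
- by apply: e2P; [exact: lt_le_trans m2|exact: lt_le_trans m2].
- by apply: e3P; rewrite /= distrC; apply: lt_le_trans m3; exact: inb.
Qed.

(* [P] is the height of the swing foot, with derivative [Pd / rt] along the
   solutions: it leaves [0] at [qp] and crosses [0] transversally at [qm]. *)
Theorem crossing (V : normedModType R) (niceV : nice V) (F : R -> V -> V)
    (P Pd rt : R * V -> R) (D : set (R * V)) (qp qm : R) :
  (forall s, F s 0 = 0) ->
  (forall s, qp <= s <= qm -> loclip (fun z : R * V => F z.1 z.2) (s, 0)) ->
  continuous P -> continuous Pd -> continuous rt -> open D ->
  (forall s, qp <= s <= qm -> 0 < rt (s, 0)) ->
  (forall s, qp <= s <= qm -> D (s, 0)) ->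
  (forall (Y : R -> V) (s : R), is_derive s 1 Y (F s (Y s)) -> 0 < rt (s, Y s) ->
    is_derive s 1 (fun t => P (t, Y t)) (Pd (s, Y s) / rt (s, Y s))) ->
  qp < qm -> 0 < Pd (qp, 0) -> (forall s, qp < s < qm -> 0 < P (s, 0)) ->
  P (qm, 0) = 0 -> Pd (qm, 0) < 0 ->
  forall eta : R, 0 < eta -> exists2 dl, 0 < dl &
  forall sp yp, `|sp - qp| < dl -> `|yp| < dl -> P (sp, yp) = 0 ->
  exists e Y, [/\ [/\ sp < e, `|e - qm| < eta, continuous Y & Y sp = yp],
    [/\ forall s, sp < s < e -> is_derive s 1 Y (F s (Y s)),
        forall s, sp <= s <= e -> [/\ `|Y s| < eta, 0 < rt (s, Y s) & D (s, Y s)],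
        forall s, sp < s < e -> 0 < P (s, Y s),
        P (e, Y e) = 0 & Pd (e, Y e) < 0], 0 < Pd (sp, yp) &
    forall e' Z, sp < e' -> continuous Z -> Z sp = yp ->
      (forall s, sp < s < e' -> is_derive s 1 Z (F s (Z s))) ->
      P (e', Z e') = 0 ->
      (forall s, sp <= s < e' -> ~ [/\ D (s, Z s), P (s, Z s) = 0 & Pd (s, Z s) < 0]) ->
      e' = e /\ Z e' = Y e].
Proof.
move=> F0 FL Pc Pdc rtc Do rt0 D0 chain qpm Pdp P0 Pm Pdm eta eta0.
have [L L0 LP] := tube qpm FL rtc Do rt0 D0.
have [e1 e10 e1P] := near0_of_continuous Pdc Pdp.
have [e2 e20 e2P] : exists2 e, 0 < e & forall t y, `|t - qm| < e -> `|y| < e -> Pd (t, y) < 0.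
  have [||e e0 eP] := @near0_of_continuous V (fun z => - Pd z) qm.
  - by move=> z; apply: cvgN; exact: Pdc.
  - by rewrite oppr_gt0.
  - by exists e => // t y te ye; rewrite -oppr_gt0; exact: eP.
have L10 : 0 < L^-1 by rewrite invr_gt0.
have L2 : 0 <= 2 * L by rewrite mulr_ge0// ltW.
(* In the windows of half-width [th] around [qp] and [qm] the sign of [Pd] is known for small [y].
   Halving the minimum makes all the bounds strict. *)
pose th := Num.min (Num.min (Num.min e1 e2) L^-1) (Num.min eta ((qm - qp) / 2)) / 2.
have [th0 th1 th2 th3 [th4 th5]] :
    [/\ 0 < th, th < e1, th < e2, th < L^-1 & th < eta /\ th < (qm - qp) / 2].
  have m0 : 0 < Num.min (Num.min (Num.min e1 e2) L^-1) (Num.min eta ((qm - qp) / 2)).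
    by rewrite !lt_min e10 e20 L10 eta0 divr_gt0 ?subr_gt0.
  have : th < Num.min (Num.min (Num.min e1 e2) L^-1) (Num.min eta ((qm - qp) / 2)).
    by rewrite /th; lra.
  by rewrite !lt_min => /andP[/andP[/andP[? ?] ?] /andP[? ?]]; split=> //; rewrite /th divr_gt0.
(* Solutions are followed slightly past [qm], to a point where the height along [y = 0] is already
   negative. *)
pose b := qm + th.
have LP' s x : qp - th <= s <= b -> `|x| < L^-1 ->
    {for (s, x), continuous (fun z : R * V => F z.1 z.2)} /\ (0 < rt (s, x) /\ D (s, x)).
  move=> /andP[s1 s2] xL; have [|_ ? ? ?] := LP s x x _ xL xL; last by [].
  by apply/andP; rewrite /b in s2; clear -s1 s2 th3 th0 L10; split; lra.
have pid (Y : R -> V) (s : R) : continuous Y -> {for s, continuous (fun t => P (t, Y t))}.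
  move=> Yc; apply: (@continuous_comp_at _ _ _ (fun t => (t, Y t)) P); last exact: Pc.
  by apply: continuous_pair; [exact: cvg_id|exact: Yc].
have rtP0 t : qm < t -> t < b -> 0 < rt (t, 0).
  move=> t1 t2; have tb : qp - th <= t <= b by apply/andP; split; [lra|exact: ltW].
  by have [|_ []] := LP' t 0 tb; rewrite ?normr0.
have Pb : P (b, 0) < 0.
  rewrite -oppr_gt0 -[X in X < _]oppr0 -Pm.
  apply: (@increasing_of_derive_gt0 (fun t => - P (t, 0)) (fun t => - (Pd (t, 0) / rt (t, 0)))).
  - by rewrite /b ltrDl.
  - by move=> t; apply: cvgN; apply: (pid (cst 0)); exact: cst_continuous.
  - move=> t /andP[t1 t2]; apply: is_deriveN; apply: (chain (cst 0)).
      by rewrite F0; exact: is_derive_cst.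
    exact: rtP0.
  - move=> t /andP[t1 t2]; rewrite -mulNr divr_gt0//.
      rewrite oppr_gt0; apply: e2P; last by rewrite normr0.
      by rewrite /b in t2; rewrite ltr_norml; apply/andP; split; lra.
    exact: rtP0.
have [e3 e30 e3P] : exists2 e, 0 < e & forall y, `|y| < e -> P (b, y) < 0.
  have [||e e0 eP] := @near0_of_continuous V (fun z => - P z) b.
  - by move=> z; apply: cvgN; exact: Pc.
  - by rewrite oppr_gt0.
  - by exists e => // y ye; rewrite -oppr_gt0; apply: eP => //; rewrite subrr normr0.
have [M M0 MP] : exists2 M, 0 < M & forall s, qp + th <= s <= qm - th ->
    forall y, `|y| < M^-1 -> 0 < P (s, y).
  apply: compact_uniform => s0 /andP[s1 s2].
  have [|e e0 eP] := near0_of_continuous Pc (P0 s0 _).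
    by apply/andP; split; lra.
  exists e => // s M se eM y yM; apply: eP => //; apply: (lt_trans yM).
  by rewrite -[ltRHS]invrK ltf_pV2 ?posrE ?invr_gt0// (lt_trans _ eM)// invr_gt0.
pose r := Num.min (Num.min th e3) (M^-1).
have [r0 r1 r2 r3] : [/\ 0 < r, r <= th, r <= e3 & r <= M^-1].
  by rewrite /r !lt_min th0 e30 invr_gt0 M0 !ge_min !lexx !orbT.
(* Computed from the earliest possible start [qp - th], so that it bounds the growth factor for
   every [sp]. *)
pose E := expR (2 * L * (b - (qp - th))).
have E0 : 0 < E by exact: expR_gt0.
exists (Num.min th (r / E)); first by rewrite lt_min th0 divr_gt0.
move=> sp yp; rewrite !lt_min => /andP[spth _] /andP[_]; rewrite ltr_pdivlMr// => ypE Psp.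
have /andP[sp1 sp2] : qp - th < sp < qp + th by rewrite -ltr_distl.
have spb : sp < b by rewrite /b; clear -sp2 th5 qpm th0; lra.
have ypr : `|yp| * expR (2 * L * (b - sp)) < r.
  apply: le_lt_trans ypE; rewrite ler_wpM2l// ler_expR ler_wpM2l//.
  by rewrite lerD2l lerN2 ltW.
have Fc t y : sp <= t <= b -> `|y| < r ->
    {for (t, y), continuous (fun z : R * V => F z.1 z.2)}.
  move=> /andP[t1 t2] yr; have [] // := LP' t y.
    by rewrite t2 andbT (le_trans _ t1)// ltW.
  by apply: (lt_trans yr); apply: le_lt_trans r1 _.
have Fl t x y : sp <= t <= b -> `|x| < r -> `|y| < r -> `|F t x - F t y| <= L * `|x - y|.
  move=> /andP[t1 t2] xr yr; have [] // := LP t x y.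
  - by rewrite /b in t2; apply/andP; clear -t1 t2 sp1 th3; split; lra.
  - by apply: (lt_trans xr); apply: le_lt_trans r1 _.
  - by apply: (lt_trans yr); apply: le_lt_trans r1 _.
have [Y [Yc Ysp Yd Yb]] := picard niceV spb (ltW L0) Fc Fl F0 ypr.
have Yr s : sp <= s <= b -> `|Y s| < r.
  move=> sb; apply: (le_lt_trans (Yb s sb)); apply: le_lt_trans ypr.
  rewrite ler_wpM2l// ler_expR ler_wpM2l//.
  by rewrite lerD2r; case/andP: sb.
pose f s := P (s, Y s); have fc : continuous f by move=> s; exact: pid.
have rtD s : sp <= s <= b -> 0 < rt (s, Y s) /\ D (s, Y s).
  move=> sb; have [] := LP' s (Y s) => //.
    by case/andP: sb => s1 ->; rewrite andbT (le_trans _ s1)// ltW.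
  by apply: (lt_trans (Yr s sb)); apply: le_lt_trans r1 _.
have fd s : sp < s < b -> is_derive s 1 f (Pd (s, Y s) / rt (s, Y s)).
  move=> sb; apply: chain; first exact: Yd.
  by case/andP: sb => s1 s2; have [] // := rtD s; rewrite !ltW.
have f1 s : sp < s <= qp + th -> 0 < f s.
  move=> /andP[s1 s2]; rewrite -Psp -Ysp -/(f sp).
  apply: (increasing_of_derive_gt0 (df := fun t => Pd (t, Y t) / rt (t, Y t)) s1 fc).
    by move=> t /andP[t1 t2]; apply: fd; rewrite t1 /b; clear -t2 s2 th0 qpm; lra.
  move=> t /andP[t1 t2]; have tb : sp <= t <= b.
    by rewrite (ltW t1)/= /b; clear -t2 s2 th0 qpm; lra.
  apply: divr_gt0; last by have [] := rtD t tb.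
  apply: e1P.
    by rewrite ltr_norml; apply/andP; clear -t1 t2 s2 sp1 th1; split; lra.
  by apply: (lt_trans (Yr t tb)); apply: le_lt_trans r1 _.
have f2 s : qp + th <= s <= qm - th -> 0 < f s.
  move=> sm; apply: MP => //; apply: lt_le_trans r3; apply: Yr.
  by case/andP: sm => s1 s2; rewrite /b; apply/andP; clear -s1 s2 sp2 th0; split; lra.
have f3 s t : qm - th <= s -> s < t -> t <= b -> f t < f s.
  move=> s1 st tb; rewrite -ltrN2.
  apply: (@increasing_of_derive_gt0 (fun u => - f u)
    (fun u => - (Pd (u, Y u) / rt (u, Y u))) _ _ st).
  - by move=> u; apply: cvgN; exact: fc.
  - move=> u /andP[u1 u2]; apply: is_deriveN; apply: fd; apply/andP.
    by clear -u1 u2 s1 tb sp2 th5; split; lra.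
  - move=> u /andP[u1 u2]; have ub : sp <= u <= b.
      by apply/andP; clear -u1 u2 s1 tb sp2 th5; split; lra.
    rewrite -mulNr divr_gt0//; last by have [] := rtD u ub.
    rewrite oppr_gt0; apply: e2P.
      rewrite /b in tb; rewrite ltr_norml; apply/andP.
      by clear -u1 u2 s1 tb th2; split; lra.
    by apply: (lt_trans (Yr u ub)); apply: le_lt_trans r1 _.
have fb : f b < 0 by apply: e3P; apply: lt_le_trans r2; apply: Yr; rewrite (ltW spb)/=.
have fm : 0 < f (qm - th) by apply: f2; apply/andP; clear -th5; split; lra.
have [e] : exists2 c, c \in `[qm - th, b] & f c = 0.
  apply: IVT; first by rewrite /b; clear -th0; lra.
    exact: continuous_subspaceT.
  by rewrite ge_min le_max (ltW fb) (ltW fm) orbT.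
rewrite in_itv/= => /andP[e4 e5] fe.
have e6 : qm - th < e.
  by rewrite lt_neqAle e4 andbT; apply/eqP => E1; move: fm; rewrite E1 fe ltxx.
have e7 : e < b.
  by rewrite lt_neqAle e5 andbT; apply/eqP => E1; move: fb; rewrite -E1 fe ltxx.
have spe : sp < e by clear -sp2 th5 e6; lra.
have em : `|e - qm| < th.
  by rewrite /b in e7; rewrite ltr_norml; apply/andP; clear -e6 e7; split; lra.
have eb : sp <= e <= b by rewrite !ltW.
have fpos s : sp < s < e -> 0 < f s.
  move=> /andP[s1 s2]; have [s3|s3] := leP s (qp + th); first by rewrite f1// s1.
  have [s4|s4] := leP s (qm - th); first by rewrite f2// (ltW s3).
  by rewrite -fe; apply: f3 => //; exact: ltW.
have Pde : Pd (e, Y e) < 0.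
  apply: e2P; first exact: lt_trans th2.
  by apply: (lt_trans (Yr e eb)); apply: le_lt_trans r1 _.
exists e, Y; split.
- by split=> //; exact: lt_trans th4.
- split=> //.
  + by move=> s /andP[s1 s2]; apply: Yd; rewrite s1 (lt_trans s2).
  + move=> s /andP[s1 s2]; have sb : sp <= s <= b by rewrite s1 (le_trans s2).
    have [] := rtD s sb; split=> //; apply: (lt_trans (Yr s sb)).
    exact: le_lt_trans th4.
- rewrite -Ysp; apply: e1P; first exact: lt_trans th1.
  by apply: (lt_trans (Yr sp _)); [rewrite lexx ltW|apply: le_lt_trans th1].
move=> e' Z spe' Zc Zsp Zd PZ nZ.
(* The two solutions agree up to [c]. If [e' < e], the height along [Y] would vanish before [e]; if
   [e < e'], then [Z] would have met the impact surface already at [e]. *)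
pose c := Num.min e e'.
have ce : c <= e by rewrite ge_min lexx.
have ce' : c <= e' by rewrite ge_min lexx orbT.
have cb : c <= b by rewrite (le_trans ce)// ltW.
have YZ : forall t, sp <= t <= c -> Y t = Z t.
  apply: (@ode_unique R V niceV sp b L r F (ltW L0) Fl F0 Y Z c cb Yc Zc).
  - by move=> t /andP[t1 t2]; apply: Yd; rewrite t1 (lt_le_trans t2).
  - by move=> t /andP[t1 t2]; apply: Zd; rewrite t1 (lt_le_trans t2).
  - by rewrite Ysp Zsp.
  - by rewrite Ysp.
case: (ltgtP e' e) => [e'e|ee'|e'e].
- have := fpos e'; rewrite spe' e'e => /(_ isT); rewrite /f YZ ?PZ ?ltxx//.
  by rewrite (ltW spe') /c le_min lexx ltW.
- exfalso; apply: (nZ e); first by rewrite (ltW spe).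
  rewrite -YZ; last by rewrite (ltW spe) /c le_min lexx ltW.
  by split=> //; have [] := rtD e eb.
- by split=> //; rewrite e'e YZ// (ltW spe) /c e'e minxx lexx.
Qed.

End Crossing.

(** * Smooth functions of q_N and of (q_r, q_N) *)

Section Smooth.
Context (R : realType).

Lemma smooth_C1 (U W : normedModType R) (f : U -> W) : smooth f -> C1 f.
Proof. by move=> /(_ 1%N) /= [_ [fd fc]]; split=> // v; have [] := fc v. Qed.

Lemma smooth_continuous (U W : normedModType R) (f : U -> W) :
  smooth f -> continuous f.
Proof. by move=> /(_ 0%N) /= []. Qed.

Lemma smooth_derive1 (W : normedModType R) (f : R -> W) :
  smooth f -> smooth (derive1 f).
Proof.
move=> fs k; have [_ [_ /(_ 1)]] := fs k.+1.
by have -> : derive1 f = (fun x => 'D_1 f x) by apply/funext => x; rewrite derive1E.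
Qed.

Lemma C1_entry (U : normedModType R) m n (f : U -> 'M[R]_(m, n)) i j :
  C1 f -> C1 (fun x => f x i j).
Proof.
move=> [fd fc]; split=> [x v|v]; first exact: ((derivable_mxP f x v).1 (fd x v)).
have -> : (fun x => 'D_v (fun y => f y i j) x) = (fun x => 'D_v f x i j).
  by apply/funext => x; rewrite derive_mx// mxE.
move=> x; apply: (@continuous_comp_at _ _ _ (fun x => 'D_v f x)
  (fun M : 'M[R]_(m, n) => M i j)); [exact: fc|exact: coord_continuous].
Qed.

Lemma C1_loclip_real (f : R -> R) x : C1 f -> loclip f x.
Proof.
apply: (@C1_loclip _ R unit (fun=> 1) [:: tt] (fun u _ => u)) => // u.
by rewrite big_seq1 /GRing.scale/= mulr1.
Qed.

Section PairFrame.
Context (n : nat).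

(** The canonical basis of the product, [None] standing for the scalar coordinate. *)
Definition pair_dir (i : option 'I_n) : 'cV[R]_n * R :=
  if i is Some j then (delta_mx j 0, 0) else (0, 1).
Definition pair_coord (u : 'cV[R]_n * R) (i : option 'I_n) : R :=
  if i is Some j then u.1 j 0 else u.2.
Definition pair_index := None :: [seq Some i | i <- enum 'I_n].

Lemma pair_frame u : u = \sum_(i <- pair_index) pair_coord u i *: pair_dir i.
Proof.
have pairE (r : seq 'I_n) : \sum_(i <- r) u.1 i 0 *: (delta_mx i 0, 0 : R)
    = (\sum_(i <- r) u.1 i 0 *: delta_mx i 0, 0) :> 'cV[R]_n * R.
  elim: r => [|i r IH]; first by rewrite !big_nil.
  by rewrite !big_cons IH; apply: injective_projections; rewrite /= ?scaler0 ?add0r.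
have u1E : u.1 = \sum_i u.1 i 0 *: delta_mx i 0.
  rewrite [LHS]matrix_sum_delta; apply: eq_bigr => i _; by rewrite big_ord1.
rewrite /pair_index big_cons big_map/= pairE big_enum/= -u1E.
case: u {pairE u1E} => h s; apply: injective_projections => /=.
  by rewrite scaler0 add0r.
by rewrite addr0 /GRing.scale/= mulr1.
Qed.

Lemma pair_coord_le u i : `|pair_coord u i| <= `|u|.
Proof.
have [u1 u2] := (prod_norm_leP u _).1 (lexx _).
case: i => [j|] //=; apply: le_trans u1.
exact: (mx_norm_leP _ (normr_ge0 _)).1.
Qed.

Lemma C1_loclip_pair (f : 'cV[R]_n * R -> R) x : C1 f -> loclip f x.
Proof. exact: (C1_loclip pair_frame pair_coord_le). Qed.

Lemma pair_coordD u w i : pair_coord (u + w) i = pair_coord u i + pair_coord w i.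
Proof. by case: i => [j|] //=; rewrite mxE. Qed.

Lemma pair_coordZ k u i : pair_coord (k *: u) i = k * pair_coord u i.
Proof. by case: i => [j|] //=; rewrite mxE. Qed.

Lemma derive_pairE (f : 'cV[R]_n * R -> R) x w : C1 f ->
  'D_w f x = \sum_(i <- pair_index) pair_coord w i * 'D_(pair_dir i) f x.
Proof. by move=> fC; apply: (derive_frame x fC (pair_coord_le w)); exact: pair_frame. Qed.

Lemma derive_pairZ (f : 'cV[R]_n * R -> R) x k w : C1 f ->
  'D_(k *: w) f x = k * 'D_w f x.
Proof.
move=> fC; rewrite !derive_pairE// mulr_sumr; apply: eq_bigr => i _.
by rewrite pair_coordZ mulrA.
Qed.

(** By linearity in the direction, the expression is a finite sum of coordinates of [w] times
    continuous partial derivatives; so the direction may move together with the point. *)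
Lemma continuous_derive_pair (T : topologicalType) (f : 'cV[R]_n * R -> R)
    (p w : T -> 'cV[R]_n * R) : C1 f -> continuous p -> continuous w ->
  continuous (fun t => 'D_(w t) f (p t)).
Proof.
move=> fC pc wc t; have [_ fc] := fC.
have -> : (fun t => 'D_(w t) f (p t)) = (fun t =>
    \sum_(i <- pair_index) pair_coord (w t) i * 'D_(pair_dir i) f (p t)).
  by apply/funext => s; rewrite derive_pairE.
elim: pair_index => [|i r IH].
  by under eq_fun do rewrite big_nil; exact: cst_continuous.
under eq_fun do rewrite big_cons; apply: cvgD => //; apply: cvgM.
  apply: (@continuous_comp_at _ _ _ w (pair_coord ^~ i)); first exact: wc.
  by apply: loclip_continuous; apply: (@loclip_lipschitz _ _ _ _ 1) => // y z;
    rewrite mul1r -[X in _ - X]mul1r -[- _]mulNr -pair_coordZ -pair_coordD scaleN1r pair_coord_le.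
apply: (@continuous_comp_at _ _ _ p (fun x => 'D_(pair_dir i) f x)); [exact: pc|exact: fc].
Qed.

End PairFrame.

Lemma smooth_loclip_real (f : R -> R) x : smooth f -> loclip f x.
Proof. by move=> /smooth_C1; exact: C1_loclip_real. Qed.

Lemma smooth_loclip_real_mx m n (f : R -> 'M[R]_(m, n)) x : smooth f -> loclip f x.
Proof.
move=> /smooth_C1 fC; apply/loclip_mxP => i j; apply: C1_loclip_real; exact: C1_entry.
Qed.

Lemma smooth_loclip_pair_mx k m n (f : 'cV[R]_k * R -> 'M[R]_(m, n)) x :
  smooth f -> loclip f x.
Proof.
move=> /smooth_C1 fC; apply/loclip_mxP => i j; apply: C1_loclip_pair; exact: C1_entry.
Qed.

End Smooth.

Section BlockLemmas.
Context (R : realType) (n : nat).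

Lemma bfst_stack a v b : bfst (@stack R n a v b) = a.
Proof. by rewrite /bfst /stack /ifst !col_mxEu mxE. Qed.

Lemma bmid_stack a v b : bmid (@stack R n a v b) = v.
Proof. by rewrite /bmid /stack col_mxKu col_mxKd. Qed.

Lemma blst_stack a v b : blst (@stack R n a v b) = b.
Proof. by rewrite /blst /stack /ilst col_mxEd mxE. Qed.

Lemma stack_eta w : @stack R n (bfst w) (bmid w) (blst w) = w.
Proof.
rewrite /stack /bfst /bmid /blst -[RHS]vsubmxK; congr col_mx.
  rewrite -[RHS]vsubmxK; congr col_mx; apply/matrixP => i j.
  by rewrite !ord1 !mxE/= ?mulr1n.
by apply/matrixP => i j; rewrite !ord1 !mxE/= ?mulr1n.
Qed.

Lemma stackD a v b a' v' b' : @stack R n a v b + stack a' v' b' =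
  stack (a + a') (v + v') (b + b').
Proof. by rewrite /stack !add_col_mx !raddfD. Qed.

Lemma stackZ k a v b : k *: @stack R n a v b = stack (k * a) (k *: v) (k * b).
Proof. by rewrite /stack !scale_col_mx !scale_scalar_mx. Qed.

Lemma stack_delta : @stack R n 1 0 0 = delta_mx ifst 0.
Proof.
rewrite -[RHS]stack_eta /bfst /blst !mxE eqxx.
have -> : (ilst == ifst :> 'I_(1 + n + 1)) = false by [].
by congr stack; apply/matrixP => i j; rewrite !mxE.
Qed.

Lemma loclip_stack (U : normedModType R) (a b : U -> R) (v : U -> 'cV[R]_n) x :
  loclip a x -> loclip v x -> loclip b x -> loclip (fun y => stack (a y) (v y) (b y)) x.
Proof.
move=> ax /loclip_mxP vx bx; apply/loclip_mxP => i j.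
case: (splitP i) => [k ik|k ik].
- have -> : i = lshift 1 k by exact: val_inj.
  under eq_fun do rewrite col_mxEu.
  case: (splitP k) => [l kl|l kl].
  + have -> : k = lshift n l by exact: val_inj.
    by under eq_fun do rewrite col_mxEu !ord1 mxE/= mulr1n.
  + have -> : k = rshift 1 l by exact: val_inj.
    by under eq_fun do rewrite col_mxEd.
- have -> : i = rshift (1 + n) k by exact: val_inj.
  by under eq_fun do rewrite col_mxEd !ord1 mxE/= mulr1n.
Qed.

Lemma loclip_bfst (U : normedModType R) (w : U -> 'cV[R]_(1 + n + 1)) x :
  loclip w x -> loclip (fun y => bfst (w y)) x.
Proof. by move=> /loclip_mxP; exact. Qed.

Lemma loclip_blst (U : normedModType R) (w : U -> 'cV[R]_(1 + n + 1)) x :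
  loclip w x -> loclip (fun y => blst (w y)) x.
Proof. by move=> /loclip_mxP; exact. Qed.

Lemma loclip_bmid (U : normedModType R) (w : U -> 'cV[R]_(1 + n + 1)) x :
  loclip w x -> loclip (fun y => bmid (w y)) x.
Proof.
move=> /loclip_mxP wx; apply/loclip_mxP => i j.
by under eq_fun do rewrite !mxE; exact: wx.
Qed.

End BlockLemmas.

(** * The robot in the coordinates (q_N, y) *)

Section ReturnMap.
Context (R : realType) (n : nat) (rb : robot R n) (hrb : robot_hyp rb)
  (rf : references R n) (hrf : references_hyp rb rf).

(** The state modulo the disc angle. It determines [valid], [p2dot] and [surface], and it is all
    that [state_of_y] recovers from [(q_N, y)]. *)
Definition reduced (x : state R n) := (qr x, qN x, x.2).

Lemma p2dot_reduced x x' : reduced x = reduced x' -> p2dot rb x = p2dot rb x'.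
Proof. by rewrite /reduced /p2dot /qr' /qN' => -[-> -> ->]. Qed.

Section Gains.
Variable g : gains R n.

Local Notation Z := (R * ycoord R n)%type.

Definition speed (z : Z) : R := rate rf g z.1 z.2.1.2 z.2.2.
Definition height (z : Z) : R := p2 rb (z.2.1.1.1 + href rf z.1, z.1).
Definition climb (z : Z) : R := p2dot rb (state_of_y rf g z.1 z.2).
Definition momenta (z : Z) : 'cV[R]_(1 + n + 1) :=
  stack (z.2.1.2 + Sref rf z.1)
    (z.2.1.1.2 + speed z *: derive1 (href rf) z.1) (speed z).
Definition in_dom : set Z :=
  [set z | dom rb (z.2.1.1.1 + href rf z.1, z.1, momenta z)].

Lemma state_of_yE s y :
  state_of_y rf g s y = (stack 0 (y.1.1.1 + href rf s) s, momenta (s, y)).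
Proof. by case: y => [[[h h'] b] c]. Qed.

Lemma reduced_state_of_y s y :
  reduced (state_of_y rf g s y) = (y.1.1.1 + href rf s, s, momenta (s, y)).
Proof. by rewrite /reduced /qr /qN state_of_yE/= bmid_stack blst_stack. Qed.

Lemma climbE z : climb z =
  'D_(z.2.1.1.2 + speed z *: derive1 (href rf) z.1, speed z) (p2 rb)
     (z.2.1.1.1 + href rf z.1, z.1).
Proof.
case: z => s y; rewrite /climb /p2dot /qr /qN /qr' /qN' state_of_yE/=.
by rewrite !bmid_stack !blst_stack.
Qed.

Lemma valid_state_of_y s y :
  valid rb (state_of_y rf g s y) <-> in_dom (s, y) /\ 0 <= height (s, y).
Proof.
by have := reduced_state_of_y s y; rewrite /reduced /valid /in_dom/= => -[-> -> ->].
Qed.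

Lemma surface_state_of_y s y : surface rb (state_of_y rf g s y) <->
  [/\ in_dom (s, y), height (s, y) = 0 & climb (s, y) < 0].
Proof.
have E : p2 rb (qr (state_of_y rf g s y), qN (state_of_y rf g s y)) = height (s, y).
  by have := reduced_state_of_y s y => -[-> -> _].
split=> [[/valid_state_of_y[xd x0] x1 x2]|[xd x0 xc]]; first by split=> //; rewrite -E.
by split=> //; [apply/valid_state_of_y; rewrite x0|rewrite E].
Qed.

Lemma state_of_y_of_state x :
  reduced (state_of_y rf g (qN x) (y_of_state rf g x)) = reduced x.
Proof.
rewrite reduced_state_of_y /reduced /y_of_state /hr/= subrK; congr (_, _, _).
have E : speed (qN x, y_of_state rf g x) = qN' x.
  by rewrite /speed /rate /y_of_state/= /cvar; ring.
rewrite /momenta E/= /bvar subrK /hr' subrK.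
exact: stack_eta.
Qed.

Lemma nominalE s : nominal rf s = state_of_y rf g s 0.
Proof.
have E : speed (s, 0) = Vref rf s by rewrite /speed /rate/= mulr0 addr0 add0r.
by rewrite state_of_yE /momenta E /nominal/= !add0r.
Qed.

Lemma speed0 s : speed (s, 0) = Vref rf s.
Proof. by rewrite /speed /rate/= mulr0 addr0 add0r. Qed.

Section LocallyLipschitzData.
Variable z : Z.

Lemma loclip_comp1 (W : normedModType R) (f : R -> W) :
  loclip f z.1 -> loclip (fun z : Z => f z.1) z.
Proof. by move=> fz; apply: loclip_comp fz; apply: loclip_fst; exact: loclip_id. Qed.

Lemma loclip_h : loclip (fun z : Z => z.2.1.1.1) z.
Proof. by do 3 apply: loclip_fst; apply: loclip_snd; exact: loclip_id. Qed.
Lemma loclip_h' : loclip (fun z : Z => z.2.1.1.2) z.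
Proof. by apply: loclip_snd; do 2 apply: loclip_fst; apply: loclip_snd; exact: loclip_id. Qed.
Lemma loclip_b : loclip (fun z : Z => z.2.1.2) z.
Proof. by apply: loclip_snd; apply: loclip_fst; apply: loclip_snd; exact: loclip_id. Qed.
Lemma loclip_c : loclip (fun z : Z => z.2.2) z.
Proof. by do 2 apply: loclip_snd; exact: loclip_id. Qed.

Lemma loclip_href : loclip (fun z : Z => href rf z.1) z.
Proof. by apply: loclip_comp1; apply: smooth_loclip_real_mx; exact: href_smooth hrf. Qed.
Lemma loclip_dhref : loclip (fun z : Z => derive1 (href rf) z.1) z.
Proof.
apply: loclip_comp1; apply: smooth_loclip_real_mx; apply: smooth_derive1.
exact: href_smooth hrf.
Qed.
Lemma loclip_Vref : loclip (fun z : Z => Vref rf z.1) z.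
Proof. by apply: loclip_comp1; apply: smooth_loclip_real; exact: Vref_smooth hrf. Qed.
Lemma loclip_Sref : loclip (fun z : Z => Sref rf z.1) z.
Proof. by apply: loclip_comp1; apply: smooth_loclip_real; exact: Sref_smooth hrf. Qed.
Lemma loclip_dSref : loclip (fun z : Z => derive1 (Sref rf) z.1) z.
Proof.
apply: loclip_comp1; apply: smooth_loclip_real; apply: smooth_derive1.
exact: Sref_smooth hrf.
Qed.

Lemma loclip_speed : loclip speed z.
Proof.
apply: loclipD; first by apply: loclipD; [exact: loclip_c|exact: loclip_Vref].
apply: loclipM; last exact: loclip_b.
by apply: loclipM; [exact: loclip_cst|exact: loclip_dSref].
Qed.

Lemma loclip_position : loclip (fun z : Z => (z.2.1.1.1 + href rf z.1, z.1)) z.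
Proof.
apply: loclip_pair; first by apply: loclipD; [exact: loclip_h|exact: loclip_href].
by apply: loclip_fst; exact: loclip_id.
Qed.

Lemma loclip_velocity : loclip (fun z : Z => z.2.1.1.2 + speed z *: derive1 (href rf) z.1) z.
Proof.
apply: loclipD; first exact: loclip_h'.
by apply: loclipZ; [exact: loclip_speed|exact: loclip_dhref].
Qed.

Lemma loclip_momenta : loclip momenta z.
Proof.
apply: loclip_stack; first by apply: loclipD; [exact: loclip_b|exact: loclip_Sref].
  exact: loclip_velocity.
exact: loclip_speed.
Qed.

Lemma loclip_height : loclip height z.
Proof.
apply: (loclip_comp loclip_position); apply: C1_loclip_pair; apply: smooth_C1.
exact: p2_smooth hrb.
Qed.

(* [f2] need not be continuous: [f2_eq] trades it for smooth data. *)
Lemma y_fieldE s y : y_field rf g s y =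
  let dS := derive1 (Sref rf) s in
  let xi := (speed (s, y))^-1 in
  (xi *: y.1.1.2, xi *: (- (KP g *m y.1.1.1) - KV g *m y.1.1.2),
   xi * (- blst (gravity rb (y.1.1.1 + href rf s, s)) - dS * Vref rf s - dS * y.2
         - gamma g / beta0 g * dS ^+ 2 * y.1.2),
   xi * (- beta0 g * y.2)).
Proof.
case: y => [[[h h'] b] c]; rewrite /y_field/=; congr (_, _ * _, _).
by rewrite -(f2_eq hrf).
Qed.

Lemma loclip_y_field : speed z != 0 -> loclip (fun z : Z => y_field rf g z.1 z.2) z.
Proof.
move=> z0; rewrite (funext (fun z : Z => y_fieldE z.1 z.2)) /=.
have xi : loclip (fun z : Z => (speed (z.1, z.2))^-1) z.
  have -> : (fun z : Z => (speed (z.1, z.2))^-1) = (fun z : Z => (speed z)^-1).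
    by apply/funext => -[].
  by apply: loclipV => //; exact: loclip_speed.
have dS := loclip_dSref; have h := loclip_h; have h' := loclip_h'.
apply: loclip_pair; first apply: loclip_pair; first apply: loclip_pair.
- exact: loclipZ.
- apply: loclipZ => //; apply: loclipB; first apply: loclipN.
    by apply: loclip_mulmx => //; exact: loclip_cst.
  by apply: loclip_mulmx => //; exact: loclip_cst.
- apply: loclipM => //; apply: loclipB; first apply: loclipB; first apply: loclipB.
  + apply: loclipN; apply: loclip_blst.
    apply: (loclip_comp loclip_position (g := gravity rb)).
    by apply: smooth_loclip_pair_mx; exact: gravity_smooth hrb.
  + by apply: loclipM => //; exact: loclip_Vref.
  + by apply: loclipM => //; exact: loclip_c.
  + apply: loclipM; last exact: loclip_b.
    by apply: loclipM; [exact: loclip_cst|exact: loclipM].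
- apply: loclipM => //; apply: loclipM; [exact: loclip_cst|exact: loclip_c].
Qed.

(** The value of [q_N] after the impact is kept, as it varies with the point of the impact
    surface. *)
Definition impact_y (z : Z) : Z :=
  let x := impact rb (state_of_y rf g z.1 z.2) in (qN x, y_of_state rf g x).

Lemma loclip_impact_y : loclip impact_y z.
Proof.
have xE : (fun z : Z => impact rb (state_of_y rf g z.1 z.2)) =
    (fun z : Z => (impact_q rb *m stack 0 (z.2.1.1.1 + href rf z.1) z.1,
      impact_w rb (z.2.1.1.1 + href rf z.1, z.1) *m momenta z)).
  apply/funext => -[s y]; have := reduced_state_of_y s y.
  by rewrite /impact /reduced => -[-> -> ->]; rewrite state_of_yE.
have x1 : loclip (fun z : Z => (impact rb (state_of_y rf g z.1 z.2)).1) z.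
  apply: loclip_fst; rewrite xE; apply: loclip_pair; last first.
    apply: loclip_mulmx; last exact: loclip_momenta.
    apply: (loclip_comp loclip_position (g := impact_w rb)).
    by apply: smooth_loclip_pair_mx; exact: impact_w_smooth hrb.
  apply: loclip_mulmx; first exact: loclip_cst.
  apply: loclip_stack; first exact: loclip_cst.
    exact: (loclip_fst loclip_position).
  exact: (loclip_snd loclip_position).
have x2 : loclip (fun z : Z => (impact rb (state_of_y rf g z.1 z.2)).2) z.
  apply: loclip_snd; rewrite xE; apply: loclip_pair.
    apply: loclip_mulmx; first exact: loclip_cst.
    apply: loclip_stack; first exact: loclip_cst.
      exact: (loclip_fst loclip_position).
    exact: (loclip_snd loclip_position).
  apply: loclip_mulmx; last exact: loclip_momenta.
  apply: (loclip_comp loclip_position (g := impact_w rb)).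
  by apply: smooth_loclip_pair_mx; exact: impact_w_smooth hrb.
have q : loclip (fun z : Z => qN (impact rb (state_of_y rf g z.1 z.2))) z.
  exact: loclip_blst.
have q' : loclip (fun z : Z => qN' (impact rb (state_of_y rf g z.1 z.2))) z.
  exact: loclip_blst.
have Sx f : smooth f -> loclip (fun z : Z => f (qN (impact rb (state_of_y rf g z.1 z.2))) : R) z.
  by move=> fs; apply: (loclip_comp q); exact: smooth_loclip_real.
have bx : loclip (fun z : Z => bvar rf (impact rb (state_of_y rf g z.1 z.2))) z.
  by apply: loclipB; [exact: loclip_bfst|apply: Sx; exact: Sref_smooth hrf].
apply: loclip_pair => //; apply: loclip_pair; first apply: loclip_pair => //.
  apply: loclip_pair.
    apply: loclipB; first exact: loclip_bmid.
    by apply: (loclip_comp q); apply: smooth_loclip_real_mx; exact: href_smooth hrf.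
  apply: loclipB; first exact: loclip_bmid.
  apply: loclipZ => //; apply: (loclip_comp q (g := derive1 (href rf))).
  by apply: smooth_loclip_real_mx; apply: smooth_derive1; exact: href_smooth hrf.
apply: loclipB; first by apply: loclipB => //; apply: Sx; exact: Vref_smooth hrf.
apply: loclipM => //; apply: loclipM; first exact: loclip_cst.
by apply: (Sx (derive1 (Sref rf))); apply: smooth_derive1; exact: Sref_smooth hrf.
Qed.

End LocallyLipschitzData.

(** By [Sref_eq] the reference [S] follows the gravity term exactly along the nominal orbit. *)
Lemma y_field0 s : y_field rf g s 0 = 0.
Proof.
rewrite y_fieldE/= !mulmx0 !(oppr0, subr0, scaler0, mulr0, add0r).
by have := Sref_eq hrf s; rewrite /k2 add0r => <-; rewrite subrr mulr0.
Qed.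

Lemma continuous_climb : continuous climb.
Proof.
rewrite (funext climbE).
apply: continuous_derive_pair; first exact/smooth_C1/(p2_smooth hrb).
  by move=> z; apply: loclip_continuous; exact: loclip_position.
by move=> z; apply: loclip_continuous; apply: loclip_pair;
  [exact: loclip_velocity|exact: loclip_speed].
Qed.

Lemma open_in_dom : open in_dom.
Proof.
apply: (@open_comp _ _ (fun z : Z => (z.2.1.1.1 + href rf z.1, z.1, momenta z)));
  last exact: dom_open hrb.
by move=> z _; apply: loclip_continuous; apply: loclip_pair;
  [exact: loclip_position|exact: loclip_momenta].
Qed.

(** [climb] is the derivative of the height in time. With [q_N] as parameter the position moves in
    the direction of its velocity divided by [speed], and directional derivatives are
    homogeneous. *)
Lemma height_chain (Y : R -> ycoord R n) (s : R) :
  is_derive s 1 Y (y_field rf g s (Y s)) -> 0 < speed (s, Y s) ->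
  is_derive s 1 (fun t => height (t, Y t)) (climb (s, Y s) / speed (s, Y s)).
Proof.
move=> Yd v0; set v := speed (s, Y s) in v0 *.
have dh : is_derive s 1 (fun t => (Y t).1.1.1 + href rf t)
    (v^-1 *: (Y s).1.1.2 + derive1 (href rf) s).
  apply: is_deriveD.
    by have := is_derive_fst (is_derive_fst (is_derive_fst Yd)); rewrite y_fieldE.
  have [hd _] := smooth_C1 (href_smooth hrf).
  by rewrite derive1E; exact/derivableP/hd.
have dc := is_derive_pair dh (is_derive_id s (1 : R)).
have pC := smooth_C1 (p2_smooth hrb).
apply: (is_derive_comp_loclip (f := p2 rb) _ _ dc); first exact: C1_loclip_pair.
have [pd _] := pC; have := derivableP (pd ((Y s).1.1.1 + href rf s, s)
  (v^-1 *: (Y s).1.1.2 + derive1 (href rf) s, 1)).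
suff -> : 'D_(v^-1 *: (Y s).1.1.2 + derive1 (href rf) s, 1) (p2 rb)
    ((Y s).1.1.1 + href rf s, s) = climb (s, Y s) / v by [].
rewrite climbE/= -/v; apply: (mulIf (lt0r_neq0 v0)); rewrite divfK ?lt0r_neq0//.
rewrite mulrC -derive_pairZ//; congr (derive _ _ _); congr pair => /=.
  by rewrite scalerDr scalerA mulfV ?lt0r_neq0// scale1r.
by rewrite /GRing.scale/= mulr1.
Qed.

End Gains.
End ReturnMap.

(** * Existence and uniqueness of the next impact *)

Section Step.
Context (R : realType) (n : nat) (rb : robot R n) (hrb : robot_hyp rb)
  (rf : references R n) (hrf : references_hyp rb rf) (g0 : gains R n)
  (hZ : impact_invariant rb (Zman rb rf g0)) (qp qm : R)
  (hstep : nominal_step rb rf qp qm).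

Local Notation Z := (R * ycoord R n)%type.

Lemma nice_ycoord : nice (ycoord R n).
Proof.
exact: (nice_prod (nice_prod (nice_prod (nice_mx _ _ _) (nice_mx _ _ _))
  (nice_scalar _)) (nice_scalar _)).
Qed.

Lemma y_of_state_of_y g s y : y_of_state rf g (state_of_y rf g s y) = y.
Proof.
rewrite /y_of_state /hr /hr' /cvar.
have -> : bvar rf (state_of_y rf g s y) = y.1.2.
  by rewrite /bvar /sigma /qN state_of_yE/= bfst_stack blst_stack addrK.
rewrite /qr /qN /qr' /qN' state_of_yE/= !bmid_stack !blst_stack !addrK /speed /rate/=.
case: y => [[[h h'] b] c] /=; congr (_, _, _, _).
by ring.
Qed.

Section Gains.
Variable g : gains R n.

(** Invariance of Z is assumed for [g0], but at [b = 0] the variable [c] does not involve the gains,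
    so the nominal impact is the same for every [g]. *)
Lemma impact_y_nominal : impact_y rb rf g (qm, 0) = (qp, 0).
Proof.
have [sm qmp qpm vs _] := hstep.
rewrite /impact_y -(nominalE _ g) /= qmp; congr (_, _).
have nZ : Zman rb rf g0 (nominal rf qm).
  have := y_of_state_of_y g0 qm 0; rewrite -nominalE /y_of_state => -[n1 n2 n3 n4].
  by split=> //; split=> //; case: sm.
have [[_ h0 h'0] b0 c0] : Zman rb rf g0 (impact rb (nominal rf qm)).
  by apply: hZ.2; exists (nominal rf qm).
rewrite /y_of_state h0 h'0 b0; congr (_, _).
by move: c0; rewrite /cvar b0 !mulr0.
Qed.

Lemma surface_impact z : y_surface rb rf g z ->
  height rb rf (impact_y rb rf g z) = 0 /\ 0 < climb rb rf g (impact_y rb rf g z).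
Proof.
move=> zs; have [x0 xd] := impact_release hrb zs.
have E := state_of_y_of_state rf g (impact rb (state_of_y rf g z.1 z.2)).
split; last by rewrite /climb /= (p2dot_reduced rb E).
have := reduced_state_of_y rf g (impact_y rb rf g z).1 (impact_y rb rf g z).2.
by rewrite E /height /reduced/= => -[<- _]; exact: x0.
Qed.

(** [crossing] is started at the image of the impact, where [impact_release] gives zero height and
    positive climb. The solution and its [eta] bounds are exported for the decay estimates. *)
Lemma return_map (eta : R) : 0 < eta -> exists2 dl, 0 < dl &
  forall z sp yp, y_surface rb rf g z -> `|z.1 - qm| < dl -> `|z.2| < dl ->
  impact_y rb rf g z = (sp, yp) ->
  exists e Y, [/\ [/\ `|sp - qp| < eta, sp < e, `|e - qm| < eta,
      continuous Y & Y sp = yp],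
    forall s, sp < s < e -> is_derive s 1 Y (y_field rf g s (Y s)),
    forall s, sp <= s <= e -> `|Y s| < eta /\ 0 < speed rf g (s, Y s),
    poincare rb rf g z (e, Y e) &
    forall z', poincare rb rf g z z' -> z' = (e, Y e)].
Proof.
move=> eta0; have [sm qmp qpm vs pos] := hstep.
have sp0 s : speed rf g (s, 0) != 0 by rewrite speed0 lt0r_neq0// (Vref_gt0 hrf).
have sp0' s : qp <= s <= qm -> 0 < speed rf g (s, 0).
  by rewrite speed0 (Vref_gt0 hrf).
have D0 s : qp <= s <= qm -> in_dom rb rf g (s, 0).
  by move=> /vs; rewrite (nominalE _ g) => /valid_state_of_y[].
have sq : y_surface rb rf g (qm, 0)
  by rewrite -[y_surface _ _ _ _]/(surface rb (state_of_y rf g qm 0)) -nominalE.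
have [_ c0] := surface_impact sq.
rewrite impact_y_nominal in c0.
have P0 s : qp < s < qm -> 0 < height rb rf (s, 0) by move=> /pos; rewrite /height/= add0r.
have [_ Pm Pdm] : [/\ in_dom rb rf g (qm, 0), height rb rf (qm, 0) = 0 & climb rb rf g (qm, 0) < 0].
  by apply/surface_state_of_y; rewrite -nominalE.
have [dl dl0 H] := @crossing R (ycoord R n) nice_ycoord (y_field rf g)
  (height rb rf) (climb rb rf g) (speed rf g) (in_dom rb rf g) qp qm
  (y_field0 hrf g) (fun s _ => loclip_y_field hrb hrf (z := (s, 0)) (sp0 s))
  (fun z => loclip_continuous (loclip_height hrb hrf z)) (@continuous_climb _ _ _ hrb _ hrf g)
  (fun z => loclip_continuous (loclip_speed hrf g z)) (@open_in_dom _ _ _ hrb _ hrf g)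
  sp0' D0 (@height_chain _ _ _ hrb _ hrf g) qpm c0 P0 Pm Pdm eta eta0.
have m0 : 0 < Num.min dl eta by rewrite lt_min dl0.
have [r r0 rP] := loclip_near (loclip_impact_y hrb hrf g (qm, 0)) m0.
exists r; [exact: r0|move=> z sp yp zs z1 z2 zpE].
have := rP z z1 z2; rewrite impact_y_nominal zpE/= subr0 !lt_min.
move=> [/andP[zd1 ze1] /andP[zd2 _]].
have [h0 cp] := surface_impact zs; rewrite zpE in h0 cp.
have [e [Y [[spe em Yc Ysp] [Yd Yb Yp Pe Ce] _ uniq]]] := H sp yp zd1 zd2 h0.
have spe' : sp <= e := ltW spe.
have spE : qN (impact rb (state_of_y rf g z.1 z.2)) = sp := congr1 fst zpE.
have ypE : y_of_state rf g (impact rb (state_of_y rf g z.1 z.2)) = yp := congr1 snd zpE.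
exists e, Y; split=> //.
- by move=> s /Yb[].
- have Ds s : sp <= s <= e -> in_dom rb rf g (s, Y s) by move=> /Yb[].
  have Ps s : sp <= s <= e -> 0 <= height rb rf (s, Y s).
    move=> /andP[]; rewrite le_eqVlt => /predU1P[<- _|s1].
      by rewrite Ysp h0.
    rewrite le_eqVlt => /predU1P[->|s2]; first by rewrite Pe.
    by apply/ltW/Yp; rewrite s1.
  split; rewrite ?spE ?ypE//.
  + by apply/surface_state_of_y; split=> //; apply: Ds; rewrite spe' lexx.
  + exists Y; split => //.
    * split=> //; first exact: continuous_subspaceT.
      by move=> s /Yb[].
    * by move=> s sb; apply/valid_state_of_y; split; [exact: Ds|exact: Ps].
    * move=> s /andP[]; rewrite le_eqVlt => /predU1P[<- _|s1 s2].
        rewrite Ysp => /surface_state_of_y[_ _].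
        by rewrite ltNge ltW.
      move=> /surface_state_of_y[_ + _].
      by apply/eqP; rewrite gt_eqF// Yp// s1.
- move=> [e' y'] [_ zs' /=]; rewrite spE ypE => spe''; move=> [W [[Wc Wd Wv] Wsp We' _ nS]].
  have /= spe2 := ltW spe''.
  (* A competing solution is only continuous on its own segment; the clamped one is continuous
     everywhere, as [uniq] requires. *)
  pose X := W \o clamp sp e'.
  have XW s : sp <= s <= e' -> X s = W s by move=> sb; rewrite /X/= clampK.
  have [E1 E2] : e' = e /\ X e' = Y e; last first.
    by congr pair => //; rewrite -We' -E2 XW// lexx spe2.
  apply: uniq => //.
  + exact: within_clamp.
  + by rewrite XW ?lexx ?spe2.
  + move=> s sb; rewrite XW; last by case/andP: sb => *; rewrite !ltW.
    by apply: is_derive_clamp => //; exact: Wd.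
  + rewrite XW ?lexx ?spe2// We'.
    by have /surface_state_of_y[] := zs'.
  + move=> s sb; rewrite XW; last by case/andP: sb => ->; exact: ltW.
    by move=> /surface_state_of_y; exact: nS.
Qed.

End Gains.
End Step.

(** * Contraction over one step *)

Section ImpactEstimate.
Context (R : realType) (n : nat) (rb : robot R n) (hrb : robot_hyp rb)
  (rf : references R n) (hrf : references_hyp rb rf) (g0 : gains R n)
  (hW : impact_invariant rb (Wman rb rf)) (hZ : impact_invariant rb (Zman rb rf g0))
  (qp qm : R) (hstep : nominal_step rb rf qp qm).

Local Notation Z := (R * ycoord R n)%type.

Lemma surface_nominal g :
  [/\ in_dom rb rf g (qm, 0), height rb rf (qm, 0) = 0 & climb rb rf g (qm, 0) < 0].
Proof. by apply/surface_state_of_y; rewrite -nominalE; case: hstep. Qed.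

(** Along [y = 0] the height has slope [- m] at [qm], and among the components of [y] it depends on
    [h] only. So [m / 2 * |q - qm|] is at most the change of height that [h] produces. *)
Lemma transversality : exists C dl, [/\ 0 <= C, 0 < dl & forall z : Z,
  height rb rf z = 0 -> `|z.1 - qm| < dl -> `|z.2| < dl ->
  `|z.1 - qm| <= C * `|z.2.1.1.1| ].
Proof.
have [_ Pm Pdm] := surface_nominal g0.
have v0 : 0 < speed rf g0 (qm, 0) by rewrite speed0 (Vref_gt0 hrf).
pose m := - (climb rb rf g0 (qm, 0) / speed rf g0 (qm, 0)).
have m0 : 0 < m by rewrite /m -mulNr divr_gt0// oppr_gt0.
have fd : is_derive qm 1 (fun t => height rb rf (t, 0 : ycoord R n)) (- m).
  rewrite /m opprK; apply: (height_chain hrb hrf (Y := cst 0) (s := qm) (g := g0)) => //.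
  by rewrite (y_field0 hrf); exact: is_derive_cst.
have [C [e [C0 e0 CP]]] := loclip_height hrb hrf (qm, 0).
move: fd => /is_deriveP/cvgrPdist_le/(_ (m / 2)); rewrite divr_gt0// => /(_ isT).
move=> /nbhs_normP[d /= d0 dP].
exists (C / (m / 2)), (Num.min e d); split.
- by rewrite divr_ge0// ltW// divr_gt0.
- by rewrite lt_min e0.
move=> [q y] /= Pz; rewrite !lt_min => /andP[qe qd] /andP[ye yd].
have [->|qqm] := eqVneq q qm.
  by rewrite subrr normr0 mulr_ge0// divr_ge0// ltW// divr_gt0.
have h0 : q - qm != 0 by rewrite subr_eq0.
have := dP (q - qm); rewrite /= sub0r normrN => /(_ qd h0).
rewrite [_ *: (1 : R)]mulr1 subrK Pm subr0 => D.
have A : m / 2 * `|q - qm| <= `|height rb rf (q, 0 : ycoord R n)|.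
  have : m - m / 2 <= `|(q - qm)^-1 * height rb rf (q, 0 : ycoord R n)|.
    have := ler_distD ((q - qm)^-1 *: height rb rf (q, 0 : ycoord R n)) (- m) 0.
    rewrite !subr0 normrN (gtr0_norm m0) => D1.
    by rewrite lerBlDl; apply: (le_trans D1); rewrite lerD2r.
  rewrite normrM normfV ler_pdivlMl ?normr_gt0// mulrC.
  by have -> : m - m / 2 = m / 2 by lra.
rewrite mulrAC ler_pdivlMr ?divr_gt0// mulrC; apply: (le_trans A).
have hE : height rb rf (q, (y.1.1.1, 0, 0, 0) : ycoord R n) = 0 by rewrite -Pz.
have y1 : `|y.1.1.1| <= `|y|.
  have [/prod_norm_leP[/prod_norm_leP[? _] _] _] := (prod_norm_leP y _).1 (lexx _).
  done.
have := CP (q, 0) (q, (y.1.1.1, 0, 0, 0)); rewrite hE subr0; move=> H.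
apply: (le_trans (H _ _)).
- by rewrite prod_normE/= gt_max qe subr0 normr0.
- rewrite !prod_normE/= !subr0 !gt_max !normr0 qe e0 /=.
  by rewrite !andbT (le_lt_trans y1).
- rewrite ler_wpM2l// !prod_normE/= subrr !sub0r !oppr0 !normr0 normrN.
  by rewrite !ge_max !lexx normr_ge0.
Qed.

Definition ratio (g : gains R n) := gamma g / beta0 g.

Lemma state_of_y_ratio g g' : ratio g = ratio g' -> state_of_y rf g = state_of_y rf g'.
Proof.
by move=> E; apply/funext => s; apply/funext => -[[[h h'] b] c];
  rewrite /state_of_y /rate -!/(ratio _) E.
Qed.

Lemma impact_y_ratio g g' : ratio g = ratio g' -> impact_y rb rf g = impact_y rb rf g'.
Proof.
move=> E; apply/funext => z; rewrite /impact_y (state_of_y_ratio E).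
by rewrite /y_of_state /cvar -!/(ratio _) E.
Qed.

(* On [Wman] the momenta just before the impact depend on [qN'] through this
   direction only; its image under the impact is the source of the term
   [A gamma / beta0 * S'(qm)] in the amplification of [b]. *)
Definition impact_dir : 'cV[R]_(1 + n + 1) :=
  impact_w rb (href rf qm, qm) *m stack 0 (derive1 (href rf) qm) 1.

Lemma impact_state_of_y g (y : ycoord R n) : y.1.1.1 = 0 ->
  impact rb (state_of_y rf g qm y) = (impact_q rb *m stack 0 (href rf qm) qm,
    impact_w rb (href rf qm, qm) *m momenta rf g (qm, y)).
Proof.
move=> y0; have E := reduced_state_of_y rf g qm y.
have q1 : qr (state_of_y rf g qm y) = _ := congr1 (fun t => t.1.1) E.
have q2 : qN (state_of_y rf g qm y) = _ := congr1 (fun t => t.1.2) E.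
by rewrite /impact q1 q2 state_of_yE/= y0 add0r.
Qed.

(** [u] is the excess of [qN'] over [V]. Before the impact the momenta are the nominal ones, plus
    [b] times the first basis vector, which [impact_w] fixes, plus [u] times the vector sent to
    [impact_dir]. Invariance of W keeps [(h, h')] at 0. *)
Lemma impact_y_W g : exists2 dl, 0 < dl & forall b c u bp, `|b| < dl -> `|c| < dl ->
  u = c + ratio g * derive1 (Sref rf) qm * b -> bp = b + u * bfst impact_dir ->
  impact_y rb rf g (qm, (0, 0, b, c)) =
    (qp, (0, 0, bp, u * blst impact_dir - ratio g * derive1 (Sref rf) qp * bp)).
Proof.
have [Dm Pm Pdm] := surface_nominal g.
have /nbhs_normP[d1 /= d10 d1P] : nbhs (qm, 0 : ycoord R n) (in_dom rb rf g).
  by apply: open_nbhs_nbhs; split=> //; exact: open_in_dom.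
have Ndm : 0 < - climb rb rf g (qm, 0) by rewrite oppr_gt0.
have [d2 d20 d2P] : exists2 e, 0 < e & forall t (y : ycoord R n), `|t - qm| < e -> `|y| < e ->
    0 < - climb rb rf g (t, y).
  apply: (near0_of_continuous (f := fun z => - climb rb rf g z)) => //.
  by move=> z; apply: cvgN; exact: continuous_climb.
exists (Num.min d1 d2); first by rewrite lt_min d10.
move=> b c u bp; rewrite !lt_min => /andP[b1 b2] /andP[c1 c2] uE' bpE.
pose z0 : Z := (qm, (0, 0, b, c)).
have small d : 0 < d -> `|b| < d -> `|c| < d -> `|(0, 0, b, c) : ycoord R n| < d.
  by move=> d0 bd cd; rewrite !prod_normE/= !normr0 !gt_max d0 bd.
have s0 : surface rb (state_of_y rf g qm (0, 0, b, c)).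
  apply/surface_state_of_y; split.
  - apply: d1P; rewrite /= prod_normE/= subrr normr0 sub0r normrN gt_max d10.
    exact: small.
  - by rewrite -[RHS]Pm.
  - by rewrite -oppr_gt0; apply: d2P; [rewrite subrr normr0|exact: small].
set x := impact rb (state_of_y rf g qm (0, 0, b, c)).
have [_ hx h'x] : Wman rb rf x.
  apply: hW.2; exists (state_of_y rf g qm (0, 0, b, c)) => //; split=> //.
  have := y_of_state_of_y rf g qm (0, 0, b, c); rewrite /y_of_state => -[n1 n2 _ _].
  by split=> //; case: s0.
have E0 := impact_y_nominal hZ hstep g.
have xE : x = (impact_q rb *m stack 0 (href rf qm) qm,
    impact_w rb (href rf qm, qm) *m momenta rf g (qm, (0, 0, b, c))).
  exact: impact_state_of_y.
have x0E : impact rb (state_of_y rf g qm 0) = (impact_q rb *m stack 0 (href rf qm) qm,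
    impact_w rb (href rf qm, qm) *m momenta rf g (qm, 0)).
  exact: impact_state_of_y.
have uE : speed rf g (qm, (0, 0, b, c)) = Vref rf qm + u.
  by rewrite /speed /rate/= uE' /ratio; ring.
have mE : momenta rf g (qm, (0, 0, b, c)) = momenta rf g (qm, 0)
    + (b *: delta_mx ifst 0 + u *: stack 0 (derive1 (href rf) qm) 1).
  rewrite /momenta uE speed0/= -stack_delta !stackZ !stackD.
  congr (stack _ _ _); [by ring| |by ring].
  by rewrite !add0r scaler0 add0r scalerDl.
have wE i : x.2 i 0 = (impact rb (state_of_y rf g qm 0)).2 i 0
    + (b * (i == ifst)%:R + u * impact_dir i 0).
  rewrite xE x0E/= mE !mulmxDr -!scalemxAr -colE !mxE.
  by rewrite (impact_w_col hrb).
move: E0; rewrite /impact_y/= => -[q0 _ _ b0 c0].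
have qx : qN x = qp by rewrite -q0 /qN xE x0E.
rewrite /impact_y/= -/x qx; congr (_, _).
rewrite /y_of_state hx h'x.
have bx : bvar rf x = bp.
  rewrite /bvar /sigma /bfst wE eqxx mulr1 qx.
  move: b0; rewrite bpE /bvar /sigma /bfst q0 => /eqP; rewrite subr_eq0 => /eqP ->.
  by rewrite addrAC subrr add0r.
congr (_, _, _, _) => //.
rewrite /cvar bx qx -/(ratio g) /qN' /blst wE.
have -> : (ilst == ifst :> 'I_(1 + n + 1)) = false by [].
move: c0; rewrite /cvar b0 q0 mulr0 subr0 => /eqP; rewrite subr_eq0 /qN' /blst => /eqP ->.
by rewrite mulr0 add0r [Vref rf qp + _]addrC addrK.
Qed.

Lemma impact_estimate g : exists C dl, [/\ 0 <= C, 0 < dl &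
  forall z sp yp u bp, y_surface rb rf g z -> `|z.1 - qm| < dl -> `|z.2| < dl ->
  impact_y rb rf g z = (sp, yp) ->
  u = z.2.2 + ratio g * derive1 (Sref rf) qm * z.2.1.2 ->
  bp = z.2.1.2 + u * bfst impact_dir ->
  [/\ `|yp.1.1| <= C * `|z.2.1.1|, `|yp.1.2 - bp| <= C * `|z.2.1.1| &
      `|yp.2 - (u * blst impact_dir - ratio g * derive1 (Sref rf) qp * bp)|
        <= C * `|z.2.1.1| ] ].
Proof.
have [C1 [d1 [C10 d10 H1]]] := transversality.
have [C2 [d2 [C20 d20 H2]]] := loclip_impact_y hrb hrf g (qm, 0).
have [d3 d30 H3] := impact_y_W g.
exists (C2 * (C1 + 1)), (Num.min (Num.min d1 d2) d3); split.
- by rewrite mulr_ge0// addr_ge0.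
- by rewrite !lt_min d10 d20.
move=> [q y] sp yp u bp zs /=; rewrite !lt_min => /andP[/andP[q1 q2] q3].
move=> /andP[/andP[y1 y2] y3] zE uE bpE.
have [yb yc] := (prod_norm_leP y _).1 (lexx _).
have [yh yb'] := (prod_norm_leP y.1 _).1 yb.
have [yh1 yh2] := (prod_norm_leP y.1.1 _).1 (lexx _).
have Pz : height rb rf (q, y) = 0 by have /surface_state_of_y[] := zs.
have qC := H1 (q, y) Pz q1 y1.
have W0 := H3 _ _ _ _ (le_lt_trans yb' y3) (le_lt_trans yc y3) uE bpE.
(* The displacement to the projection on [Wman]: the term [C1] pays for [q_N], the term 1 for
   [(h, h')]. *)
have zz : `|(q, y) - (qm, (0, 0, y.1.2, y.2)) : Z| <= (C1 + 1) * `|y.1.1|.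
  apply/prod_norm_leP; split => /=.
    apply: (le_trans qC); rewrite mulrDl mul1r.
    have : C1 * `|y.1.1.1| <= C1 * `|y.1.1| by rewrite ler_wpM2l.
    by move=> /le_trans; apply; rewrite lerDl.
  apply/prod_norm_leP; split => /=; last by rewrite subrr normr0 mulr_ge0// addr_ge0.
  apply/prod_norm_leP; split => /=; last by rewrite subrr normr0 mulr_ge0// addr_ge0.
  have -> : y.1.1 - (0, 0) = y.1.1.
    by apply: injective_projections; rewrite /= subr0.
  by rewrite mulrDl mul1r lerDr mulr_ge0.
have D : `|(sp, yp) - impact_y rb rf g (qm, (0, 0, y.1.2, y.2))| <= C2 * (C1 + 1) * `|y.1.1|.
  rewrite -zE -mulrA; apply: le_trans (ler_wpM2l C20 zz); apply: H2.
    by rewrite prod_normE/= subr0 gt_max q2.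
  rewrite prod_normE/= subrr normr0 gt_max d20 subr0 !prod_normE/= !normr0 !gt_max d20/=.
  by rewrite (le_lt_trans yb' y2) (le_lt_trans yc y2).
move: D; rewrite W0 => /prod_norm_leP[_ /= /prod_norm_leP[/= /prod_norm_leP[/= D1 D2] D3]].
split=> //; move: D1; congr (`|_| <= _).
by apply: injective_projections; rewrite /= subr0.
Qed.

End ImpactEstimate.

(** * Decay of (h, h'), b and c along the continuous phase *)

Section FlowEstimate.
Context (R : realType) (n : nat) (rf : references R n).

Lemma pure_decay (u c : R -> R) (a b al : R) : a <= b -> 0 <= al -> continuous u ->
  (forall t, a < t < b -> is_derive t 1 u (- (c t * u t))) ->
  (forall t, a < t < b -> al <= c t) ->
  `|u b| <= `|u a| * expR (- al * (b - a)).
Proof.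
move=> ab al0 uc ud ac.
have ud' t : a < t < b -> is_derive t 1 u (- (c t * u t) + cst 0 t).
  by move=> tab; rewrite /cst addr0; exact: ud.
have := decay_bound (H := 0) (K := 0) (k := 0) ab al0 (lexx _) (lexx _) (lexx _) uc ud' ac.
rewrite !mul0r !addr0; apply=> t _.
by rewrite normr0 mul0r.
Qed.

Lemma y_field_proj g s y : y_field rf g s y =
  let dS := derive1 (Sref rf) s in
  let xi := (speed rf g (s, y))^-1 in
  (xi *: y.1.1.2, xi *: (- (KP g *m y.1.1.1) - KV g *m y.1.1.2),
   xi * (inner y.1.1.1 (f2 rf y.1.1.1 s) - dS * y.2
         - gamma g / beta0 g * dS ^+ 2 * y.1.2),
   xi * (- beta0 g * y.2)).
Proof. by case: y => [[[h h'] b] c]. Qed.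

Lemma inner_le (u v : 'cV[R]_n) : `|inner u v| <= n%:R * (`|u| * `|v|).
Proof.
rewrite /inner mxE; apply: (le_trans (ler_norm_sum _ _ _)).
rewrite -[n in n%:R]card_ord -sumr_const mulr_suml; apply: ler_sum => i _.
rewrite mul1r normrM mxE; apply: ler_pM => //; exact: (mx_norm_leP _ (normr_ge0 _)).1.
Qed.

(** Scalar matrices let each joint evolve alone, with the distinct real eigenvalues [- k] and
    [- 2 k] in time; taking [q_N] as parameter only divides them by the speed. [gamma] is set so
    that [ratio] is [eps]. *)
Definition decoupled_gains (eps be k : R) : gains R n :=
  Gains (2 * k ^+ 2)%:M (3 * k)%:M be (eps * be).

Lemma posdef_scalar (c : R) : 0 < c -> posdef (c%:M : 'M[R]_n).
Proof.
move=> c0; split=> [|v v0]; first exact: tr_scalar_mx.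
rewrite mul_mx_scalar -scalemxAl mxE mulr_gt0// mxE.
have sq i : 0 <= v^T 0 i * v i 0 by rewrite mxE -expr2 sqr_ge0.
rewrite lt_def sumr_ge0// andbT psumr_eq0//; apply: contra v0 => /allP v0.
apply/eqP/matrixP => i j; rewrite ord1 [RHS]mxE.
by have := v0 i (mem_index_enum _); rewrite mxE/= mulf_eq0 orbb => /eqP.
Qed.

Lemma decoupled_admissible eps be k : 0 < eps -> 0 < be -> 0 < k ->
  admissible (decoupled_gains eps be k).
Proof.
move=> e0 b0 k0; split => //=; [apply: posdef_scalar|apply: posdef_scalar|];
  by rewrite ?mulr_gt0// exprn_gt0.
Qed.

Lemma ratio_decoupled eps be k : be != 0 -> ratio (decoupled_gains eps be k) = eps.
Proof. by move=> b0; rewrite /ratio/= mulfK. Qed.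

Variables (qp qm v0 v1 S1 M0 m s1 s2 : R).
Hypotheses (v00 : 0 < v0)
  (Vb : forall s, qp - 1 <= s <= qm + 1 -> v0 <= Vref rf s <= v1)
  (Sb : forall s, qp - 1 <= s <= qm + 1 -> `|derive1 (Sref rf) s| <= S1)
  (M00 : 0 <= M0) (f2b : forall h s, `|f2 rf h s| <= M0)
  (m0 : 0 <= m) (mb : forall s, s1 <= s <= s2 -> m <= derive1 (Sref rf) s ^+ 2)
  (s1p : qp < s1) (s12 : s1 < s2) (s2m : s2 < qm).
Variables (eps be k eta : R).
(** [eta4] leaves at least half the nominal length, [etas1] and [etas2] keep [[s1, s2]] inside
    [[sp, e]], and [etav] keeps the speed between [v0 / 2] and [2 * v1]. *)
Hypotheses (eps0 : 0 < eps) (be0 : 0 < be) (k1 : 1 <= k) (eta0 : 0 < eta) (eta1 : eta <= 1)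
  (eta4 : eta <= (qm - qp) / 4) (etas1 : eta <= s1 - qp) (etas2 : eta <= qm - s2)
  (etav : eta * (1 + eps * S1) <= v0 / 2).
Let g := decoupled_gains eps be k.
Variables (Y : R -> ycoord R n) (sp e : R).
Hypotheses (spq : `|sp - qp| < eta) (spe : sp < e) (eqm : `|e - qm| < eta)
  (Yc : continuous Y)
  (Yd : forall s, sp < s < e -> is_derive s 1 Y (y_field rf g s (Y s)))
  (Yb : forall s, sp <= s <= e -> `|Y s| < eta).

Let x0 := (2 * v1)^-1.
Let x1 := 2 / v0.
Let l := (qm - qp) / 2.
Let Hp := `|(Y sp).1.1|.

Lemma slope_bounds s : sp <= s <= e ->
  [/\ x0 <= (speed rf g (s, Y s))^-1, (speed rf g (s, Y s))^-1 <= x1 &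
      `|derive1 (Sref rf) s| <= S1].
Proof.
move=> se; have := se => /andP[sps ses].
move: spq eqm; rewrite !ltr_norml => /andP[a1 _] /andP[_ a2].
have sq : qp - 1 <= s <= qm + 1 by have := eta1; lra.
have /andP[Vl Vu] := Vb sq; have SS := Sb sq.
have [y1 yc] := (prod_norm_leP (Y s) _).1 (lexx _).
have [_ yb] := (prod_norm_leP (Y s).1 _).1 y1.
have ye := Yb se.
have d : `|(Y s).2 + eps * derive1 (Sref rf) s * (Y s).1.2| <= v0 / 2.
  apply: le_trans etav; rewrite mulrDr mulr1; apply: (le_trans (ler_normD _ _)).
  apply: lerD; first by rewrite (le_trans yc)// ltW.
  rewrite !normrM (gtr0_norm eps0) [leRHS]mulrC; apply: ler_pM => //.
  - by rewrite mulr_ge0// ltW.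
  - by rewrite ler_wpM2l// ltW.
  - by rewrite (le_trans yb)// ltW.
have E : speed rf g (s, Y s) = Vref rf s + ((Y s).2 + eps * derive1 (Sref rf) s * (Y s).1.2).
  by rewrite /speed /rate -/(ratio g) ratio_decoupled ?lt0r_neq0//=; ring.
move: d; rewrite ler_norml => /andP[d1 d2].
have v00' := v00; have sl : v0 / 2 <= speed rf g (s, Y s) by rewrite E; lra.
have su : speed rf g (s, Y s) <= 2 * v1 by rewrite E; lra.
have h0 : 0 < v0 / 2 by rewrite divr_gt0.
have sp0 : 0 < speed rf g (s, Y s) by exact: lt_le_trans sl.
split=> //; first by rewrite /x0 lef_pV2 ?posrE// (lt_le_trans sp0).
by rewrite /x1 -[leRHS]invrK invf_div lef_pV2 ?posrE ?invr_gt0.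
Qed.

Lemma x0_gt0 : 0 < x0.
Proof.
have /Vb/andP[a b] : qp - 1 <= qp <= qm + 1.
  by have := s1p; have := s12; have := s2m; lra.
by rewrite invr_gt0 mulr_gt0// (lt_le_trans v00)// (le_trans a).
Qed.

Lemma length_ge : l <= e - sp.
Proof. by move: spq eqm; rewrite /l !ltr_norml => /andP[_ a1] /andP[a2 _]; have := eta4; lra. Qed.

Lemma decay_c s : sp <= s <= e ->
  `|(Y s).2| <= `|(Y sp).2| * expR (- (be * x0) * (s - sp)).
Proof.
move=> /andP[s0 se].
apply: (pure_decay (u := fun s => (Y s).2) (c := fun s => be * (speed rf g (s, Y s))^-1) s0).
- by rewrite mulr_ge0 ?ltW// x0_gt0.
- by move=> t; apply: (@continuous_comp_at _ _ _ Y snd); [exact: Yc|exact: cvg_snd].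
- move=> t /andP[t1 t2]; have te : sp < t < e by rewrite t1 (lt_le_trans t2).
  have := is_derive_snd (Yd te); rewrite y_field_proj/=.
  by congr is_derive; ring.
- move=> t /andP[/ltW t1 t2]; rewrite ler_pM2l//.
  by have [|] := @slope_bounds t; first by rewrite t1 (le_trans (ltW t2)).
Qed.

Lemma derive_h s i : sp < s < e ->
  is_derive s 1 (fun t => (Y t).1.1.1 i 0) ((speed rf g (s, Y s))^-1 * (Y s).1.1.2 i 0).
Proof.
move=> se; have := is_derive_fst (is_derive_fst (is_derive_fst (Yd se))).
by rewrite y_field_proj/= => /is_derive_mx/(_ i 0); rewrite mxE.
Qed.

Lemma derive_h' s i : sp < s < e ->
  is_derive s 1 (fun t => (Y t).1.1.2 i 0)
    ((speed rf g (s, Y s))^-1 * (- (2 * k ^+ 2 * (Y s).1.1.1 i 0) - 3 * k * (Y s).1.1.2 i 0)).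
Proof.
move=> se; have := is_derive_snd (is_derive_fst (is_derive_fst (Yd se))).
by rewrite y_field_proj/= !mul_scalar_mx => /is_derive_mx/(_ i 0); rewrite !mxE.
Qed.

Lemma continuous_h i : continuous (fun t => (Y t).1.1.1 i 0).
Proof.
move=> t; apply: (@continuous_comp_at _ _ _ Y (fun y => y.1.1.1 i 0)); first exact: Yc.
apply: loclip_continuous; apply: (loclip_mxP (fun y : ycoord R n => y.1.1.1) _).2.
by do 3 apply: loclip_fst; exact: loclip_id.
Qed.

Lemma continuous_h' i : continuous (fun t => (Y t).1.1.2 i 0).
Proof.
move=> t; apply: (@continuous_comp_at _ _ _ Y (fun y => y.1.1.2 i 0)); first exact: Yc.
apply: loclip_continuous; apply: (loclip_mxP (fun y : ycoord R n => y.1.1.2) _).2.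
by apply: loclip_snd; do 2 apply: loclip_fst; exact: loclip_id.
Qed.

(* [h' + j k h] for [j = 1, 2] are the eigenvectors of the linear system
   [h'' = - 2 k^2 h - 3 k h']. *)
Lemma decay_eigen (j : R) s i : (j - 1) * (j - 2) = 0 -> j <= 2 -> sp <= s <= e ->
  `|(Y s).1.1.2 i 0 + j * k * (Y s).1.1.1 i 0| <=
  `|(Y sp).1.1.2 i 0 + j * k * (Y sp).1.1.1 i 0| * expR (- (k * x0) * (s - sp)).
Proof.
move=> j12 j2 /andP[s0 se]; have k0 : 0 < k by exact: lt_le_trans k1.
apply: (pure_decay (u := fun t => (Y t).1.1.2 i 0 + j * k * (Y t).1.1.1 i 0)
  (c := fun t => (3 - j) * k * (speed rf g (t, Y t))^-1) s0).
- by rewrite mulr_ge0 ?ltW// x0_gt0.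
- move=> t; apply: cvgD; first exact: continuous_h'.
  by apply: cvgMr; exact: continuous_h.
- move=> t /andP[t1 t2]; have te : sp < t < e by rewrite t1 (lt_le_trans t2).
  have := is_deriveD (derive_h' i te) (is_deriveZ (j * k) (derive_h i te)).
  congr is_derive; rewrite /GRing.scale/=.
  set xi := _^-1; set h := (Y t).1.1.1 i 0; set h' := (Y t).1.1.2 i 0.
  rewrite -[LHS]addr0 -[X in _ + X = _](mul0r (k ^+ 2 * xi * h)) -j12; ring.
- move=> t /andP[/ltW t1 t2].
  have [|xi _ _] := @slope_bounds t; first by rewrite t1 (le_trans (ltW t2)).
  rewrite [_ * k]mulrC -mulrA ler_pM2l//; apply: (le_trans xi).
  by rewrite ler_peMl ?(le_trans (ltW x0_gt0))//; lra.
Qed.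

(** With [w_j = h' + j k h], one has [k h = w_2 - w_1] and [h' = 2 w_1 - w_2], while [w_j] starts
    below [(1 + j k) Hp]. For [k >= 1] this gives the constants 5 and [7 * k]; the bound on [h]
    alone does not grow with [k]. *)
Lemma decay_h s : sp <= s <= e ->
  `|(Y s).1.1| <= 7 * k * expR (- (k * x0) * (s - sp)) * Hp /\
  `|(Y s).1.1.1| <= 5 * Hp.
Proof.
move=> se; have k0 : 0 < k by exact: lt_le_trans k1.
have k1' := k1.
set E := expR _; have E0 : 0 <= E by exact: expR_ge0.
have E1 : E <= 1.
  rewrite -expR0 ler_expR mulNr oppr_le0 mulr_ge0//.
    by rewrite mulr_ge0 ?ltW// x0_gt0.
  by rewrite subr_ge0; case/andP: se.
have Hp0 : 0 <= Hp by exact: normr_ge0.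
have [p1 p2] := (prod_norm_leP (Y sp).1.1 _).1 (lexx Hp).
have comp i : `|(Y s).1.1.1 i 0| <= 5 * (E * Hp) /\ `|(Y s).1.1.2 i 0| <= 7 * k * (E * Hp).
  have h0 : `|(Y sp).1.1.1 i 0| <= Hp := (mx_norm_leP _ Hp0).1 p1 i 0.
  have h'0 : `|(Y sp).1.1.2 i 0| <= Hp := (mx_norm_leP _ Hp0).1 p2 i 0.
  have init (j : R) : 0 <= j ->
      `|(Y sp).1.1.2 i 0 + j * k * (Y sp).1.1.1 i 0| <= (1 + j * k) * Hp.
    move=> j0; rewrite mulrDl mul1r; apply: (le_trans (ler_normD _ _)); apply: lerD => //.
    by rewrite normrM ger0_norm ?mulr_ge0 ?(ltW k0)// ler_wpM2l// mulr_ge0// ltW.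
  have D (j : R) : (j - 1) * (j - 2) = 0 -> 0 <= j <= 2 ->
      `|(Y s).1.1.2 i 0 + j * k * (Y s).1.1.1 i 0| <= (1 + j * k) * (E * Hp).
    move=> j12 /andP[j0 j2]; apply: (le_trans (decay_eigen i j12 j2 se)).
    by rewrite mulrCA mulrC; apply: ler_wpM2l => //; exact: init.
  have := D 1 _ _; rewrite subrr mul0r => /(_ erefl); rewrite ler01 ler1n => /(_ isT).
  have := D 2 _ _; rewrite subrr mulr0 => /(_ erefl); rewrite ler0n lexx => /(_ isT).
  set h := (Y s).1.1.1 i 0; set h' := (Y s).1.1.2 i 0.
  have EH : 0 <= E * Hp by rewrite mulr_ge0.
  have kEH : E * Hp <= k * (E * Hp) by rewrite ler_peMl.
  rewrite !ler_norml => /andP[a1 a2] /andP[a3 a4].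
  split; last by apply/andP; split; lra.
  have a5 : k * h <= k * (5 * (E * Hp)) by lra.
  have a6 : k * (- (5 * (E * Hp))) <= k * h by lra.
  by apply/andP; split; [rewrite -(ler_pM2l k0)|rewrite -(ler_pM2l k0)].
have EHp : E * Hp <= Hp by rewrite ler_piMl.
have EH0 : 0 <= E * Hp by rewrite mulr_ge0.
have kEH : E * Hp <= k * (E * Hp) by rewrite ler_peMl.
split.
  rewrite -mulrA; apply/prod_norm_leP; split; apply/mx_norm_leP.
  - by rewrite !mulr_ge0// ltW.
  - by move=> i j; rewrite ord1; have [/le_trans + _] := comp i; apply; lra.
  - by rewrite !mulr_ge0// ltW.
  - by move=> i j; rewrite ord1; have [] := comp i.
apply/mx_norm_leP; first by rewrite mulr_ge0.
by move=> i j; rewrite ord1; have [/le_trans + _] := comp i; apply; lra.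
Qed.

(** [G] bounds the forcing of [b] by [h] per unit of [q_N]. [K] bounds the whole forcing of [b] by
    [c]: it is the integral of an exponential of rate [be * x0], hence of order [1 / be]. *)
Let G := x1 * (n%:R * (5 * Hp * M0)).
Let K := x1 * S1 * `|(Y sp).2| / (be * x0).

Lemma G_ge0 : 0 <= G.
Proof.
apply: mulr_ge0; first by rewrite divr_ge0// ltW.
by apply: mulr_ge0 => //; apply: mulr_ge0 => //; apply: mulr_ge0 => //; exact: normr_ge0.
Qed.

Lemma K_ge0 : 0 <= K.
Proof.
apply: divr_ge0; last by apply: mulr_ge0; apply: ltW => //; exact: x0_gt0.
apply: mulr_ge0; last exact: normr_ge0.
apply: mulr_ge0; first by rewrite divr_ge0// ltW.
have [|_ _] := @slope_bounds sp; first by rewrite lexx ltW.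
exact: le_trans.
Qed.

(** The damping rate of [b] is [eps * S' ^ 2] divided by the speed and may vanish; [al] is any lower
    bound valid on the phase at hand. *)
Lemma decay_b_phase a b al : sp <= a -> a <= b -> b <= e -> 0 <= al ->
  (forall t, a < t < b -> al <= x0 * eps * derive1 (Sref rf) t ^+ 2) ->
  `|(Y b).1.2| <= `|(Y a).1.2| * expR (- al * (b - a)) + G * (b - a) + K.
Proof.
move=> spa ab b_e al0 alP.
have bx0 : 0 < be * x0 by rewrite mulr_gt0// x0_gt0.
have x10 : 0 <= x1 by rewrite divr_ge0// ltW.
have se t : a < t < b -> sp <= t <= e.
  by move=> /andP[t1 t2]; rewrite (le_trans spa (ltW t1)) (le_trans (ltW t2)).
have se' t : a < t < b -> sp < t < e.
  by move=> /andP[t1 t2]; rewrite (le_lt_trans spa t1) (lt_le_trans t2).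
apply: (@decay_bound _ (fun t => (Y t).1.2)
  (fun t => (speed rf g (t, Y t))^-1 * (eps * derive1 (Sref rf) t ^+ 2))
  (fun t => (speed rf g (t, Y t))^-1 * (inner (Y t).1.1.1 (f2 rf (Y t).1.1.1 t)
    - derive1 (Sref rf) t * (Y t).2)) a b al G K (be * x0)) => //.
- exact: G_ge0.
- exact: K_ge0.
- exact: ltW.
- move=> t; apply: (@continuous_comp_at _ _ _ Y (fun y => y.1.2)); first exact: Yc.
  by apply: loclip_continuous; apply: loclip_snd; apply: loclip_fst; exact: loclip_id.
- move=> t tab; have := is_derive_snd (is_derive_fst (Yd (se' t tab))).
  rewrite y_field_proj/= -/(ratio g) ratio_decoupled ?lt0r_neq0//.
  by congr is_derive; ring.
- move=> t tab; apply: (le_trans (alP t tab)); rewrite -mulrA.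
  have [xi _ _] := slope_bounds (se t tab).
  by apply: ler_wpM2r => //; rewrite mulr_ge0 ?sqr_ge0// ltW.
- move=> t tab; have [xi0 xi1 St] := slope_bounds (se t tab).
  have xi00 : 0 <= (speed rf g (t, Y t))^-1 by rewrite (le_trans (ltW x0_gt0)).
  have [_ h5] := decay_h (se t tab); have ct := decay_c (se t tab).
  rewrite normrM (ger0_norm xi00).
  have -> : K * (be * x0 * expR (- (be * x0) * (t - a))) =
      x1 * (S1 * (`|(Y sp).2| * expR (- (be * x0) * (t - a)))).
    by rewrite /K; field; rewrite !lt0r_neq0// x0_gt0.
  rewrite /G -mulrDr; apply: ler_pM => //.
  apply: (le_trans (ler_normB _ _)); apply: lerD.
    apply: (le_trans (inner_le _ _)); rewrite ler_wpM2l//; apply: ler_pM => //.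
  rewrite normrM; apply: ler_pM => //; apply: (le_trans ct).
  (* Decay of [c] counted from [sp] is at least as strong as decay counted from [a]. *)
  rewrite ler_wpM2l// ler_expR !mulNr lerN2 ler_pM2l// lerD2l lerN2.
  exact: spa.
Qed.

(** Three phases cut at [s1] and [s2]: the rate [x0 * eps * m] is used between them and the rate 0
    outside. Each phase adds at most [G] times its length plus [K], and lengths are below
    [qm - qp + 2] because [eta <= 1]. *)
Lemma decay_b : `|(Y e).1.2| <= expR (- (x0 * eps * m) * (s2 - s1)) * `|(Y sp).1.2|
  + 3 * (G * (qm - qp + 2) + K).
Proof.
have e1' := eta1; have es1 := etas1; have es2 := etas2; have ss := s12.
have s1p' := s1p; have s2m' := s2m.
have := spq; have := eqm; rewrite !ltr_norml => /andP[a1 a2] /andP[a3 a4].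
have x0' := x0_gt0.
have pos t : 0 <= x0 * eps * derive1 (Sref rf) t ^+ 2.
  by rewrite mulr_ge0 ?sqr_ge0// mulr_ge0 ?ltW.
have p1 := @decay_b_phase sp s1 0 (lexx _) _ _ (lexx _) (fun t _ => pos t).
have p2 := @decay_b_phase s1 s2 (x0 * eps * m) _ (ltW ss) _ _ _.
have p3 := @decay_b_phase s2 e 0 _ _ (lexx _) (lexx _) (fun t _ => pos t).
have sps1 : sp <= s1 by lra.
have s2e : s2 <= e by lra.
move: p1 p2 p3; rewrite !oppr0 !mul0r expR0 !mulr1.
have xem : 0 <= x0 * eps * m.
  by apply: mulr_ge0 => //; apply: mulr_ge0; exact: ltW.
set E := expR _.
have E0 : 0 <= E by exact: expR_ge0.
have E1 : E <= 1.
  by rewrite -expR0 ler_expR mulNr oppr_le0 mulr_ge0// subr_ge0 ltW.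
move=> /(_ sps1 (ltac:(lra))) p1 p2 /(_ (ltac:(lra)) s2e) p3.
have {}p2 : `|(Y s2).1.2| <= `|(Y s1).1.2| * E + G * (s2 - s1) + K.
  apply: p2 => // t /andP[/ltW t1 /ltW t2]; rewrite ler_wpM2l ?mb ?t1//.
  by rewrite mulr_ge0 ?ltW.
have G0 := G_ge0.
have K0 := K_ge0.
have q1 : `|(Y s1).1.2| * E <= `|(Y sp).1.2| * E + G * (s1 - sp) + K.
  apply: (le_trans (ler_wpM2r E0 p1)); rewrite !mulrDl -!addrA lerD2l.
  have g1 : G * (s1 - sp) * E <= G * (s1 - sp).
    by rewrite ler_piMr// mulr_ge0// subr_ge0.
  have : K * E <= K by rewrite ler_piMr.
  lra.
have gT : G * (e - sp) <= G * (qm - qp + 2) by rewrite ler_wpM2l//; lra.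
have gT0 : 0 <= G * (qm - qp + 2) by rewrite mulr_ge0//; lra.
rewrite [E * _]mulrC; lra.
Qed.

End FlowEstimate.

Section Contraction.
Context (R : realType).

(** Squaring [x / 2 <= exp (x / 2)] gives [x ^ 2 / 4 <= exp x], which outgrows any affine function.
    The bound [1 / 4] lets two such terms share a factor [1 / 2]. *)
Lemma expR_beats_linear (mu a d : R) : 0 < mu -> 0 <= a -> 0 <= d ->
  exists2 X, 1 <= X & forall x, X <= x -> expR (- (mu * x)) * (a + d * x) <= 4^-1.
Proof.
move=> mu0 a0 d0; exists (Num.max 1 (16 * (a + d) / mu ^+ 2)); first by rewrite le_max lexx.
move=> x; rewrite ge_max => /andP[x1 xX].
have x0 : 0 < x by exact: lt_le_trans x1.
have mx : 0 < mu * x by rewrite mulr_gt0.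
rewrite expRN mulrC ler_pdivrMr ?expR_gt0//.
have e1 : (mu * x) ^+ 2 / 4 <= expR (mu * x).
  have e2 : mu * x / 2 <= expR (mu * x / 2).
    by apply: le_trans (expR_ge1Dx _); rewrite lerDr.
  have -> : (mu * x) ^+ 2 / 4 = (mu * x / 2) * (mu * x / 2) by field.
  rewrite -[X in expR X](_ : mu * x / 2 + mu * x / 2 = _); last by field.
  by rewrite expRD; apply: ler_pM => //; rewrite divr_ge0// ltW.
apply: le_trans (_ : 4^-1 * ((mu * x) ^+ 2 / 4) <= _); last by rewrite ler_wpM2l ?invr_ge0.
move: xX; rewrite ler_pdivrMr ?exprn_gt0// => xX.
have : a + d * x <= (a + d) * x by rewrite mulrDl lerD2r ler_peMr.
have : 16 * ((a + d) * x) <= (mu * x) ^+ 2.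
  have -> : 16 * ((a + d) * x) = 16 * (a + d) * x by ring.
  have -> : (mu * x) ^+ 2 = x * mu ^+ 2 * x by ring.
  by rewrite ler_pM2r.
lra.
Qed.

(** The point [s] may be an end of the segment, so the interval is placed beside [s], on the side
    facing the midpoint. *)
Lemma positive_on_segment (f : R -> R) (a b s : R) : continuous f -> a < b ->
  a <= s <= b -> f s != 0 -> exists m s1 s2, [/\ 0 < m, a < s1, s1 < s2, s2 < b &
    forall t, s1 <= t <= s2 -> m <= f t ^+ 2].
Proof.
move=> fc ab /andP[as_ sb] fs.
pose h t := f t ^+ 2; have hs : 0 < h s / 2 by rewrite divr_gt0// exprn_even_gt0.
have hc : {for s, continuous h} by apply: cvgM; exact: fc.
have /cvgrPdist_lt/(_ _ hs)/nbhs_normP[d /= d0 dP] := hc.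
pose r := Num.min d (b - a) / 4.
have [r0 r1 r2] : [/\ 0 < r, 2 * r < d & 2 * r < b - a].
  have m0 : 0 < Num.min d (b - a) by rewrite lt_min d0 subr_gt0.
  have : Num.min d (b - a) <= d by rewrite ge_min lexx.
  have : Num.min d (b - a) <= b - a by rewrite ge_min lexx orbT.
  by rewrite /r; move: m0; set mm := Num.min _ _; split; lra.
have near_s t : `|s - t| < d -> h s / 2 <= f t ^+ 2.
  by move=> /dP; rewrite ltr_distl => /andP[_]; rewrite -/(h t); lra.
have r3 : 4 * r <= b - a.
  have : Num.min d (b - a) <= b - a by rewrite ge_min lexx orbT.
  by rewrite /r; lra.
have [smid|smid] := leP s ((a + b) / 2).
  exists (h s / 2), (s + r), (s + 3 / 2 * r); split=> //; try lra.
  by move=> t /andP[t1 t2]; apply: near_s; rewrite ltr_norml; apply/andP; split; lra.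
exists (h s / 2), (s - 3 / 2 * r), (s - r); split=> //; try lra.
by move=> t /andP[t1 t2]; apply: near_s; rewrite ltr_norml; apply/andP; split; lra.
Qed.

(** The weight [L] absorbs the effect of [(h, h')] on the next [(b, c)], which is bounded but not
    small. *)
Definition weighted_norm n (L : R) (y : ycoord R n) :=
  Num.max (Num.max `|y.1.2| `|y.2|) (L * `|y.1.1|).

Lemma weighted_norm_ge n (L : R) (y : ycoord R n) : 1 <= L -> `|y| <= weighted_norm L y.
Proof.
move=> L1; have H : `|y.1.1| <= L * `|y.1.1| by rewrite ler_peMl.
apply/prod_norm_leP; split; [apply/prod_norm_leP; split|].
- by rewrite !le_max H orbT.
- by rewrite !le_max lexx.
- by rewrite !le_max lexx orbT.
Qed.

Lemma weighted_norm_le n (L : R) (y : ycoord R n) : 1 <= L -> weighted_norm L y <= L * `|y|.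
Proof.
move=> L1; have [yb yc] := (prod_norm_leP y _).1 (lexx _).
have [yh yb'] := (prod_norm_leP y.1 _).1 yb.
have Ly : `|y| <= L * `|y| by rewrite ler_peMl.
rewrite /weighted_norm !ge_max (le_trans yb' Ly) (le_trans yc Ly)/=.
by rewrite ler_wpM2l// (le_trans ler01).
Qed.

(* [X], [H] bound [(b, c)] and [(h, h')] before the step, primes are after it. *)
Lemma weighted_contraction (X H C3 b' c' H' : R) : 0 <= X -> 0 <= H -> 0 <= C3 ->
  b' <= X / 2 + C3 * H -> c' <= X / 2 + C3 * H -> H' <= H / 4 ->
  Num.max (Num.max b' c') ((4 * C3 + 1) * H') <=
    3 / 4 * Num.max X ((4 * C3 + 1) * H).
Proof.
(* With the weight [4 * C3 + 1], the term [C3 * H] is at most a quarter of [N], whence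
   [1 / 2 + 1 / 4]. *)
move=> X0 H0 C30 bb cc HH; set N := Num.max X _.
have NX : X <= N by rewrite le_max lexx.
have NH : (4 * C3 + 1) * H <= N by rewrite le_max lexx orbT.
have L0 : 0 <= 4 * C3 + 1 by lra.
have LH : (4 * C3 + 1) * H' <= (4 * C3 + 1) * (H / 4) by rewrite ler_wpM2l.
by rewrite !ge_max; apply/andP; split; first (apply/andP; split); lra.
Qed.

End Contraction.

(** * Choice of the gains and conclusion *)

Section Main.
Context (R : realType) (n : nat) (rb : robot R n) (hrb : robot_hyp rb)
  (rf : references R n) (hrf : references_hyp rb rf) (g0 : gains R n)
  (hW : impact_invariant rb (Wman rb rf)) (hZ : impact_invariant rb (Zman rb rf g0))
  (qp qm : R) (hstep : nominal_step rb rf qp qm).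

(** The margin of 1 on both sides covers steps that start before [qp] or end after [qm]. *)
Lemma reference_bounds : exists v0 v1 S1 M0, [/\ 0 < v0,
  forall s, qp - 1 <= s <= qm + 1 -> v0 <= Vref rf s <= v1,
  forall s, qp - 1 <= s <= qm + 1 -> `|derive1 (Sref rf) s| <= S1,
  0 <= M0 & forall h s, `|f2 rf h s| <= M0].
Proof.
have [_ _ qpm _ _] := hstep.
have ab : qp - 1 <= qm + 1 by lra.
have Vc : continuous (Vref rf) := smooth_continuous (Vref_smooth hrf).
have Sc : continuous (derive1 (Sref rf)) := smooth_continuous (smooth_derive1 (Sref_smooth hrf)).
have [c1 _ c1P] := EVT_min ab (continuous_subspaceT Vc).
have [c2 _ c2P] := EVT_max ab (continuous_subspaceT Vc).
have nSc : continuous (fun s => `|derive1 (Sref rf) s|) by move=> s; exact: (cvg_norm (Sc s)).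
have [c3 _ c3P] := EVT_max ab (continuous_subspaceT nSc).
have [M0 M0P] := f2_bounded hrf.
exists (Vref rf c1), (Vref rf c2), `|derive1 (Sref rf) c3|, M0; split=> //.
- exact: Vref_gt0 hrf _.
- by move=> s sab; rewrite c1P ?c2P// in_itv.
- apply: le_trans (M0P 0 0); exact: normr_ge0.
Qed.

Lemma quarter_sum (X w1 w2 w3 : R) :
  X / 4 + w1 + (w2 + (X / 4 + w3)) <= X / 2 + (w1 + w2 + w3).
Proof. lra. Qed.

Lemma quarter_le_half (X : R) : 0 <= X -> X / 4 <= X / 2.
Proof. lra. Qed.

(* [y] is [|b|] or [|c|] just after the impact, [x] its value at the next one. *)
Lemma le_quarter (X H a C EX x y : R) : 0 <= X -> 0 <= H -> 0 <= C ->
  0 <= EX <= 1 -> EX * a <= 4^-1 -> x <= y * EX -> y <= a * X + C * H ->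
  x <= X / 4 + C * H.
Proof.
move=> X0 H0 C0 /andP[E0 E1] Ea xy ya; apply: (le_trans xy).
apply: (le_trans (ler_wpM2r E0 ya)); rewrite mulrDl; apply: lerD.
  by rewrite mulrAC [a * _]mulrC [leRHS]mulrC ler_wpM2r.
by rewrite ler_piMr// mulr_ge0.
Qed.

(* The constants are chosen in the order [eps = gamma / beta0], [be = beta0],
   [k] (for [KP] and [KV]), and the weight of [(h, h')] in the norm last. *)
Lemma step_contraction : (exists s, qp <= s <= qm /\ k2 rb rf 0 s != 0) ->
  exists g L C1 rho, [/\ admissible g, 1 <= L, 0 <= C1, 0 < rho &
    forall z, y_surface rb rf g z -> `|z.1 - qm| < rho -> `|z.2| < rho ->
    exists z', [/\ poincare rb rf g z z', `|z'.1 - qm| <= C1 * `|z'.2| &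
      weighted_norm L z'.2 <= 3 / 4 * weighted_norm L z.2] ].
Proof.
move=> [s0 [s0pm k20]]; have [_ _ qpm _ _] := hstep.
have S0 : derive1 (Sref rf) s0 != 0.
  by apply: contra k20 => /eqP S0; rewrite -(Sref_eq hrf) S0 mul0r.
have Sc : continuous (derive1 (Sref rf)) := smooth_continuous (smooth_derive1 (Sref_smooth hrf)).
have [m [s1 [s2 [m0 s1p s12 s2m mb]]]] := positive_on_segment Sc qpm s0pm S0.
have [v0 [v1 [S1 [M0 [v00 Vb Sb M00 f2b]]]]] := reference_bounds.
have S10 : 0 <= S1.
  by apply: (le_trans (normr_ge0 _) (Sb qm _)); apply/andP; split; lra.
have v10 : 0 < v1.
  have /Vb/andP[] : qp - 1 <= qm <= qm + 1 by apply/andP; split; lra.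
  by move=> a1 a2; lra.
pose x0 := (2 * v1)^-1; have x00 : 0 < x0 by rewrite invr_gt0 mulr_gt0.
pose x1 := 2 / v0; have x10 : 0 < x1 by rewrite divr_gt0.
pose l := (qm - qp) / 2; have l0 : 0 < l by rewrite divr_gt0// subr_gt0.
pose A := `|bfst (impact_dir rb rf qm)|; pose B := `|blst (impact_dir rb rf qm)|.
pose Sm := `|derive1 (Sref rf) qm|; pose Sp := `|derive1 (Sref rf) qp|.
have [A0 B0 Sm0 Sp0] : [/\ 0 <= A, 0 <= B, 0 <= Sm & 0 <= Sp] by rewrite !normr_ge0.
have mu0 : 0 < x0 * m * (s2 - s1) by rewrite !mulr_gt0// subr_gt0.
(* The affine factor is [1 + U * A] below: up to terms in [(h, h')], the impact leaves [|b|] at most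
   this times the maximum of [|b|] and [|c|]. The exponential is the damping gained on
   [[s1, s2]]. *)
have [eps eps1 epsP] : exists2 eps, 1 <= eps &
    expR (- (x0 * m * (s2 - s1) * eps)) * (1 + A + A * Sm * eps) <= 4^-1.
  have [||X X1 XP] := expR_beats_linear mu0 (a := 1 + A) (d := A * Sm).
  - by rewrite addr_ge0.
  - by rewrite mulr_ge0.
  - by exists X => //; exact: XP.
have eps0 : 0 < eps by exact: lt_le_trans eps1.
pose U := 1 + eps * Sm; have U0 : 0 <= U by rewrite addr_ge0// mulr_ge0// ltW.
(* The analogous amplification factor for [c]. *)
pose Kc := U * B + eps * Sp * (1 + U * A).
have Kc0 : 0 <= Kc by rewrite !(addr_ge0, mulr_ge0)// ltW.
(* The gains 1, 1 stand for any [be] and [k]: the impact depends on the ratio [eps] only, so [C] is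
   available before [be] and [k] are chosen. *)
have [C [d1 [C0 d10 impP]]] := impact_estimate hrb hrf hW hZ hstep (decoupled_gains n eps 1 1).
(* The first condition damps [c] over the step; the second makes its accumulated effect on [b], of
   order [1 / be], small. *)
have [be be1 [beP beP']] : exists2 be, 1 <= be &
    expR (- (x0 * l * be)) * Kc <= 4^-1 /\ 3 * (x1 * S1 * Kc / (be * x0)) <= 4^-1.
  have [X X1 XP] := expR_beats_linear (mulr_gt0 x00 l0) Kc0 (lexx 0).
  pose Y := 12 * (x1 * S1 * Kc / x0).
  exists (Num.max X Y); first by rewrite le_max X1.
  split; first by have := XP (Num.max X Y); rewrite mul0r addr0; apply; rewrite le_max lexx.
  have be0 : 0 < Num.max X Y by rewrite lt_max (lt_le_trans _ X1).
  rewrite [_ * x0]mulrC invfM !mulrA ler_pdivrMr//.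
  have : Y <= Num.max X Y by rewrite le_max lexx orbT.
  rewrite /Y !mulrA; lra.
have be0 : 0 < be by exact: lt_le_trans be1.
(* [7 * k] is the overshoot of [(h, h')] in [decay_h], and [C] its amplification at the impact. *)
have [k k1 kP] : exists2 k, 1 <= k & expR (- (x0 * l * k)) * (7 * C * k) <= 4^-1.
  have [|X X1 XP] := expR_beats_linear (mulr_gt0 x00 l0) (lexx 0) (d := 7 * C).
  - by rewrite mulr_ge0.
  - by exists X => //; have := XP X; rewrite add0r; apply.
have k0 : 0 < k by exact: lt_le_trans k1.
pose g := decoupled_gains n eps be k.
have ratioE : ratio g = ratio (decoupled_gains n eps 1 1).
  by rewrite !ratio_decoupled ?oner_neq0// lt0r_neq0.
have ratio_g : ratio g = eps by rewrite ratio_decoupled// lt0r_neq0.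
have [C1 [d2 [C10 d20 transP]]] := transversality hrb hrf g0 hstep.
(* All but the last entry serve the decay estimates; [d2] makes [transversality] applicable at the
   next impact. *)
pose eta := Num.min (Num.min (Num.min 1 ((qm - qp) / 4)) (Num.min (s1 - qp) (qm - s2)))
  (Num.min (v0 / 2 / (1 + eps * S1)) d2).
have V1 : 0 < 1 + eps * S1 by rewrite ltr_pwDl// mulr_ge0// ltW.
have eta0 : 0 < eta.
  by rewrite !lt_min ltr01 d20 !subr_gt0 s1p s2m !divr_gt0// subr_gt0.
have [e1 e2 e3 e4 [e5 e6]] : [/\ eta <= 1, eta <= (qm - qp) / 4, eta <= s1 - qp,
    eta <= qm - s2 & eta <= v0 / 2 / (1 + eps * S1) /\ eta <= d2].
  by split; [| | | |split]; rewrite /eta !ge_min !lexx ?orbT.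
have e5' : eta * (1 + eps * S1) <= v0 / 2 by rewrite -ler_pdivlMr.
have [dl dl0 retP] := return_map hrb hrf hZ hstep g eta0.
pose T := qm - qp + 2.
(* The effect of [(h, h')] on the next [b]: directly at the impact, through the forcing by [h], and
   through the [c] created at the impact. *)
pose C2 := C + 3 * (x1 * (n%:R * (5 * C * M0)) * T) + 3 * (x1 * S1 * C / (be * x0)).
have T0 : 0 <= T by apply: addr_ge0 => //; rewrite subr_ge0 ltW.
have bx0 : 0 < be * x0 by rewrite mulr_gt0.
have q1 : 0 <= 3 * (x1 * (n%:R * (5 * C * M0)) * T).
  apply: mulr_ge0 => //; apply: mulr_ge0 => //; apply: mulr_ge0; first exact: ltW.
  by apply: mulr_ge0 => //; apply: mulr_ge0 => //; exact: mulr_ge0.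
have q2 : 0 <= 3 * (x1 * S1 * C / (be * x0)).
  apply: mulr_ge0 => //; apply: divr_ge0; last exact: ltW.
  by apply: mulr_ge0 => //; apply: mulr_ge0 => //; exact: ltW.
have C20 : 0 <= C2 by apply: addr_ge0 => //; exact: addr_ge0.
exists g, (4 * C2 + 1), C1, (Num.min dl d1); split => //.
- exact: decoupled_admissible.
- by rewrite lerDr mulr_ge0.
- by rewrite lt_min dl0.
move=> z zs; rewrite !lt_min => /andP[z1 z2] /andP[z3 z4].
case E : (impact_y rb rf g z) => [sp yp].
have [e [Y [[spq spe eqm Yc Ysp] Yd Yb zP _]]] := retP z sp yp zs z1 z3 E.
have Yb' s : sp <= s <= e -> `|Y s| < eta by move=> /Yb[].
exists (e, Y e); split=> //=.
  have [_ /surface_state_of_y[_ Pe _] _ _] := zP.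
  have eb : `|Y e| < eta by apply: Yb'; rewrite lexx ltW.
  apply: (le_trans (transP (e, Y e) Pe (lt_le_trans eqm e6) (lt_le_trans eb e6))).
  rewrite ler_wpM2l//.
  have [/prod_norm_leP[/prod_norm_leP[? _] _] _] := (prod_norm_leP (Y e) _).1 (lexx _).
  done.
set u := z.2.2 + eps * derive1 (Sref rf) qm * z.2.1.2.
set bp := z.2.1.2 + u * bfst (impact_dir rb rf qm).
have [Hp_le bp_le cp_le] : [/\ `|yp.1.1| <= C * `|z.2.1.1|, `|yp.1.2 - bp| <= C * `|z.2.1.1| &
      `|yp.2 - (u * blst (impact_dir rb rf qm) - eps * derive1 (Sref rf) qp * bp)|
        <= C * `|z.2.1.1| ].
  have := impP z sp yp u bp _ z2 z4; rewrite -ratioE ratio_g; apply=> //.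
    by rewrite /y_surface/= -(state_of_y_ratio rf ratioE).
  by rewrite -(impact_y_ratio rb rf ratioE).
have spe' : sp <= e <= e by rewrite lexx ltW.
have le_e := length_ge e2 spq eqm; rewrite -/l in le_e.
have cE := decay_c v00 Vb Sb s1p s12 s2m eps0 be0 e1 e5' spq eqm Yc Yd Yb' spe'.
have [hE _] := decay_h v00 Vb Sb s1p s12 s2m eps0 be0 k1 e1 e5' spq eqm Yc Yd Yb' spe'.
have bE := decay_b v00 Vb Sb M00 f2b (ltW m0) mb s1p s12 s2m eps0 be0 k1 e1 e3 e4 e5'
  spq spe eqm Yc Yd Yb'.
rewrite Ysp -/x0 in cE hE bE; rewrite -/x1 -/T in bE.
pose X := Num.max `|z.2.1.2| `|z.2.2|; pose H := `|z.2.1.1|.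
have X0 : 0 <= X by rewrite le_max normr_ge0.
have H0 : 0 <= H by exact: normr_ge0.
have bX : `|z.2.1.2| <= X by rewrite le_max lexx.
have cX : `|z.2.2| <= X by rewrite le_max lexx orbT.
have uX : `|u| <= U * X.
  rewrite /U mulrDl mul1r; apply: (le_trans (ler_normD _ _)); apply: lerD => //.
  by rewrite !normrM (gtr0_norm eps0) ler_wpM2l// mulr_ge0// ltW.
have bpX : `|bp| <= (1 + U * A) * X.
  rewrite mulrDl mul1r; apply: (le_trans (ler_normD _ _)); apply: lerD => //.
  by rewrite normrM mulrAC; apply: ler_pM.
have cpX : `|u * blst (impact_dir rb rf qm) - eps * derive1 (Sref rf) qp * bp| <= Kc * X.
  rewrite [leRHS]mulrDl; apply: (le_trans (ler_normB _ _)); apply: lerD.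
    by rewrite normrM mulrAC; apply: ler_pM.
  rewrite !normrM (gtr0_norm eps0) -[leRHS]mulrA; apply: ler_wpM2l; last exact: bpX.
  by apply: mulr_ge0 => //; exact: ltW.
have ypb : `|yp.1.2| <= (1 + U * A) * X + C * H.
  by rewrite -[yp.1.2](subrK bp) addrC (le_trans (ler_normD _ _))// lerD.
have ypc : `|yp.2| <= Kc * X + C * H.
  move: cpX cp_le; set w := u * _ - _ => cpX cp_le.
  by rewrite -[yp.2](subrK w) addrC (le_trans (ler_normD _ _))// lerD.
have CH0 : 0 <= C * H by rewrite mulr_ge0.
have exp_le (r : R) : 0 <= r -> 0 <= expR (- r) <= 1.
  by move=> r0; rewrite expR_ge0 -expR0 ler_expR oppr_le0.
have cR : `|(Y e).2| <= X / 4 + C * H.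
  apply: (@le_quarter X H Kc C (expR (- (x0 * l * be))) _ `|yp.2|) => //.
    by apply: exp_le; apply: mulr_ge0; [apply: mulr_ge0|]; exact: ltW.
  apply: (le_trans cE); apply: ler_wpM2l => //; rewrite ler_expR mulNr lerN2.
  have -> : x0 * l * be = be * x0 * l by ring.
  by apply: ler_wpM2l => //; exact: ltW.
have hR : `|(Y e).1.1| <= H / 4.
  apply: (le_trans hE).
  have Ek : expR (- (k * x0) * (e - sp)) <= expR (- (x0 * l * k)).
    rewrite ler_expR mulNr lerN2.
    have -> : x0 * l * k = k * x0 * l by ring.
    by apply: ler_wpM2l => //; apply: mulr_ge0; exact: ltW.
  apply: (@le_trans _ _ (7 * k * expR (- (x0 * l * k)) * (C * H))).
    have k7 : 0 <= 7 * k by apply: mulr_ge0 => //; exact: ltW.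
    by apply: ler_pM => //; [rewrite mulr_ge0// expR_ge0|exact: ler_wpM2l].
  have -> : 7 * k * expR (- (x0 * l * k)) * (C * H) =
    expR (- (x0 * l * k)) * (7 * C * k) * H by ring.
  by rewrite [leRHS]mulrC; apply: ler_wpM2r.
(* One quarter of [X] comes from the damped [b], the other from the forcing by [c]. *)
have bR : `|(Y e).1.2| <= X / 2 + C2 * H.
  have b1 : expR (- (x0 * eps * m) * (s2 - s1)) * `|yp.1.2| <= X / 4 + C * H.
    have Ee : expR (- (x0 * eps * m) * (s2 - s1)) = expR (- (x0 * m * (s2 - s1) * eps)).
      by congr expR; ring.
    apply: (@le_quarter X H (1 + U * A) C (expR (- (x0 * m * (s2 - s1) * eps))) _ `|yp.1.2|) => //.
    - by apply: exp_le; apply: mulr_ge0; exact: ltW.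
    - suff -> : 1 + U * A = 1 + A + A * Sm * eps by [].
      by rewrite /U; ring.
    - by rewrite Ee mulrC.
  have b2 : 3 * (x1 * (n%:R * (5 * `|yp.1.1| * M0)) * T) <=
      3 * (x1 * (n%:R * (5 * C * M0)) * T) * H.
    have -> : 3 * (x1 * (n%:R * (5 * C * M0)) * T) * H =
      3 * (x1 * (n%:R * (5 * (C * H) * M0)) * T) by ring.
    apply: ler_wpM2l => //; apply: ler_wpM2r => //; apply: ler_wpM2l; first exact: ltW.
    by apply: ler_wpM2l => //; apply: ler_wpM2r => //; exact: ler_wpM2l.
  have b3 : 3 * (x1 * S1 * `|yp.2| / (be * x0)) <= X / 4 + 3 * (x1 * S1 * C / (be * x0)) * H.
    have xS : 0 <= x1 * S1 by apply: mulr_ge0 => //; exact: ltW.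
    apply: (@le_trans _ _ (3 * (x1 * S1 * (Kc * X + C * H) / (be * x0)))).
      apply: ler_wpM2l => //; apply: ler_wpM2r; first by rewrite invr_ge0 ltW.
      exact: ler_wpM2l.
    have -> : 3 * (x1 * S1 * (Kc * X + C * H) / (be * x0)) =
      3 * (x1 * S1 * Kc / (be * x0)) * X + 3 * (x1 * S1 * C / (be * x0)) * H.
      by move: (be * x0)^-1 => w; ring.
    by rewrite lerD2r [leRHS]mulrC; apply: ler_wpM2r.
  apply: (le_trans bE); rewrite [3 * (_ + _)]mulrDr.
  have distr a1 a2 a3 : (a1 + a2 + a3) * H = a1 * H + a2 * H + a3 * H by rewrite !mulrDl.
  apply: (le_trans (lerD b1 (lerD b2 b3))); rewrite [C2 * H]distr.
  exact: quarter_sum.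
apply: weighted_contraction => //.
apply: (le_trans cR); apply: lerD; first exact: quarter_le_half.
by apply: ler_wpM2r => //; rewrite /C2 -addrA lerDl addr_ge0.
Qed.

End Main.


Theorem theorem1 (R : realType) (n : nat)
  (rb : robot R n) (hrb : robot_hyp rb)
  (rf : references R n) (hrf : references_hyp rb rf)
  (g0 : gains R n) (hg0 : admissible g0)
  (hW : hybrid_invariant rb rf g0 (Wman rb rf))
  (hZ : hybrid_invariant rb rf g0 (Zman rb rf g0))
  (qp qm : R) (hstep : nominal_step rb rf qp qm) :
  (forall g : gains R n, admissible g ->
     exists SP : set (R * ycoord R n), regular_on rb rf g qm SP)
  /\
  ((exists s : R, qp <= s <= qm /\ k2 rb rf 0 s != 0) ->
   exists g : gains R n, admissible g /\
     forall SP : set (R * ycoord R n), regular_on rb rf g qm SP ->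
       exists SC : set (R * ycoord R n), contracting_on rb rf g qm SP SC).
Proof.
have {}hW := hW.2; have {}hZ := hZ.2; split.
  move=> g _; have [dl dl0 H] := return_map hrb hrf hZ hstep g ltr01.
  exists (y_surface rb rf g `&` [set z | `|z.1 - qm| < dl /\ `|z.2| < dl]); split.
    split; first by move=> z [].
    by rewrite /within/=; apply: (nbhs_pair0P qm _).2; exists dl.
  move=> z [zs [z1 z2]]; case E : (impact_y rb rf g z) => [sp yp].
  have [e [Y [_ _ _ zP uniq]]] := H z sp yp zs z1 z2 E.
  by exists (e, Y e); split=> // z' /uniq.
move=> k2_neq0; have [g [L [C1 [rho [gadm L1 C10 rho0 step]]]]] :=
  step_contraction hrb hrf hW hZ hstep k2_neq0.
exists g; split=> // SP [[SPs SPn] _]; have /nbhs_pair0P[d d0 dP] := SPn.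
pose N (y : ycoord R n) := weighted_norm L y.
(* [r2 <= r1] bounds [|y|] on [SC]. The second entry bounds the [q_N] of the next impact, through
   its distance [C1 * |y|] from [qm], so that [SC] is mapped into itself. *)
pose r1 := Num.min rho d; pose r2 := Num.min r1 (r1 / (C1 + 1)).
have r10 : 0 < r1 by rewrite lt_min rho0.
have C11 : 0 < C1 + 1 by rewrite ltr_wpDl.
have r20 : 0 < r2 by rewrite lt_min r10 divr_gt0.
have L0 : 0 < L by exact: lt_le_trans L1.
pose SC := y_surface rb rf g `&` [set z | `|z.1 - qm| < r1 /\ N z.2 < r2].
have yN y : `|y| <= N y by exact: weighted_norm_ge.
have Ny y : N y <= L * `|y| by exact: weighted_norm_le.
have small z : SC z -> [/\ y_surface rb rf g z, `|z.1 - qm| < r1 & `|z.2| < r1].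
  move=> [zs [z1 z2]]; split=> //; apply: (le_lt_trans (yN _)); apply: (lt_le_trans z2).
  by rewrite ge_min lexx.
have SCSP : SC `<=` SP.
  move=> z /small[zs z1 z2]; apply: dP => //.
    by rewrite (lt_le_trans z1)// ge_min lexx orbT.
  by rewrite (lt_le_trans z2)// ge_min lexx orbT.
exists SC; split=> //.
  split; first by move=> z [].
  rewrite /within/=; apply: (nbhs_pair0P qm _).2.
  exists (Num.min r1 (r2 / L)); first by rewrite lt_min r10 divr_gt0.
  move=> z qd yd zs; split; [exact: zs|split].
    by apply: (lt_le_trans qd); rewrite ge_min lexx.
  apply: (le_lt_trans (Ny z.2)); rewrite mulrC -ltr_pdivlMr//.
  by apply: (lt_le_trans yd); rewrite ge_min lexx orbT.
(* Each step contracts the weighted norm by [3 / 4]; the factor [L] is the price of returning to the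
   maximum norm. *)
exists L, (3 / 4); split=> //; first by apply/andP; split; lra.
have /choice[next nextP] : forall z, exists z', SC z ->
    [/\ SC z', poincare rb rf g z z' & N z'.2 <= 3 / 4 * N z.2].
  move=> z; have [zC|] := pselect (SC z); last by exists z.
  have [zs z1 z2] := small z zC.
  have r1rho : r1 <= rho by rewrite ge_min lexx.
  have [z' [zz' z'q z'N]] := step z zs (lt_le_trans z1 r1rho) (lt_le_trans z2 r1rho).
  have zN : N z.2 < r2 by have [_ []] := zC.
  have N0 y : 0 <= N y by exact: le_trans (yN y).
  have z'r : N z'.2 < r2.
    by apply: (le_lt_trans z'N); apply: le_lt_trans zN; have := N0 z.2; rewrite /N; lra.
  exists z' => _; split=> //; split; first by have [] := zz'.
  split=> //; apply: (le_lt_trans z'q).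
  have : `|z'.2| < r1 / (C1 + 1).
    by apply: (le_lt_trans (yN _)); apply: (lt_le_trans z'r); rewrite ge_min lexx orbT.
  rewrite ltr_pdivlMr// mulrDr mulr1 mulrC; apply: le_lt_trans.
  by rewrite lerDl.
move=> z zC; pose zs k := iter k next z.
have zsC k : SC (zs k) by elim: k => // k /nextP[].
exists zs; split=> // k.
  by split; [exact/SCSP/zsC|have [] := nextP _ (zsC k)].
apply: (le_trans (yN _)); apply: (@le_trans _ _ ((3 / 4) ^+ k * N z.2)); last first.
  by rewrite mulrAC mulrC; apply: ler_wpM2r => //; rewrite exprn_ge0// divr_ge0.
elim: k => [|k IH]; first by rewrite expr0 mul1r.
have [_ _ H] := nextP _ (zsC k); apply: (le_trans H).
by rewrite exprS -[leRHS]mulrA; apply: ler_wpM2l => //; rewrite divr_ge0.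
Qed.
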